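(* Let $0<r<R<\infty$ and $\delta\in\mathbb{R}$. There exists a large constant $C$ such that for any $\nu\ge0$, if $s\in\mathbb{N}$ satisfies $s>C(\nu^3+1)$, then within the circle $|z|=(s+1/2)\pi/(R-r)$ the function $\widetilde{\mathfrak{h}}_{\nu,\delta}(z)$ has $2s+2$ zeros if $\nu\ne|\delta|$, and $2s$ zeros if $\nu=|\delta|$ (zeros counted with multiplicity).
   Context: $J_\nu,Y_\nu$ are Bessel functions of the first and second kind of order $\nu$. The function $\widetilde{\mathfrak{h}}_{\nu,\delta}$ is $$\begin{aligned}\widetilde{\mathfrak{h}}_{\nu,\delta}(z)=&\;J_\nu'(Rz)Y_\nu'(rz)-J_\nu'(rz)Y_\nu'(Rz)+\frac{\delta^2}{Rr\,z^{2}}\left(J_\nu(Rz)Y_\nu(rz)-J_\nu(rz)Y_\nu(Rz)\right)\\&-\frac{\delta}{Rz}\left(J_\nu(Rz)Y_\nu'(rz)-J_\nu'(rz)Y_\nu(Rz)\right)-\frac{\delta}{rz}\left(J_\nu'(Rz)Y_\nu(rz)-J_\nu(rz)Y_\nu'(Rz)\right),\end{aligned}$$ initially for $z>0$ and then extended analytically to the complex plane: it extends to an even single-valued analytic function on $\mathbb{C}\setminus\{0\}$ (and, when $\nu=|\delta|$, to an entire function). Equivalently, for $x>0$, $\widetilde{\mathfrak{h}}_{\nu,\delta}(x)=(Rr)^{\delta}x^{2\delta}\left(j_\nu'(Rx)y_\nu'(rx)-j_\nu'(rx)y_\nu'(Rx)\right)$ with $j_\nu(x)=x^{-\delta}J_\nu(x)$,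 $y_\nu(x)=x^{-\delta}Y_\nu(x)$. The constant $C$ may depend on $r,R,\delta$ but not on $\nu$ or $s$. *)

(* Defs.v *)
From Stdlib Require Import Reals Factorial List ClassicalEpsilon.
From Coquelicot Require Import Coquelicot.
Open Scope R_scope.

(** [1 / Gamma x] by Gauss's product; it converges for every real [x] and
    vanishes at the poles [0, -1, -2, ...] of Gamma. *)
Definition rGamma (x : R) : R :=
  real (Lim_seq (fun n : nat =>
    prod_f_R0 (fun k : nat => x + INR k) n
      / (INR (fact n) * Rpower (INR n) x))).

(** Real order [nu], meaningful for [x > 0]. *)
Definition besselJ (nu x : R) : R :=
  Rpower (x / 2) nu *
  Series (fun k : nat =>
    (-1) ^ k / INR (fact k) * rGamma (INR k + nu + 1) * (x / 2) ^ (2 * k)).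

Definition besselY_quot (nu x : R) : R :=
  (besselJ nu x * cos (nu * PI) - besselJ (- nu) x) / sin (nu * PI).

(** At an integer order the quotient is 0/0 and [Y] is its limit in the order. *)
Definition besselY (nu x : R) : R :=
  if Req_EM_T (frac_part nu) 0
  then real (Lim (fun mu : R => besselY_quot mu x) nu)
  else besselY_quot nu x.

Definition besselJ' (nu x : R) : R := Derive (besselJ nu) x.
Definition besselY' (nu x : R) : R := Derive (besselY nu) x.

(** [a] and [b] are the outer and inner radii ([R] and [r] in the usual
    notation for the annulus); meaningful for [x > 0]. *)
Definition h_real (a b nu delta x : R) : R :=
  besselJ' nu (a * x) * besselY' nu (b * x)
  - besselJ' nu (b * x) * besselY' nu (a * x)
  + delta ^ 2 / (a * b * x ^ 2)
    * (besselJ nu (a * x) * besselY nu (b * x)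
       - besselJ nu (b * x) * besselY nu (a * x))
  - delta / (a * x)
    * (besselJ nu (a * x) * besselY' nu (b * x)
       - besselJ' nu (b * x) * besselY nu (a * x))
  - delta / (b * x)
    * (besselJ' nu (a * x) * besselY nu (b * x)
       - besselJ nu (b * x) * besselY' nu (a * x)).

Definition taylor_at (f : C -> C) (z0 : C) (c : nat -> C) : Prop :=
  exists eps : R, 0 < eps /\
    forall z : C, Cmod (z - z0) < eps ->
      @is_pseries C_AbsRing C_NormedModule c (z - z0)%C (f z).

Definition analytic_at (f : C -> C) (z0 : C) : Prop :=
  exists c : nat -> C, taylor_at f z0 c.

(** Domain of the extension: the punctured plane, and the whole plane when
    [nu = |delta|]. *)
Definition h_dom (nu delta : R) (z : C) : Prop :=
  z <> RtoC 0 \/ nu = Rabs delta.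

Definition is_h_extension (a b nu delta : R) (h : C -> C) : Prop :=
  (forall z : C, h_dom nu delta z -> analytic_at h z) /\
  (forall x : R, 0 < x -> h (RtoC x) = RtoC (h_real a b nu delta x)).

(** The analytic extension of [h_real]. The identity theorem makes it unique on
    [h_dom nu delta]; its value at 0 is arbitrary when [nu <> |delta|]. *)
Definition h_tilde (a b nu delta : R) : C -> C :=
  epsilon (inhabits (fun _ : C => RtoC 0)) (is_h_extension a b nu delta).

Definition zero_of_order (f : C -> C) (z0 : C) (m : nat) : Prop :=
  (0 < m)%nat /\
  exists c : nat -> C, taylor_at f z0 c /\
    (forall k : nat, (k < m)%nat -> c k = RtoC 0) /\ c m <> RtoC 0.

(** [l] lists the distinct zeros of [f] in [D], each with its multiplicity. *)
Definition number_of_zeros (f : C -> C) (D : C -> Prop) (N : nat) : Prop :=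
  exists l : list (C * nat),
    NoDup (map fst l) /\
    (forall z : C, In z (map fst l) <-> D z /\ f z = RtoC 0) /\
    (forall (z : C) (m : nat), In (z, m) l -> zero_of_order f z m) /\
    list_sum (map snd l) = N.

(* Main.v *)
Require Import Defs.
From Stdlib Require Import Reals Factorial ZArith List Lra Lia Classical ClassicalEpsilon.
From Stdlib Require Ranalysis5.
From Coquelicot Require Import Coquelicot.
Open Scope R_scope.

(** Let [D u = u' - (delta/t) u], so that
    [h(x) = DJ(Ro x) DY(r x) - DJ(r x) DY(Ro x)].  Let [u(t; lam)] solve
    [u'' + u'/t + (lam - nu^2/t^2) u = 0] with [u = 1], [D u = 0] at [t = r], and put
    [F(lam) = Ro (D u)(Ro; lam)].  Comparing [u] with [J] and [Y] through constant
    Wronskians gives [h(x) = const F(x^2) / x^2] with a nonzero constant.  Now [F] is the entire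
    characteristic function of a regular Sturm-Liouville problem: its zeros are real
    (Green's identity), simple (Lagrange's identity), and [F(0) = 0] iff [nu = |delta|].
    Zeros are counted by the Pruefer angle [theta] of [(u, D u)] at [t = Ro], which increases
    with [lam] and crosses a multiple of [PI] exactly at a zero of [F].  With
    [w = (s + 1/2) PI / (Ro - r)], [theta] lies in [(-PI, 0)] at [lam = -w^2], and in
    [(s PI, (s+1) PI)] at [lam = w^2] by the modified Pruefer equation
    [phi' = w - (nu^2 - 1/4) / (w t^2) cos^2 phi] for [sqrt t u].  Hence [F] has exactly
    [s + 1] zeros with [|lam| < w^2], and [h] has two zeros for each nonzero one.

    Everything is done in the variable [x = ln t]; [nu] integer is reached as a limit in the
    order, where [Y_0] is a multiple of [dJ_nu/dnu] at [nu = 0]. *)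

(** The disk is complex, whereas oscillation arguments are real. So [u] is built as a power series
    in [lam] whose coefficients are real functions of [x], obtained by iterated integration. Summing
    it against arbitrary real weights in place of [lam ^ k] treats real [lam], the derivative in
    [lam], and the real and imaginary parts at complex [lam] by one set of differential equations.
    Multiplicities are read off the first Taylor coefficient, nonzero by simplicity. Angles are
    integrals of their derivatives, so no branch is chosen; two of them are compared by showing that
    their vectors are never opposite. At the top end the radius makes the unperturbed phase equal to
    [(s + 1/2) PI], the middle between two multiples of [PI]; the threshold on [s] keeps the
    perturbation, of order [nu^2 / (w r)], and an initial phase below half a radian, and the cube
    enters through [nu^2 <= nu^3 + 1]. Division by [x^2] removes the eigenvalue 0: when
    [nu = |delta|] the origin is in the domain, but the quotient there is a nonzero multiple of
    [F'(0)], which is not zero. *)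

(** * Series: tails, dominated convergence, termwise differentiation *)

Lemma sum_n_norm_diff {K : AbsRing} {V : NormedModule K} (a : nat -> V) (B : nat -> R) (N m : nat) :
  (forall k, norm (a k) <= B k) ->
  norm (minus (sum_n a (N + m)) (sum_n a N)) <= sum_n B (N + m) - sum_n B N.
Proof.
  intros HB. induction m as [|m IH].
  - rewrite Nat.add_0_r. rewrite minus_eq_zero. eapply Rle_trans; [apply Req_le, (@norm_zero K V)|]. lra.
  - rewrite Nat.add_succ_r, !sum_Sn.
    replace (minus (plus (sum_n a (N + m)) (a (S (N + m)))) (sum_n a N))
      with (plus (minus (sum_n a (N + m)) (sum_n a N)) (a (S (N + m)))).
    + eapply Rle_trans; [apply norm_triangle|].
      specialize (HB (S (N + m))). change (norm (minus (sum_n a (N + m)) (sum_n a N)) + norm (a (S (N + m))) <= (sum_n B (N + m) + B (S (N + m))) - sum_n B N). lra.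
    + unfold minus. rewrite <- !plus_assoc. f_equal. apply plus_comm.
Qed.

Lemma series_tail_le {K : AbsRing} {V : NormedModule K} (a : nat -> V) (S0 : V) (B : nat -> R) (SB : R) (N : nat) :
  is_series a S0 -> is_series B SB -> (forall k, norm (a k) <= B k) ->
  norm (minus S0 (sum_n a N)) <= SB - sum_n B N.
Proof.
  intros Ha HSB HB.
  apply le_epsilon; intros eps Heps.
  assert (Hl : locally_norm S0 (ball_norm S0 (mkposreal eps Heps))) by apply locally_norm_ball_norm.
  apply locally_le_locally_norm in Hl.
  apply Ha in Hl. destruct Hl as [n0 Hn0].
  assert (HBi : forall n, sum_n B n <= SB).
  { intros n. apply is_lim_seq_incr_compare with (u := sum_n B); [exact HSB|].
    intros k. rewrite sum_Sn. unfold plus; simpl.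
    specialize (HB (S k)). pose proof (norm_ge_0 (a (S k))). lra. }
  set (m := n0).
  specialize (Hn0 (N + m)%nat ltac:(unfold m; lia)). unfold ball_norm in Hn0; simpl in Hn0.
  pose proof (sum_n_norm_diff a B N m HB) as H1. specialize (HBi (N + m)%nat).
  replace (minus S0 (sum_n a N)) with
    (plus (minus S0 (sum_n a (N + m))) (minus (sum_n a (N + m)) (sum_n a N))).
  - eapply Rle_trans; [apply norm_triangle|].
    rewrite <- norm_opp in Hn0. rewrite opp_minus in Hn0. lra.
  - rewrite <- minus_trans. reflexivity.
Qed.

Lemma ex_series_le_R (a b : nat -> R) :
  (forall n, Rabs (a n) <= b n) -> ex_series b -> ex_series a.
Proof. exact (ex_series_le (V := R_CompleteNormedModule) a b). Qed.

Lemma ex_series_scal_R (c : R) (a : nat -> R) : ex_series a -> ex_series (fun k => c * a k).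
Proof. exact (ex_series_scal (V := R_NormedModule) c a). Qed.

Lemma ex_series_ext_R (a b : nat -> R) : (forall n, a n = b n) -> ex_series a -> ex_series b.
Proof. exact (ex_series_ext a b). Qed.

(** Dominated convergence for series, by cutting at an [N] beyond which the majorant [B] has tail
    below [eps / 3]. The filter is left abstract because three kinds of limit are taken with it:
    difference quotients, joint continuity in two real variables, and the partial sums of a
    rearranged complex double series. *)
Lemma tannery {K : AbsRing} {V : NormedModule K} {T : Type} (Fl : (T -> Prop) -> Prop) {FF : Filter Fl}
  (a : T -> nat -> V) (S : T -> V) (a0 : nat -> V) (S0 : V) (B : nat -> R) :
  ex_series B ->
  Fl (fun t => forall k, norm (a t k) <= B k) ->
  (forall k, norm (a0 k) <= B k) ->
  (forall k, filterlim (fun t => a t k) Fl (locally (a0 k))) ->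
  Fl (fun t => is_series (a t) (S t)) ->
  is_series a0 S0 ->
  filterlim S Fl (locally S0).
Proof.
  intros [SB HSB] Hdom Hdom0 Hlim Hser Hser0.
  intros P HP. apply locally_norm_le_locally in HP. destruct HP as [eps HP].
  assert (Heps : 0 < eps / 3) by (destruct eps as [e He]; simpl; lra).
  assert (HN : exists N, SB - sum_n B N < eps / 3).
  { destruct (HSB (ball SB (eps/3))) as [N HN].
    - apply (locally_ball SB (mkposreal _ Heps)).
    - exists N. specialize (HN N (Nat.le_refl _)). change (Rabs (sum_n B N - SB) < eps / 3) in HN. apply Rabs_def2 in HN.
      lra. }
  destruct HN as [N HN].
  assert (Hs : filterlim (fun t => sum_n (a t) N) Fl (locally (sum_n a0 N))).
  { clear HN. induction N as [|N IH].
    - rewrite sum_O. eapply filterlim_ext; [|apply (Hlim 0%nat)].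
      intros t; simpl. now rewrite sum_O.
    - rewrite sum_Sn. eapply filterlim_ext; [intros t; symmetry; apply sum_Sn|].
      eapply (filterlim_comp_2 (F := Fl)); [apply IH | apply (Hlim (Datatypes.S N)) |].
      apply filterlim_plus. }
  assert (Hs' : Fl (fun t => ball_norm (sum_n a0 N) (mkposreal _ Heps) (sum_n (a t) N))).
  { apply (Hs (ball_norm (sum_n a0 N) (mkposreal _ Heps))).
    apply locally_le_locally_norm. apply locally_norm_ball_norm. }
  unfold filtermap.   generalize (filter_and _ _ Hdom (filter_and _ _ Hser Hs')).
  apply filter_imp. intros t (H1 & H2 & H3).
  apply HP. unfold ball_norm in *; simpl in H3.
  pose proof (series_tail_le (a t) (S t) B SB N H2 HSB H1) as T1.
  pose proof (series_tail_le a0 S0 B SB N Hser0 HSB Hdom0) as T2.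
  rewrite (minus_trans (sum_n (a t) N)).
  eapply Rle_lt_trans; [apply norm_triangle|].
  rewrite (minus_trans (sum_n a0 N) (sum_n (a t) N)).
  rewrite <- (norm_opp (minus S0 (sum_n a0 N))), opp_minus in T2.
  eapply Rle_lt_trans;
    [apply Rplus_le_compat; [exact T1 | eapply Rle_trans;
      [apply norm_triangle | apply Rplus_le_compat; [apply Rlt_le, H3 | exact T2]]]|].
  simpl. lra.
Qed.

Lemma is_derive_filterlim (f : R -> R) (x l : R) :
  is_derive f x l <-> filterlim (fun h => (f (x + h) - f x) / h) (locally' 0) (locally l).
Proof.
  rewrite is_derive_Reals. split.
  - intros H. apply filterlim_locally. intros eps.
    destruct (H eps (cond_pos eps)) as [d Hd].
    exists d. intros h Hh Hne. apply Hd; [exact Hne|].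
    revert Hh. unfold ball; simpl. unfold AbsRing_ball, abs, minus, plus, opp; simpl.
    now rewrite Ropp_0, Rplus_0_r.
  - intros H eps Heps. apply filterlim_locally with (eps := mkposreal eps Heps) in H.
    destruct H as [d Hd]. exists d. intros h Hne Hh.
    apply (Hd h); [|exact Hne].
    unfold ball; simpl. unfold AbsRing_ball, abs, minus, plus, opp; simpl.
    now rewrite Ropp_0, Rplus_0_r.
Qed.

Lemma is_derive_eqr (f : R -> R) (x l l' : R) : is_derive f x l -> l = l' -> is_derive f x l'.
Proof. now intros H <-. Qed.

Ltac known_derive :=
  repeat match goal with
  | |- context [Derive ?g ?x] =>
      match goal with
      | D : is_derive ?f x ?l |- _ =>
          first [constr_eq f g | let f' := constr:(fun z : R => f z) in constr_eq f' g];
          replace (Derive g x) with l by (symmetry; exact (is_derive_unique _ _ _ D))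
      end
  end.

Lemma abs_diff_le_of_derive (f g : R -> R) (x y M : R) :
  (forall t, Rmin x y <= t <= Rmax x y -> is_derive f t (g t)) ->
  (forall t, Rmin x y <= t <= Rmax x y -> Rabs (g t) <= M) ->
  Rabs (f y - f x) <= M * Rabs (y - x).
Proof.
  intros H1 H2.
  destruct (MVT_gen f x y g) as [c [Hc E]].
  - intros t Ht. apply H1. lra.
  - intros t Ht. apply continuity_pt_filterlim. apply (ex_derive_continuous f).
    exists (g t). now apply H1.
  - rewrite E, Rabs_mult. apply Rmult_le_compat_r; [apply Rabs_pos|]. now apply H2.
Qed.

Lemma ball_R (x e y : R) : ball x e y -> Rabs (y - x) < e.
Proof. exact (fun H => H). Qed.

Lemma ball_R0 (e y : R) : ball 0 e y -> Rabs y < e.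
Proof. intros H. apply ball_R in H. now rewrite Rminus_0_r in H. Qed.

(** The mean value inequality dominates the difference quotients by [B], so this is dominated
    convergence as the increment tends to 0. *)
Lemma is_derive_series (f g : nat -> R -> R) (B : nat -> R) (x : R) (d : posreal) :
  (forall k y, Rabs (y - x) < d -> is_derive (f k) y (g k y)) ->
  (forall k y, Rabs (y - x) < d -> Rabs (g k y) <= B k) ->
  ex_series B ->
  (forall y, Rabs (y - x) < d -> ex_series (fun k => f k y)) ->
  is_derive (fun y => Series (fun k => f k y)) x (Series (fun k => g k x)).
Proof.
  intros Hd Hb HB Hex.
  assert (Hx : Rabs (x - x) < d) by (rewrite Rminus_diag, Rabs_R0; apply cond_pos).
  apply is_derive_filterlim.
  apply (tannery (locally' 0) (fun h k => (f k (x + h) - f k x) / h) _ (fun k => g k x) _ B); trivial.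
  - exists d. intros h Hh Hne k. apply ball_R0 in Hh.
    change (Rabs ((f k (x + h) - f k x) / h) <= B k).
    unfold Rdiv. rewrite Rabs_mult, Rabs_inv.
    assert (Hp : 0 < Rabs h) by now apply Rabs_pos_lt.
    apply Rmult_le_reg_r with (Rabs h); [exact Hp|].
    rewrite Rmult_assoc, Rinv_l, Rmult_1_r by lra.
    replace (Rabs h) with (Rabs (x + h - x)) by (f_equal; ring).
    assert (Hin : forall t, Rmin x (x + h) <= t <= Rmax x (x + h) -> Rabs (t - x) < d).
    { intros t Ht. unfold Rmin, Rmax in Ht. destruct (Rle_dec x (x + h)); apply Rabs_def2 in Hh; apply Rabs_def1; lra. }
    apply abs_diff_le_of_derive with (g k); intros t Ht.
    + apply Hd. now apply Hin.
    + apply Hb. now apply Hin.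
  - intros k. apply (Hb k x Hx).
  - intros k. apply -> (is_derive_filterlim (f k)). now apply Hd.
  - exists d. intros h Hh Hne. apply ball_R0 in Hh.
    assert (E1 := Hex (x + h) (eq_ind_r (fun y => Rabs y < d) Hh (Rplus_minus_l x h))).
    assert (E2 := Hex x Hx).
    apply Series_correct in E1; apply Series_correct in E2.
    pose proof (is_series_minus _ _ _ _ E1 E2) as E.
    apply (is_series_scal_r (/ h)) in E.
    exact E.
  - apply Series_correct. apply ex_series_le_R with B; [|trivial].
    intros k. apply (Hb k x Hx).
Qed.

(** * Continuous polar angles of plane curves *)

(** By the intermediate value theorem, since [Rabs (D x) - PI] never vanishes. This is the device
    for comparing two angles: the pointwise statement that two vectors are never opposite becomes a
    bound on the difference of their angles. *)
Lemma angle_trapped (D : R -> R) (a b : R) :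
  a <= b -> (forall x, a <= x <= b -> continuity_pt D x) ->
  Rabs (D a) < PI -> (forall x, a <= x <= b -> Rabs (D x) <> PI) -> Rabs (D b) < PI.
Proof.
  intros Hab Hc Ha Hn.
  destruct (Rlt_dec (Rabs (D b)) PI) as [H|H]; [exact H|exfalso].
  destruct (Req_dec a b) as [->|Hne]; [lra|].
  assert (Hb : PI < Rabs (D b)).
  { specialize (Hn b ltac:(lra)). lra. }
  destruct (Ranalysis5.IVT_interv (fun x => Rabs (D x) - PI) a b) as [z [Hz E]]; try lra.
  - intros x Hx. apply continuity_pt_minus.
    + apply (continuity_pt_comp D Rabs); [now apply Hc|apply Rcontinuity_abs].
    + apply continuity_pt_const. now intros ? ?.
  - apply (Hn z Hz). lra.
Qed.

Lemma derive_zero_const (f : R -> R) (x y : R) :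
  (forall t, is_derive f t 0) -> f y = f x.
Proof.
  intros H. apply Rminus_diag_uniq. apply Rabs_eq_0.
  apply Rle_antisym; [|apply Rabs_pos].
  replace 0 with (0 * Rabs (y - x)) by ring.
  apply abs_diff_le_of_derive with (fun _ => 0); intros; [apply H|rewrite Rabs_R0; lra].
Qed.

Lemma is_derive_RInt_R (f : R -> R) (x0 x : R) :
  (forall y : R, continuous f y) -> is_derive (fun y => RInt f x0 y) x (f x).
Proof.
  intros H. apply (is_derive_RInt f _ x0 x); [|apply H].
  exists (mkposreal 1 Rlt_0_1). intros y _. apply (RInt_correct (V := R_CompleteNormedModule)).
  apply (ex_RInt_continuous (V := R_CompleteNormedModule)).
  intros z _. apply H.
Qed.

(** The orientation is clockwise: [(p, q) = rho (cos th, - sin th)]. Integrating the derivative that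
    polar coordinates dictate gives a differentiable lift without choosing a branch of the
    arctangent; [dp] and [dq] stand for the derivatives of [p] and [q]. *)
Definition angle (p q dp dq : R -> R) (x0 th0 x : R) : R :=
  th0 + RInt (fun s => (q s * dp s - p s * dq s) / (p s ^ 2 + q s ^ 2)) x0 x.

Section AngleLift.
Variables (p q dp dq : R -> R) (x0 th0 : R).
Hypothesis Hp : forall x : R, is_derive p x (dp x).
Hypothesis Hq : forall x : R, is_derive q x (dq x).
Hypothesis Cp : forall x : R, continuous dp x.
Hypothesis Cq : forall x : R, continuous dq x.
Hypothesis Hpos : forall x, 0 < p x ^ 2 + q x ^ 2.

Lemma angle_integrand_continuous (x : R) :
  continuous (fun s => (q s * dp s - p s * dq s) / (p s ^ 2 + q s ^ 2)) x.
Proof.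
  assert (Cp0 : continuous p x) by (apply (ex_derive_continuous p); exists (dp x); apply Hp).
  assert (Cq0 : continuous q x) by (apply (ex_derive_continuous q); exists (dq x); apply Hq).
  apply (continuous_mult (fun s => q s * dp s - p s * dq s) (fun s => / (p s ^ 2 + q s ^ 2))).
  - apply (continuous_minus (fun s => q s * dp s) (fun s => p s * dq s)).
    + now apply (continuous_mult q dp).
    + now apply (continuous_mult p dq).
  - apply continuous_Rinv_comp.
    + apply (continuous_plus (fun s => p s ^ 2) (fun s => q s ^ 2)).
      * apply continuous_ext with (fun s => p s * p s); [intros t; change (p t * p t = p t ^ 2); ring|].
        now apply (continuous_mult p p).
      * apply continuous_ext with (fun s => q s * q s); [intros t; change (q t * q t = q t ^ 2); ring|].
        now apply (continuous_mult q q).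
    + specialize (Hpos x). lra.
Qed.

Lemma is_derive_angle (x : R) :
  is_derive (angle p q dp dq x0 th0) x ((q x * dp x - p x * dq x) / (p x ^ 2 + q x ^ 2)).
Proof.
  unfold angle.
  refine (is_derive_eqr _ _ _ _ _ (Rplus_0_l _)).
  apply (is_derive_plus (fun _ => th0)
    (RInt (fun s => (q s * dp s - p s * dq s) / (p s ^ 2 + q s ^ 2)) x0)).
  - apply (is_derive_const th0).
  - apply (is_derive_RInt_R _ x0 x angle_integrand_continuous).
Qed.

(** Rotating the unit vector [(p, q) / rho] by the angle gives the two quotients of [EA] and [EB].
    Their derivatives vanish, so they keep their values 1 and 0 at [x0]; solving these two equations
    for [p] and [q] gives the claim. *)
Lemma angle_polar (x : R) :
  p x0 = sqrt (p x0 ^ 2 + q x0 ^ 2) * cos th0 ->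
  q x0 = - sqrt (p x0 ^ 2 + q x0 ^ 2) * sin th0 ->
  p x = sqrt (p x ^ 2 + q x ^ 2) * cos (angle p q dp dq x0 th0 x) /\
  q x = - sqrt (p x ^ 2 + q x ^ 2) * sin (angle p q dp dq x0 th0 x).
Proof.
  intros Ip Iq.
  set (th := angle p q dp dq x0 th0) in *.
  assert (Hth : forall y, is_derive th y ((q y * dp y - p y * dq y) / (p y ^ 2 + q y ^ 2)))
    by apply is_derive_angle.
  assert (Hrho : forall y, is_derive (fun y => sqrt (p y ^ 2 + q y ^ 2)) y
            ((p y * dp y + q y * dq y) / sqrt (p y ^ 2 + q y ^ 2))).
  { intros y. pose proof (Hpos y) as P. pose proof (sqrt_lt_R0 _ P).
    auto_derive.
    - repeat split; [exists (dp y); apply Hp|exists (dq y); apply Hq|].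
      simpl in P. lra.
    - replace (Derive (fun x1 => p x1) y) with (dp y) by (symmetry; apply is_derive_unique, Hp).
      replace (Derive (fun x1 => q x1) y) with (dq y) by (symmetry; apply is_derive_unique, Hq).
      replace (p y * (p y * 1) + q y * (q y * 1)) with (p y ^ 2 + q y ^ 2) by ring.
      field. lra. }
  assert (th00 : th x0 = th0).
  { unfold th, angle. rewrite RInt_point. apply Rplus_0_r. }
  assert (Dp : forall y, Derive (fun x1 => p x1) y = dp y) by (intros; apply is_derive_unique, Hp).
  assert (Dq : forall y, Derive (fun x1 => q x1) y = dq y) by (intros; apply is_derive_unique, Hq).
  assert (Dt : forall y, Derive (fun x1 => th x1) y = (q y * dp y - p y * dq y) / (p y ^ 2 + q y ^ 2))
    by (intros; apply is_derive_unique, Hth).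
  set (rho := fun y => sqrt (p y ^ 2 + q y ^ 2)) in *.
  assert (Dr : forall y, Derive (fun x1 => rho x1) y = (p y * dp y + q y * dq y) / rho y)
    by (intros; apply is_derive_unique, Hrho).
  assert (rpos : forall y, 0 < rho y) by (intros; apply sqrt_lt_R0, Hpos).
  assert (rsq : forall y, p y ^ 2 + q y ^ 2 = rho y ^ 2)
    by (intros; unfold rho; rewrite pow2_sqrt; [reflexivity|apply Rlt_le, Hpos]).
  assert (EA : forall y, (p y * cos (th y) - q y * sin (th y)) / rho y = 1).
  { intros y. transitivity ((p x0 * cos (th x0) - q x0 * sin (th x0)) / rho x0).
    - apply (derive_zero_const (fun y => (p y * cos (th y) - q y * sin (th y)) / rho y)).
      intros t. pose proof (rpos t). auto_derive.
      + repeat split; try (eexists; eauto; fail); try lra.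
      + rewrite Dp, Dq, Dt, Dr, rsq. field_simplify_eq; [|lra].
        replace (p t ^ 2) with (rho t ^ 2 - q t ^ 2) by (rewrite <- rsq; ring). ring.
    - rewrite th00. change (p x0 = rho x0 * cos th0) in Ip. change (q x0 = - rho x0 * sin th0) in Iq.
      rewrite Ip, Iq. pose proof (rpos x0). pose proof (sin2_cos2 th0) as SC. unfold Rsqr in SC.
      rewrite <- SC. field. lra. }
  assert (EB : forall y, (p y * sin (th y) + q y * cos (th y)) / rho y = 0).
  { intros y. transitivity ((p x0 * sin (th x0) + q x0 * cos (th x0)) / rho x0).
    - apply (derive_zero_const (fun y => (p y * sin (th y) + q y * cos (th y)) / rho y)).
      intros t. pose proof (rpos t). auto_derive.
      + repeat split; try (eexists; eauto; fail); try lra.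
      + rewrite Dp, Dq, Dt, Dr, rsq. field_simplify_eq; [|lra].
        replace (p t ^ 2) with (rho t ^ 2 - q t ^ 2) by (rewrite <- rsq; ring). ring.
    - rewrite th00. change (p x0 = rho x0 * cos th0) in Ip. change (q x0 = - rho x0 * sin th0) in Iq.
      rewrite Ip, Iq. pose proof (rpos x0). field. lra. }
  specialize (EA x). specialize (EB x). pose proof (rpos x) as P.
  pose proof (sin2_cos2 (th x)) as SC. unfold Rsqr in SC.
  assert (A1 : p x * cos (th x) - q x * sin (th x) = rho x).
  { apply Rmult_eq_reg_r with (/ rho x); [|apply Rinv_neq_0_compat; lra].
    unfold Rdiv in EA. rewrite EA. field. lra. }
  assert (B1 : p x * sin (th x) + q x * cos (th x) = 0).
  { apply Rmult_eq_reg_r with (/ rho x); [|apply Rinv_neq_0_compat; lra].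
    unfold Rdiv in EB. rewrite EB. ring. }
  change (p x = rho x * cos (th x) /\ q x = - rho x * sin (th x)).
  rewrite <- A1. split.
  - replace (p x) with (p x * (sin (th x) * sin (th x) + cos (th x) * cos (th x))) at 1
      by (rewrite SC; ring).
    replace (p x * (sin (th x) * sin (th x) + cos (th x) * cos (th x))) with
      ((p x * cos (th x) - q x * sin (th x)) * cos (th x) + (p x * sin (th x) + q x * cos (th x)) * sin (th x)) by ring.
    rewrite B1. ring.
  - replace (q x) with (q x * (sin (th x) * sin (th x) + cos (th x) * cos (th x))) at 1
      by (rewrite SC; ring).
    replace (q x * (sin (th x) * sin (th x) + cos (th x) * cos (th x))) with
      (- (p x * cos (th x) - q x * sin (th x)) * sin (th x) + (p x * sin (th x) + q x * cos (th x)) * cos (th x)) by ring.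
    rewrite B1. ring.
Qed.
End AngleLift.

(** * The reciprocal Gamma function *)

Lemma INR_p1_pos (k : nat) : 0 < INR k + 1.
Proof. pose proof (pos_INR k). lra. Qed.

Lemma sum_telescope (n : nat) : sum_n (fun k => / ((INR k + 1) * (INR k + 2))) n = 1 - / (INR n + 2).
Proof.
  induction n as [|n IH].
  - rewrite sum_O. simpl. field.
  - rewrite sum_Sn, IH. unfold plus; simpl. change (match n with 0%nat => 1 | S _ => INR n + 1 end) with (INR (S n)).
    rewrite S_INR. pose proof (pos_INR n). field. lra.
Qed.

Lemma ex_series_inv_prod : ex_series (fun k => / ((INR k + 1) * (INR k + 2))).
Proof.
  exists 1. change (is_lim_seq (sum_n (fun k => / ((INR k + 1) * (INR k + 2)))) 1).
  apply is_lim_seq_ext with (fun n => 1 - / (INR n + 2)); [intros; symmetry; apply sum_telescope|].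
  replace (Finite 1) with (Finite (1 - 0)) by (f_equal; ring).
  apply is_lim_seq_minus'; [apply is_lim_seq_const|].
  apply (is_lim_seq_inv (fun n => INR n + 2) p_infty); [|easy].
  apply (is_lim_seq_plus _ _ p_infty 2); [apply is_lim_seq_INR|apply is_lim_seq_const|reflexivity].
Qed.

Definition gauss (x : R) (n : nat) : R :=
  prod_f_R0 (fun k : nat => x + INR k) n / (INR (fact n) * Rpower (INR n) x).

(** [ln (gauss x (k + 2)) - ln (gauss x (k + 1))] *)
Definition lginc (k : nat) (x : R) : R :=
  ln (1 + x / (INR k + 2)) - x * ln ((INR k + 2) / (INR k + 1)).
Definition lginc' (k : nat) (x : R) : R :=
  / (INR k + 2 + x) - ln ((INR k + 2) / (INR k + 1)).

Lemma ln_le_sub (y : R) : 0 < y -> ln y <= y - 1.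
Proof.
  intros H. destruct (Req_dec y 1) as [->|Hne]; [rewrite ln_1; lra|].
  replace y with (1 + (y - 1)) at 1 by ring. apply Rlt_le.
  rewrite <- (ln_exp (y - 1)) at 2. apply ln_increasing; [lra|].
  apply exp_ineq1. lra.
Qed.

Lemma ln_ge_sub (y : R) : 0 < y -> 1 - / y <= ln y.
Proof.
  intros H. pose proof (ln_le_sub (/ y) (Rinv_0_lt_compat _ H)) as L.
  rewrite ln_Rinv in L by assumption. lra.
Qed.

Lemma ln_ratio_bounds (k : nat) : / (INR k + 2) <= ln ((INR k + 2) / (INR k + 1)) <= / (INR k + 1).
Proof.
  pose proof (INR_p1_pos k) as P.
  assert (Q : 0 < (INR k + 2) / (INR k + 1)) by (apply Rdiv_lt_0_compat; lra).
  pose proof (ln_ge_sub _ Q) as L1. pose proof (ln_le_sub _ Q) as L2.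
  replace (1 - / ((INR k + 2) / (INR k + 1))) with (/ (INR k + 2)) in L1 by (field; lra).
  replace ((INR k + 2) / (INR k + 1) - 1) with (/ (INR k + 1)) in L2 by (field; lra). lra.
Qed.

(** By [1 - 1/y <= ln y <= y - 1] both terms equal [x / k] up to an error of order [1 / k^2], and
    these leading parts cancel. The majorant is chosen to telescope. *)
Lemma lginc_bound (k : nat) (x : R) : 0 < x ->
  Rabs (lginc k x) <= x * (x + 1) * / ((INR k + 1) * (INR k + 2)).
Proof.
  intros Hx. pose proof (INR_p1_pos k) as P. pose proof (ln_ratio_bounds k) as [B1 B2].
  assert (Q0 : 0 < x / (INR k + 2)) by (apply Rdiv_lt_0_compat; lra).
  assert (Q : 0 < 1 + x / (INR k + 2)) by lra.
  pose proof (ln_ge_sub _ Q) as L1. pose proof (ln_le_sub _ Q) as L2.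
  unfold lginc.
  assert (M1 : x * / (INR k + 2) <= x * ln ((INR k + 2) / (INR k + 1))) by (apply Rmult_le_compat_l; lra).
  assert (M2 : x * ln ((INR k + 2) / (INR k + 1)) <= x * / (INR k + 1)) by (apply Rmult_le_compat_l; lra).
  assert (E : 1 - / (1 + x / (INR k + 2)) - x * / (INR k + 1) = - (x * (x + 1) * / ((INR k + 1) * (INR k + 2 + x))))
    by (field; lra).
  assert (I : / ((INR k + 1) * (INR k + 2 + x)) <= / ((INR k + 1) * (INR k + 2))).
  { apply Rinv_le_contravar; [apply Rmult_lt_0_compat; lra|]. apply Rmult_le_compat_l; lra. }
  assert (I2 : x * (x + 1) * / ((INR k + 1) * (INR k + 2 + x)) <= x * (x + 1) * / ((INR k + 1) * (INR k + 2))).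
  { apply Rmult_le_compat_l; [|exact I]. apply Rmult_le_pos; lra. }
  unfold Rdiv in *. rewrite Rabs_left1; lra.
Qed.

Lemma lginc'_bound (k : nat) (x : R) : 0 < x ->
  Rabs (lginc' k x) <= (x + 1) * / ((INR k + 1) * (INR k + 2)).
Proof.
  intros Hx. pose proof (INR_p1_pos k) as P. pose proof (ln_ratio_bounds k) as [B1 B2].
  unfold lginc'.
  assert (E : / (INR k + 2 + x) - / (INR k + 1) = - ((x + 1) * / ((INR k + 1) * (INR k + 2 + x))))
    by (field; lra).
  assert (I : / ((INR k + 1) * (INR k + 2 + x)) <= / ((INR k + 1) * (INR k + 2))).
  { apply Rinv_le_contravar; [apply Rmult_lt_0_compat; lra|]. apply Rmult_le_compat_l; lra. }
  assert (I2 : (x + 1) * / ((INR k + 1) * (INR k + 2 + x)) <= (x + 1) * / ((INR k + 1) * (INR k + 2)))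
    by (apply Rmult_le_compat_l; lra).
  assert (I3 : / (INR k + 2 + x) <= / (INR k + 2)) by (apply Rinv_le_contravar; lra).
  rewrite Rabs_left1; lra.
Qed.

Lemma is_derive_lginc (k : nat) (x : R) : 0 < x -> is_derive (lginc k) x (lginc' k x).
Proof.
  intros Hx. pose proof (INR_p1_pos k) as P. unfold lginc, lginc'.
  assert (Q0 : 0 < x / (INR k + 2)) by (apply Rdiv_lt_0_compat; lra).
  auto_derive; [unfold Rdiv in Q0; lra|].
  field. lra.
Qed.

Lemma ex_series_lginc (x : R) : 0 < x -> ex_series (fun k => lginc k x).
Proof.
  intros Hx. apply ex_series_le_R with (fun k => x * (x + 1) * / ((INR k + 1) * (INR k + 2))).
  - intros k. now apply lginc_bound.
  - apply (ex_series_scal_R (x * (x + 1))). apply ex_series_inv_prod.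
Qed.

(** The recursion is unrolled down to [gauss x 1], which is exactly [x * (x + 1)]. Index 0 is left
    out because [Rpower (INR 0) x] rests on the default value of [ln 0]. *)
Lemma gauss_exp (x : R) (n : nat) : 0 < x ->
  gauss x (S (S n)) = x * (x + 1) * exp (sum_n (fun k => lginc k x) n).
Proof.
  intros Hx.
  assert (step : forall n, gauss x (S (S n)) = gauss x (S n) * exp (lginc n x)).
  { clear n. intros n. unfold gauss, lginc.
    pose proof (INR_p1_pos n) as P.
    assert (Q0 : 0 < x / (INR n + 2)) by (apply Rdiv_lt_0_compat; lra).
    change (prod_f_R0 (fun k => x + INR k) (S (S n))) with (prod_f_R0 (fun k => x + INR k) (S n) * (x + INR (S (S n)))).
    replace (fact (S (S n))) with ((S (S n)) * fact (S n))%nat by reflexivity. rewrite mult_INR.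
    replace (ln (1 + x / (INR n + 2)) - x * ln ((INR n + 2) / (INR n + 1)))
      with (ln (1 + x / (INR n + 2)) + (x * ln (INR n + 1) + - (x * ln (INR n + 2))))
      by (rewrite ln_div by lra; ring).
    rewrite !exp_plus, exp_Ropp, exp_ln by lra.
    unfold Rpower. rewrite (S_INR (S n)), (S_INR n).
    replace (INR n + 1 + 1) with (INR n + 2) by ring.
    pose proof (exp_pos (x * ln (INR n + 1))). pose proof (exp_pos (x * ln (INR n + 2))).
    pose proof (INR_fact_neq_0 (S n)). field. repeat split; lra. }
  induction n as [|n IH].
  - rewrite step, sum_O. f_equal. unfold gauss. simpl.
    unfold Rpower. rewrite ln_1, Rmult_0_r, exp_0. field.
  - rewrite step, IH, sum_Sn. change plus with Rplus. rewrite exp_plus. ring.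
Qed.

Definition lgam (x : R) : R := Series (fun k => lginc k x).
Definition lgam' (x : R) : R := Series (fun k => lginc' k x).

Lemma is_lim_gauss_pos (x : R) : 0 < x -> is_lim_seq (gauss x) (x * (x + 1) * exp (lgam x)).
Proof.
  intros Hx. apply is_lim_seq_incr_1, is_lim_seq_incr_1.
  apply is_lim_seq_ext with (fun n => x * (x + 1) * exp (sum_n (fun k => lginc k x) n)).
  { intros n. symmetry. now apply gauss_exp. }
  apply (is_lim_seq_scal_l _ _ (Finite _)).
  apply is_lim_seq_continuous; [apply derivable_continuous_pt, derivable_pt_exp|].
  exact (Series_correct _ (ex_series_lginc x Hx)).
Qed.

Lemma rGamma_pos_eq (x : R) : 0 < x -> rGamma x = x * (x + 1) * exp (lgam x).
Proof. intros Hx. unfold rGamma. change (fun n : nat => _) with (gauss x). now rewrite (is_lim_seq_unique _ _ (is_lim_gauss_pos x Hx)). Qed.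

Lemma gauss_shift (x : R) (n : nat) : (0 < n)%nat -> 0 < x + INR n + 1 ->
  gauss x n = x * (gauss (x + 1) n * (INR n / (x + INR n + 1))).
Proof.
  intros Hn Hp. unfold gauss.
  assert (E : prod_f_R0 (fun k => x + INR k) n * (x + INR n + 1) = x * prod_f_R0 (fun k => x + 1 + INR k) n).
  { clear Hn Hp. induction n as [|n IH]; [simpl; ring|].
    change (prod_f_R0 (fun k => x + INR k) n * (x + INR (S n)) * (x + INR (S n) + 1) =
      x * (prod_f_R0 (fun k => x + 1 + INR k) n * (x + 1 + INR (S n)))).
    rewrite <- (Rmult_assoc x), <- IH, S_INR. ring. }
  apply Rmult_eq_reg_r with (x + INR n + 1); [|lra].
  unfold Rdiv at 1. rewrite Rmult_assoc, (Rmult_comm (/ _)), <- Rmult_assoc, E.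
  assert (0 < INR n) by now apply lt_0_INR.
  unfold Rpower. rewrite Rmult_plus_distr_r, Rmult_1_l, exp_plus, exp_ln by assumption.
  pose proof (exp_pos (x * ln (INR n))). pose proof (INR_fact_neq_0 n). field. repeat split; lra.
Qed.

Lemma is_lim_gauss_shift (x l : R) : is_lim_seq (gauss (x + 1)) l -> is_lim_seq (gauss x) (x * l).
Proof.
  intros H.
  destruct (nfloor_ex (Rabs x) (Rabs_pos x)) as [N [_ HN]].
  apply is_lim_seq_ext_loc with (fun n => x * (gauss (x + 1) n * (INR n / (x + INR n + 1)))).
  { exists (S N). intros n Hn. symmetry. apply gauss_shift; [lia|].
    apply le_INR in Hn. rewrite S_INR in Hn. pose proof (Rle_abs (- x)). rewrite Rabs_Ropp in H0. lra. }
  apply (is_lim_seq_scal_l _ _ (Finite l)).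
  replace (Finite l) with (Finite (l * 1)) by (f_equal; ring).
  apply is_lim_seq_mult'; [exact H|].
  apply is_lim_seq_ext_loc with (fun n => 1 - (x + 1) * / (x + INR n + 1)).
  { exists (S N). intros n Hn. apply le_INR in Hn. rewrite S_INR in Hn.
    pose proof (Rle_abs (- x)). rewrite Rabs_Ropp in H0. field. lra. }
  replace (Finite 1) with (Finite (1 - (x + 1) * 0)) by (f_equal; ring).
  apply is_lim_seq_minus'; [apply is_lim_seq_const|].
  apply (is_lim_seq_scal_l _ _ (Finite 0)).
  apply (is_lim_seq_inv (fun n => x + INR n + 1) p_infty); [|easy].
  apply (is_lim_seq_plus _ _ p_infty 1); [|apply is_lim_seq_const|reflexivity].
  apply (is_lim_seq_plus _ _ x p_infty); [apply is_lim_seq_const|apply is_lim_seq_INR|reflexivity].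
Qed.

(** Convergence for [x > 0] is carried to the left one unit at a time by the functional equation.
    This makes the limit in [rGamma] genuine at negative arguments, which occur in
    [besselJ (- nu)]. *)
Lemma is_lim_gauss (x : R) : is_lim_seq (gauss x) (rGamma x).
Proof.
  assert (H : forall (N : nat) (x : R), - INR N < x -> exists l : R, is_lim_seq (gauss x) l).
  { induction N as [|N IH]; intros y Hy.
    - simpl in Hy. eexists. apply is_lim_gauss_pos. lra.
    - rewrite S_INR in Hy. destruct (IH (y + 1) ltac:(lra)) as [l Hl].
      exists (y * l). now apply is_lim_gauss_shift. }
  destruct (nfloor_ex (Rabs x) (Rabs_pos x)) as [N [_ HN]].
  destruct (H (S N) x) as [l Hl].
  { rewrite S_INR. pose proof (Rle_abs (- x)) as HH. rewrite Rabs_Ropp in HH. lra. }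
  replace (rGamma x) with l; [exact Hl|].
  unfold rGamma. change (fun n : nat => _) with (gauss x). now rewrite (is_lim_seq_unique _ _ Hl).
Qed.

Lemma rGamma_shift (x : R) : rGamma x = x * rGamma (x + 1).
Proof.
  pose proof (is_lim_gauss_shift x _ (is_lim_gauss (x + 1))) as H.
  apply is_lim_seq_unique in H. rewrite (is_lim_seq_unique _ _ (is_lim_gauss x)) in H.
  now injection H.
Qed.

Lemma rGamma_1 : rGamma 1 = 1.
Proof.
  assert (H : is_lim_seq (gauss 1) 1).
  { replace (Finite 1) with (Finite (1 + 0)) by (f_equal; ring).
    apply is_lim_seq_ext_loc with (fun n => 1 + / INR n).
    - exists 1%nat. intros n Hn. unfold gauss.
      assert (P : 0 < INR n) by (apply lt_0_INR; lia).
      assert (E : prod_f_R0 (fun k => 1 + INR k) n = INR (fact n) * (INR n + 1)).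
      { clear. induction n as [|n IH]; [simpl; ring|].
        change (prod_f_R0 (fun k => 1 + INR k) (S n)) with (prod_f_R0 (fun k => 1 + INR k) n * (1 + INR (S n))).
        rewrite IH. replace (fact (S n)) with ((S n) * fact n)%nat by reflexivity.
        rewrite mult_INR, S_INR. ring. }
      rewrite E, Rpower_1 by assumption. pose proof (INR_fact_neq_0 n). field. lra.
    - apply is_lim_seq_plus'; [apply is_lim_seq_const|].
      apply (is_lim_seq_inv INR p_infty); [apply is_lim_seq_INR|easy]. }
  apply is_lim_seq_unique in H. rewrite (is_lim_seq_unique _ _ (is_lim_gauss 1)) in H.
  now injection H.
Qed.

Lemma rGamma_neq_0 (x : R) : (forall n : nat, x <> - INR n) -> rGamma x <> 0.
Proof.
  assert (H : forall (N : nat) (x : R), - INR N < x -> (forall n : nat, x <> - INR n) -> rGamma x <> 0).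
  { induction N as [|N IH]; intros y Hy Hn.
    - simpl in Hy. rewrite rGamma_pos_eq by lra. pose proof (exp_pos (lgam y)).
      apply Rgt_not_eq. apply Rmult_lt_0_compat; [nra|assumption].
    - rewrite rGamma_shift. apply Rmult_integral_contrapositive_currified.
      + specialize (Hn 0%nat). simpl in Hn. lra.
      + rewrite S_INR in Hy. apply IH; [lra|].
        intros n E. apply (Hn (S n)). rewrite S_INR. lra. }
  intros Hn. destruct (nfloor_ex (Rabs x) (Rabs_pos x)) as [N [_ HN]].
  apply (H (S N)); [|exact Hn].
  rewrite S_INR. pose proof (Rle_abs (- x)) as HH. rewrite Rabs_Ropp in HH. lra.
Qed.

(** Derivative of [x (x + 1) exp (lgam x)], hence of [rGamma] on the positive axis only. *)
Definition rGamma' (x : R) : R :=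
  (2 * x + 1 + x * (x + 1) * lgam' x) * exp (lgam x).

Lemma Series_inv_prod : Series (fun k => / ((INR k + 1) * (INR k + 2))) <= 1.
Proof.
  apply (is_lim_seq_le (sum_n (fun k => / ((INR k + 1) * (INR k + 2)))) (fun _ => 1) (Series _) 1).
  - intros n. rewrite sum_telescope. pose proof (pos_INR n).
    pose proof (Rinv_0_lt_compat (INR n + 2) ltac:(lra)). lra.
  - apply Series_correct, ex_series_inv_prod.
  - apply is_lim_seq_const.
Qed.

Lemma lginc_nonpos (k : nat) (x : R) : 0 < x -> lginc k x <= 0.
Proof.
  intros Hx. pose proof (ln_ratio_bounds k) as B. pose proof (INR_p1_pos k) as P.
  assert (Q0 : 0 < x / (INR k + 2)) by (apply Rdiv_lt_0_compat; lra).
  pose proof (ln_le_sub (1 + x / (INR k + 2)) ltac:(lra)) as L2.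
  assert (M1 : x * / (INR k + 2) <= x * ln ((INR k + 2) / (INR k + 1))) by (apply Rmult_le_compat_l; lra).
  unfold lginc, Rdiv in *. lra.
Qed.

Lemma lgam_nonpos (x : R) : 0 < x -> lgam x <= 0.
Proof.
  intros Hx. apply (is_lim_seq_le (sum_n (fun k => lginc k x)) (fun _ => 0) (lgam x) 0).
  - intros n. induction n as [|n IH]; [rewrite sum_O | rewrite sum_Sn; change plus with Rplus].
    + now apply lginc_nonpos.
    + pose proof (lginc_nonpos (S n) x Hx). lra.
  - apply Series_correct. now apply ex_series_lginc.
  - apply is_lim_seq_const.
Qed.

Lemma lgam'_bound (x : R) : 0 < x -> Rabs (lgam' x) <= x + 1.
Proof.
  intros Hx. unfold lgam'.
  assert (E : ex_series (fun k => Rabs (lginc' k x))).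
  { apply ex_series_le_R with (fun k => (x + 1) * / ((INR k + 1) * (INR k + 2))).
    - intros k. rewrite Rabs_Rabsolu. now apply lginc'_bound.
    - apply (ex_series_scal_R (x + 1)), ex_series_inv_prod. }
  eapply Rle_trans; [now apply Series_Rabs|].
  eapply Rle_trans; [apply (Series_le _ (fun k => (x + 1) * / ((INR k + 1) * (INR k + 2))))|].
  - intros k. split; [apply Rabs_pos|now apply lginc'_bound].
  - apply (ex_series_scal_R (x + 1)), ex_series_inv_prod.
  - rewrite Series_scal_l. pose proof Series_inv_prod. nra.
Qed.

Lemma is_derive_lgam (x : R) : 0 < x -> is_derive lgam x (lgam' x).
Proof.
  intros Hx. assert (Hx2 : 0 < x / 2) by lra.
  apply (is_derive_series lginc lginc' (fun k => (2 * x + 1) * / ((INR k + 1) * (INR k + 2))) x (mkposreal _ Hx2)).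
  - simpl. intros k y Hy. apply Rabs_def2 in Hy. apply is_derive_lginc. lra.
  - simpl. intros k y Hy. apply Rabs_def2 in Hy. eapply Rle_trans; [apply lginc'_bound; lra|].
    apply Rmult_le_compat_r; [|lra]. apply Rlt_le, Rinv_0_lt_compat.
    pose proof (pos_INR k). apply Rmult_lt_0_compat; lra.
  - apply (ex_series_scal_R (2 * x + 1)), ex_series_inv_prod.
  - simpl. intros y Hy. apply Rabs_def2 in Hy. apply ex_series_lginc. lra.
Qed.

Lemma is_derive_rGamma (x : R) : 0 < x -> is_derive rGamma x (rGamma' x).
Proof.
  intros Hx.
  apply is_derive_ext_loc with (fun x => x * (x + 1) * exp (lgam x)).
  { exists (mkposreal x Hx). intros y Hy. apply ball_R in Hy. simpl in Hy. apply Rabs_def2 in Hy.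
    symmetry. apply rGamma_pos_eq. lra. }
  pose proof (is_derive_lgam x Hx) as D.
  auto_derive; [exists (lgam' x); exact D|].
  known_derive. unfold rGamma'. ring.
Qed.

(** [lgam] is nonpositive, so the exponential is at most 1. Polynomial growth suffices because the
    Bessel series carries a further factor [1 / k!]; the cube is chosen to serve [rGamma'] as
    well. *)
Lemma rGamma_bound (x : R) : 0 < x -> Rabs (rGamma x) <= (x + 2) ^ 3.
Proof.
  intros Hx. rewrite rGamma_pos_eq by assumption.
  pose proof (lgam_nonpos x Hx) as L. pose proof (exp_pos (lgam x)) as P.
  assert (Q : exp (lgam x) <= 1).
  { rewrite <- exp_0. destruct (Req_dec (lgam x) 0) as [->|Hn]; [lra|]. apply Rlt_le, exp_increasing. lra. }
  rewrite Rabs_mult, (Rabs_pos_eq (exp _)), Rabs_pos_eq by nra.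
  assert (x * (x + 1) * exp (lgam x) <= x * (x + 1) * 1) by (apply Rmult_le_compat_l; nra). nra.
Qed.

Lemma rGamma'_bound (x : R) : 0 < x -> Rabs (rGamma' x) <= (x + 2) ^ 3.
Proof.
  intros Hx. unfold rGamma'.
  pose proof (lgam_nonpos x Hx) as L. pose proof (exp_pos (lgam x)) as P. pose proof (lgam'_bound x Hx) as B.
  assert (Q : exp (lgam x) <= 1).
  { rewrite <- exp_0. destruct (Req_dec (lgam x) 0) as [->|Hn]; [lra|]. apply Rlt_le, exp_increasing. lra. }
  rewrite Rabs_mult, (Rabs_pos_eq (exp _)) by lra.
  assert (M : Rabs (2 * x + 1 + x * (x + 1) * lgam' x) <= 2 * x + 1 + x * (x + 1) * (x + 1)).
  { eapply Rle_trans; [apply Rabs_triang|]. rewrite Rabs_mult, (Rabs_pos_eq (2 * x + 1)), (Rabs_pos_eq (x * (x + 1))) by nra.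
    apply Rplus_le_compat_l. apply Rmult_le_compat_l; nra. }
  pose proof (Rabs_pos (2 * x + 1 + x * (x + 1) * lgam' x)).
  eapply Rle_trans; [apply Rmult_le_compat; [assumption|lra|exact M|exact Q]|]. nra.
Qed.

Lemma rGamma'_shift (x : R) : 0 < x -> rGamma' x = rGamma (x + 1) + x * rGamma' (x + 1).
Proof.
  intros Hx.
  transitivity (Derive rGamma x); [symmetry; now apply is_derive_unique, is_derive_rGamma|].
  apply is_derive_unique.
  apply is_derive_ext with (fun y => y * rGamma (y + 1)); [intros y; symmetry; apply rGamma_shift|].
  pose proof (is_derive_rGamma (x + 1) ltac:(lra)) as D.
  auto_derive; [exists (rGamma' (x + 1)); exact D|].
  known_derive. ring.
Qed.

(** * Bessel functions of the first kind *)

(** Coefficients of an entire function of exponential type. Both the Bessel series and the series in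
    the spectral parameter are of this kind. *)
Definition exp_bounded (a : nat -> R) : Prop :=
  exists M c : R, 0 <= M /\ 0 <= c /\ forall k, Rabs (a k) <= M * c ^ k / INR (fact k).

Lemma INR_fact_pos (k : nat) : 0 < INR (fact k).
Proof. apply lt_0_INR, lt_O_fact. Qed.

Lemma ex_series_exp (M c : R) : ex_series (fun k => M * c ^ k / INR (fact k)).
Proof.
  apply ex_series_ext_R with (fun k => M * (/ INR (fact k) * c ^ k)).
  { intros k. pose proof (INR_fact_pos k). field. lra. }
  apply ex_series_scal_R. exists (exp c).
  pose proof (is_exp_Reals c) as H. apply is_pseries_R in H. exact H.
Qed.

Lemma exp_bounded_ex_series (a : nat -> R) (t : R) :
  exp_bounded a -> ex_series (fun k => Rabs (a k * t ^ k)).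
Proof.
  intros (M & c & HM & Hc & H).
  apply ex_series_le_R with (fun k => M * (c * Rabs t) ^ k / INR (fact k)); [|apply ex_series_exp].
  intros k. rewrite Rabs_Rabsolu, Rabs_mult, <- RPow_abs, Rpow_mult_distr.
  specialize (H k). pose proof (pow_le (Rabs t) k (Rabs_pos t)).
  replace (M * (c ^ k * Rabs t ^ k) / INR (fact k)) with (M * c ^ k / INR (fact k) * Rabs t ^ k)
    by (pose proof (INR_fact_pos k); field; lra).
  now apply Rmult_le_compat_r.
Qed.

Lemma exp_bounded_ex_pseries (a : nat -> R) (t : R) : exp_bounded a -> ex_pseries a t.
Proof.
  intros H. apply ex_pseries_R. apply (ex_series_Rabs (fun k => a k * t ^ k)).
  now apply exp_bounded_ex_series.
Qed.

Lemma exp_bounded_radius (a : nat -> R) (t : R) : exp_bounded a -> Rbar_lt (Rabs t) (CV_radius a).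
Proof.
  intros H. apply Rbar_lt_le_trans with (Rabs t + 1); [simpl; lra|].
  apply (proj1 (CV_radius_bounded a)).
  pose proof (exp_bounded_ex_series a (Rabs t + 1) H) as E.
  apply ex_series_lim_0 in E.
  destruct (filterlim_bounded (fun k => Rabs (a k * (Rabs t + 1) ^ k))) as [M HM].
  - exists 0. exact E.
  - exists M. intros n. specialize (HM n). change (Rabs (Rabs (a n * (Rabs t + 1) ^ n)) <= M) in HM.
    now rewrite Rabs_Rabsolu in HM.
Qed.

(** The bound on the Bessel coefficients holds only once the argument of [rGamma] is positive. The
    finitely many earlier terms are absorbed one at a time; raising [c] to [c + 1] ensures
    [(c + 1) ^ k >= 1] at the absorbed index. *)
Lemma exp_bounded_eventually (a : nat -> R) (N : nat) (M c : R) :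
  0 <= M -> 0 <= c -> (forall k, (N <= k)%nat -> Rabs (a k) <= M * c ^ k / INR (fact k)) -> exp_bounded a.
Proof.
  revert M c. induction N as [|N IH]; intros M c HM Hc H.
  - exists M, c. repeat split; trivial. intros k. apply H. lia.
  - apply (IH (M + Rabs (a N) * INR (fact N)) (c + 1)); [|lra|].
    + pose proof (INR_fact_pos N). pose proof (Rabs_pos (a N)). nra.
    + intros k Hk. pose proof (INR_fact_pos k) as Pk. pose proof (INR_fact_pos N) as PN.
      pose proof (Rabs_pos (a N)) as PA.
      apply Rmult_le_reg_r with (INR (fact k)); [exact Pk|].
      unfold Rdiv. rewrite Rmult_assoc, Rinv_l, Rmult_1_r by lra.
      assert (Q : 1 <= (c + 1) ^ k) by (apply pow_R1_Rle; lra).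
      assert (Q2 : c ^ k <= (c + 1) ^ k) by (apply pow_incr; lra).
      pose proof (pow_le c k Hc).
      destruct (Nat.eq_dec k N) as [->|Hne].
      * assert (0 <= Rabs (a N) * INR (fact N)) by nra. nra.
      * specialize (H k ltac:(lia)).
        apply Rmult_le_compat_r with (r := INR (fact k)) in H; [|lra].
        unfold Rdiv in H. rewrite Rmult_assoc, Rinv_l, Rmult_1_r in H by lra.
        assert (0 <= Rabs (a N) * INR (fact N)) by nra. nra.
Qed.

Lemma cube_bound (k : nat) (y c : R) : 1 <= c -> 0 <= y <= INR k + c -> y ^ 3 <= c ^ 3 * 8 ^ k.
Proof.
  intros Hc Hy.
  assert (H : INR k + 1 <= 2 ^ k).
  { clear. induction k as [|k IH]; [simpl; lra|]. rewrite S_INR. simpl. pose proof (pos_INR k). lra. }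
  replace 8 with (2 ^ 3) by ring. rewrite <- pow_mult, Nat.mul_comm, pow_mult, <- Rpow_mult_distr.
  apply pow_incr. split; [lra|]. pose proof (pos_INR k). nra.
Qed.

(** [jser nu] is the entire factor in [J_nu(x) = (x/2)^nu jser nu ((x/2)^2)]; for [nu >= 0],
    [jserd nu] is its derivative in the order. *)
Definition jc (nu : R) (k : nat) : R := (-1) ^ k / INR (fact k) * rGamma (INR k + nu + 1).
Definition jd (nu : R) (k : nat) : R := (-1) ^ k / INR (fact k) * rGamma' (INR k + nu + 1).
Definition jser (nu t : R) : R := PSeries (jc nu) t.
Definition jserd (nu t : R) : R := PSeries (jd nu) t.

Lemma Rabs_sign_fact (k : nat) : Rabs ((-1) ^ k / INR (fact k)) = / INR (fact k).
Proof.
  unfold Rdiv. rewrite Rabs_mult, pow_1_abs, Rmult_1_l. apply Rabs_pos_eq.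
  apply Rlt_le, Rinv_0_lt_compat, INR_fact_pos.
Qed.

Lemma jc_bound (k : nat) (nu c : R) : 1 <= c -> nu + 3 <= c -> 0 < INR k + nu + 1 ->
  Rabs (jc nu k) <= c ^ 3 * 8 ^ k / INR (fact k).
Proof.
  intros Hc Hn Hp. unfold jc. rewrite Rabs_mult, Rabs_sign_fact, Rmult_comm.
  apply Rmult_le_compat_r; [apply Rlt_le, Rinv_0_lt_compat, INR_fact_pos|].
  eapply Rle_trans; [now apply rGamma_bound|]. apply cube_bound; lra.
Qed.

Lemma jd_bound (k : nat) (nu c : R) : 1 <= c -> nu + 3 <= c -> 0 < INR k + nu + 1 ->
  Rabs (jd nu k) <= c ^ 3 * 8 ^ k / INR (fact k).
Proof.
  intros Hc Hn Hp. unfold jd. rewrite Rabs_mult, Rabs_sign_fact, Rmult_comm.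
  apply Rmult_le_compat_r; [apply Rlt_le, Rinv_0_lt_compat, INR_fact_pos|].
  eapply Rle_trans; [now apply rGamma'_bound|]. apply cube_bound; lra.
Qed.

Lemma exp_bounded_jc (nu : R) : exp_bounded (jc nu).
Proof.
  destruct (nfloor_ex (Rabs nu) (Rabs_pos nu)) as [N [_ HN]].
  pose proof (Rabs_pos nu). pose proof (Rle_abs nu). pose proof (Rle_abs (- nu)) as HH. rewrite Rabs_Ropp in HH.
  apply (exp_bounded_eventually _ N ((Rabs nu + 3) ^ 3) 8); [apply pow_le; lra|lra|].
  intros k Hk. apply le_INR in Hk. apply jc_bound; lra.
Qed.

Lemma exp_bounded_jd (nu : R) : exp_bounded (jd nu).
Proof.
  destruct (nfloor_ex (Rabs nu) (Rabs_pos nu)) as [N [_ HN]].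
  pose proof (Rabs_pos nu). pose proof (Rle_abs nu). pose proof (Rle_abs (- nu)) as HH. rewrite Rabs_Ropp in HH.
  apply (exp_bounded_eventually _ N ((Rabs nu + 3) ^ 3) 8); [apply pow_le; lra|lra|].
  intros k Hk. apply le_INR in Hk. apply jd_bound; lra.
Qed.

Lemma sign_fact_S (k : nat) : (-1) ^ (S k) / INR (fact (S k)) * INR (S k) = - ((-1) ^ k / INR (fact k)).
Proof.
  replace (fact (S k)) with ((S k) * fact k)%nat by reflexivity. rewrite mult_INR.
  pose proof (INR_fact_pos k). pose proof (not_0_INR (S k) ltac:(lia)).
  simpl pow. field. split; lra.
Qed.

Lemma is_derive_jser (nu t : R) : is_derive (jser nu) t (- jser (nu + 1) t).
Proof.
  eapply is_derive_eqr; [apply is_derive_PSeries, exp_bounded_radius, exp_bounded_jc|].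
  unfold jser. rewrite <- PSeries_opp. apply PSeries_ext. intros k.
  unfold PS_derive, PS_opp, jc. rewrite S_INR. change (opp ?x) with (- x).
  replace (INR k + 1 + nu + 1) with (INR k + (nu + 1) + 1) by ring.
  rewrite <- S_INR, <- Rmult_assoc, (Rmult_comm (INR (S k))), sign_fact_S. ring.
Qed.

Lemma is_derive_jserd (nu t : R) : is_derive (jserd nu) t (- jserd (nu + 1) t).
Proof.
  eapply is_derive_eqr; [apply is_derive_PSeries, exp_bounded_radius, exp_bounded_jd|].
  unfold jserd. rewrite <- PSeries_opp. apply PSeries_ext. intros k.
  unfold PS_derive, PS_opp, jd. rewrite S_INR. change (opp ?x) with (- x).
  replace (INR k + 1 + nu + 1) with (INR k + (nu + 1) + 1) by ring.
  rewrite <- S_INR, <- Rmult_assoc, (Rmult_comm (INR (S k))), sign_fact_S. ring.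
Qed.

(** Coefficientwise this is the functional equation of [rGamma], so it holds at every real order. It
    is the three-term recurrence of the Bessel functions with the powers of [x/2] removed. *)
Lemma jser_rec (nu t : R) : t * jser (nu + 2) t = (nu + 1) * jser (nu + 1) t - jser nu t.
Proof.
  unfold jser. rewrite <- PSeries_incr_1, <- PSeries_scal, <- PSeries_minus;
    [|apply ex_pseries_scal; [apply Rmult_comm|]; apply exp_bounded_ex_pseries, exp_bounded_jc
     |apply exp_bounded_ex_pseries, exp_bounded_jc].
  apply PSeries_ext. intros [|k]; unfold PS_incr_1, PS_minus, PS_plus, PS_opp, PS_scal, jc;
    change plus with Rplus; change opp with Ropp; change zero with 0; change (scal ?x ?y) with (x * y).
  - simpl. rewrite (rGamma_shift (0 + nu + 1)).
    replace (0 + (nu + 1) + 1) with (0 + nu + 1 + 1) by ring. ring.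
  - pose proof (sign_fact_S k) as E.
    rewrite (rGamma_shift (INR (S k) + nu + 1)), S_INR in *.
    replace (INR k + 1 + nu + 1 + 1) with (INR k + nu + 3) by ring.
    replace (INR k + 1 + (nu + 1) + 1) with (INR k + nu + 3) by ring.
    replace (INR k + (nu + 2) + 1) with (INR k + nu + 3) by ring.
    replace ((-1) ^ k / INR (fact k)) with (- ((-1) ^ S k / INR (fact (S k)) * (INR k + 1))) by (rewrite E; ring).
    ring.
Qed.

(** The derivative of [jser_rec] in the order, proved on coefficients. The condition on [nu] keeps
    the arguments of [rGamma'] positive. *)
Lemma jserd_rec (nu t : R) : -1 < nu ->
  t * jserd (nu + 2) t = (nu + 1) * jserd (nu + 1) t + jser (nu + 1) t - jserd nu t.
Proof.
  intros Hnu.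
  unfold jser, jserd. rewrite <- PSeries_incr_1, <- PSeries_scal, <- PSeries_plus, <- PSeries_minus.
  2: apply ex_pseries_plus; [apply ex_pseries_scal; [apply Rmult_comm|]; apply exp_bounded_ex_pseries, exp_bounded_jd|].
  2,3,5: apply exp_bounded_ex_pseries; try apply exp_bounded_jc; apply exp_bounded_jd.
  2: apply ex_pseries_scal; [apply Rmult_comm|]; apply exp_bounded_ex_pseries, exp_bounded_jd.
  apply PSeries_ext. intros [|k]; unfold PS_incr_1, PS_minus, PS_plus, PS_opp, PS_scal, jc, jd;
    change plus with Rplus; change opp with Ropp; change zero with 0; change (scal ?x ?y) with (x * y).
  - simpl. rewrite (rGamma'_shift (0 + nu + 1)) by lra.
    replace (0 + (nu + 1) + 1) with (0 + nu + 1 + 1) by ring. ring.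
  - pose proof (sign_fact_S k) as E. pose proof (pos_INR k).
    rewrite (rGamma'_shift (INR (S k) + nu + 1)), S_INR in * by (rewrite S_INR; lra).
    replace (INR k + 1 + nu + 1 + 1) with (INR k + nu + 3) by ring.
    replace (INR k + 1 + (nu + 1) + 1) with (INR k + nu + 3) by ring.
    replace (INR k + (nu + 2) + 1) with (INR k + nu + 3) by ring.
    replace ((-1) ^ k / INR (fact k)) with (- ((-1) ^ S k / INR (fact (S k)) * (INR k + 1))) by (rewrite E; ring).
    ring.
Qed.

(** The recurrence at orders [nu] and [- nu - 1] makes the derivative vanish, and the value is read
    off at [t = 0]. Up to powers this is the Wronskian of [J_nu] and [J_(-nu)]; as a product of
    reciprocal Gammas, the constant visibly vanishes only at integer orders. *)
Lemma jser_wronskian (nu t : R) :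
  jser nu t * jser (- nu - 1) t + t * jser (nu + 1) t * jser (- nu) t = rGamma (nu + 1) * rGamma (- nu).
Proof.
  transitivity (jser nu 0 * jser (- nu - 1) 0 + 0 * jser (nu + 1) 0 * jser (- nu) 0).
  - apply (derive_zero_const (fun t => jser nu t * jser (- nu - 1) t + t * jser (nu + 1) t * jser (- nu) t)).
    clear t. intros t.
    assert (D : forall m, Derive (fun x => jser m x) t = - jser (m + 1) t)
      by (intros; apply is_derive_unique, is_derive_jser).
    auto_derive; [repeat split; eexists; apply is_derive_jser|].
    rewrite !D.
    replace (- nu - 1 + 1) with (- nu) by ring.
    replace (nu + 1 + 1) with (nu + 2) by ring.
    pose proof (jser_rec nu t) as E1. pose proof (jser_rec (- nu - 1) t) as E2.
    replace (- nu - 1 + 1) with (- nu) in E2 by ring.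
    replace (- nu - 1 + 2) with (- nu + 1) in E2 by ring.
    match goal with |- ?l = 0 => replace l with
      (- jser (nu + 1) t * jser (- nu - 1) t - jser nu t * jser (- nu) t
       + jser (nu + 1) t * jser (- nu) t - (t * jser (nu + 2) t) * jser (- nu) t
       - jser (nu + 1) t * (t * jser (- nu + 1) t)) by ring end.
    rewrite E1, E2. ring.
  - unfold jser. rewrite !PSeries_0. unfold jc. simpl.
    replace (0 + nu + 1) with (nu + 1) by ring.
    replace (0 + (- nu - 1) + 1) with (- nu) by ring. field.
Qed.

Lemma besselJ_jser (nu x : R) : besselJ nu x = Rpower (x / 2) nu * jser nu ((x / 2) ^ 2).
Proof.
  unfold besselJ, jser, PSeries. f_equal. apply Series_ext. intros k.
  unfold jc. now rewrite pow_mult.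
Qed.

Lemma Rpower_S (y nu : R) : 0 < y -> Rpower y (nu + 1) = Rpower y nu * y.
Proof. intros H. now rewrite Rpower_plus, Rpower_1. Qed.

Lemma is_derive_besselJ (nu x : R) : 0 < x ->
  is_derive (besselJ nu) x (nu / x * besselJ nu x - besselJ (nu + 1) x).
Proof.
  intros Hx.
  apply is_derive_ext with (fun x => Rpower (x / 2) nu * jser nu ((x / 2) ^ 2)).
  { intros y. symmetry. apply besselJ_jser. }
  rewrite !besselJ_jser, Rpower_S by lra.
  pose proof (is_derive_jser nu ((x / 2) ^ 2)) as D.
  unfold Rpower at 1. auto_derive.
  - repeat split; [lra|]. exists (- jser (nu + 1) ((x / 2) ^ 2)).
    replace (x * / 2 * (x * / 2 * 1)) with ((x / 2) ^ 2) by field. exact D.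
  - replace (x * / 2 * (x * / 2 * 1)) with ((x / 2) ^ 2) by field.
    known_derive.
    unfold Rpower. replace (x * / 2) with (x / 2) by reflexivity. field. lra.
Qed.

Lemma besselJ_rec (nu x : R) : 0 < x ->
  besselJ (nu + 1) x = 2 * nu / x * besselJ nu x - besselJ (nu - 1) x.
Proof.
  intros Hx. rewrite !besselJ_jser.
  pose proof (jser_rec (nu - 1) ((x / 2) ^ 2)) as E.
  replace (nu - 1 + 2) with (nu + 1) in E by ring.
  replace (nu - 1 + 1) with nu in E by ring.
  rewrite Rpower_S by lra.
  assert (EP : Rpower (x / 2) nu = Rpower (x / 2) (nu - 1) * (x / 2))
    by (rewrite <- Rpower_S by lra; f_equal; ring).
  rewrite EP.
  replace (jser (nu - 1) ((x / 2) ^ 2)) with (nu * jser nu ((x / 2) ^ 2) - (x / 2) ^ 2 * jser (nu + 1) ((x / 2) ^ 2)) by lra.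
  field. lra.
Qed.

Lemma is_derive_besselJ_down (nu x : R) : 0 < x ->
  is_derive (besselJ nu) x (besselJ (nu - 1) x - nu / x * besselJ nu x).
Proof.
  intros Hx. eapply is_derive_eqr; [now apply is_derive_besselJ|].
  rewrite besselJ_rec by assumption. field. lra.
Qed.

Lemma besselJ_wronskian (nu x : R) : 0 < x ->
  x * (besselJ nu x * besselJ (- nu - 1) x + besselJ (nu + 1) x * besselJ (- nu) x)
  = 2 * rGamma (nu + 1) * rGamma (- nu).
Proof.
  intros Hx. rewrite Rmult_assoc, <- (jser_wronskian nu ((x / 2) ^ 2)), !besselJ_jser.
  rewrite Rpower_S by lra.
  assert (EP : Rpower (x / 2) (- nu) = Rpower (x / 2) (- nu - 1) * (x / 2))
    by (rewrite <- Rpower_S by lra; f_equal; ring).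
  rewrite EP.
  assert (E : Rpower (x / 2) (- nu - 1) = / (Rpower (x / 2) nu * (x / 2))).
  { rewrite <- Rpower_S, <- Rpower_Ropp by lra. f_equal. ring. }
  rewrite E. assert (0 < Rpower (x / 2) nu) by apply exp_pos. field. lra.
Qed.

(** [d/dnu besselJ nu x] *)
Definition besselJdot (nu x : R) : R :=
  ln (x / 2) * besselJ nu x + Rpower (x / 2) nu * jserd nu ((x / 2) ^ 2).

Lemma is_derive_jser_order (nu t : R) : 0 <= nu -> is_derive (fun m => jser m t) nu (jserd nu t).
Proof.
  (* With radius 1/2 around [nu >= 0] every [INR k + y + 1] stays positive, where [rGamma'] is the
     derivative. Order 0 is thus approached from both sides. *)
  intros Hnu. assert (H2 : 0 < / 2) by lra.
  apply (is_derive_series (fun k m => jc m k * t ^ k) (fun k m => jd m k * t ^ k)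
    (fun k => (nu + 4) ^ 3 * (8 * Rabs t) ^ k / INR (fact k)) nu (mkposreal _ H2)); simpl.
  - intros k y Hy. apply Rabs_def2 in Hy. pose proof (pos_INR k).
    pose proof (is_derive_rGamma (INR k + y + 1) ltac:(lra)) as D.
    unfold jc, jd. auto_derive; [exists (rGamma' (INR k + y + 1)); exact D|].
    known_derive.
    unfold Rdiv. ring.
  - intros k y Hy. apply Rabs_def2 in Hy. pose proof (pos_INR k).
    rewrite Rabs_mult, <- RPow_abs, Rpow_mult_distr.
    pose proof (pow_le (Rabs t) k (Rabs_pos t)).
    replace ((nu + 4) * ((nu + 4) * ((nu + 4) * 1)) * (8 ^ k * Rabs t ^ k) / INR (fact k))
      with ((nu + 4) ^ 3 * 8 ^ k / INR (fact k) * Rabs t ^ k)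
      by (pose proof (INR_fact_pos k); field; lra).
    apply Rmult_le_compat_r; [assumption|]. apply jd_bound; lra.
  - apply (ex_series_exp ((nu + 4) ^ 3) (8 * Rabs t)).
  - intros y Hy. apply (ex_series_Rabs (fun k => jc y k * t ^ k)), exp_bounded_ex_series, exp_bounded_jc.
Qed.

Lemma is_derive_besselJ_order (nu x : R) : 0 <= nu ->
  is_derive (fun m => besselJ m x) nu (besselJdot nu x).
Proof.
  intros Hnu. pose proof (is_derive_jser_order nu ((x / 2) ^ 2) Hnu) as D.
  apply is_derive_ext with (fun m => Rpower (x / 2) m * jser m ((x / 2) ^ 2)).
  { intros y. symmetry. apply besselJ_jser. }
  unfold besselJdot. rewrite besselJ_jser.
  set (t := (x / 2) ^ 2) in *. clearbody t. unfold Rpower. auto_derive.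
  - eexists; exact D.
  - replace (Derive (fun x0 => jser x0 t) nu) with (jserd nu t) by (symmetry; now apply is_derive_unique).
    unfold Rdiv. ring.
Qed.

Lemma is_derive_besselJdot (nu x : R) : 0 < x ->
  is_derive (besselJdot nu) x (nu / x * besselJdot nu x + besselJ nu x / x - besselJdot (nu + 1) x).
Proof.
  intros Hx. unfold besselJdot. rewrite Rpower_S by lra.
  pose proof (is_derive_besselJ nu x Hx) as D1.
  pose proof (is_derive_jserd nu ((x / 2) ^ 2)) as D2.
  unfold Rpower at 1. auto_derive.
  - repeat split; try lra; [eexists; exact D1|].
    replace (x * / 2 * (x * / 2 * 1)) with ((x / 2) ^ 2) by field. eexists; exact D2.
  - replace (x * / 2 * (x * / 2 * 1)) with ((x / 2) ^ 2) by field.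
    known_derive.
    unfold Rpower. replace (x * / 2) with (x / 2) by reflexivity. field. lra.
Qed.

Lemma besselJdot_rec (nu x : R) : 0 < nu -> 0 < x ->
  besselJdot (nu + 1) x = 2 * nu / x * besselJdot nu x + 2 / x * besselJ nu x - besselJdot (nu - 1) x.
Proof.
  intros Hnu Hx. unfold besselJdot. rewrite (besselJ_rec nu x) by assumption.
  rewrite (besselJ_jser nu).
  pose proof (jserd_rec (nu - 1) ((x / 2) ^ 2) ltac:(lra)) as E.
  replace (nu - 1 + 2) with (nu + 1) in E by ring.
  replace (nu - 1 + 1) with nu in E by ring.
  rewrite Rpower_S by lra.
  assert (EP : Rpower (x / 2) nu = Rpower (x / 2) (nu - 1) * (x / 2))
    by (rewrite <- Rpower_S by lra; f_equal; ring).
  rewrite EP.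
  replace (jserd (nu - 1) ((x / 2) ^ 2)) with
    (nu * jserd nu ((x / 2) ^ 2) + jser nu ((x / 2) ^ 2) - (x / 2) ^ 2 * jserd (nu + 1) ((x / 2) ^ 2)) by lra.
  field. lra.
Qed.

(** * Bessel functions of the second kind *)

(** L'Hopital's rule at a simple zero of the denominator, as a quotient of two difference
    quotients. *)
Lemma quotient_limit (N D : R -> R) (a n d : R) :
  is_derive N a n -> is_derive D a d -> N a = 0 -> D a = 0 -> d <> 0 ->
  filterlim (fun h => N (a + h) / D (a + h)) (locally' 0) (locally (n / d)).
Proof.
  intros HN HD N0 D0 Hd.
  apply is_derive_filterlim in HN. apply is_derive_filterlim in HD.
  apply filterlim_ext_loc with (fun h => ((N (a + h) - N a) / h) * / ((D (a + h) - D a) / h)).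
  { exists (mkposreal 1 Rlt_0_1). intros h _ Hh. rewrite N0, D0, !Rminus_0_r.
    unfold Rdiv. rewrite Rinv_mult, Rinv_inv.
    replace (N (a + h) * / h * (/ D (a + h) * h)) with (N (a + h) * / D (a + h) * (/ h * h)) by ring.
    rewrite Rinv_l by assumption. ring. }
  apply (filterlim_comp_2 (F := locally' 0) (G := locally n) (H := locally (/ d))).
  - exact HN.
  - eapply filterlim_comp; [exact HD|]. 
    now apply (continuous_Rinv d).
  - apply (filterlim_mult n (/ d)).
Qed.

Lemma filterlim_mult_R {T : Type} (Fl : (T -> Prop) -> Prop) {FF : Filter Fl} (f g : T -> R) (a b : R) :
  filterlim f Fl (locally a) -> filterlim g Fl (locally b) ->
  filterlim (fun t => f t * g t) Fl (locally (a * b)).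
Proof. intros H1 H2. eapply (filterlim_comp_2 (F := Fl)); [exact H1|exact H2|apply (filterlim_mult a b)]. Qed.

Lemma filterlim_minus_R {T : Type} (Fl : (T -> Prop) -> Prop) {FF : Filter Fl} (f g : T -> R) (a b : R) :
  filterlim f Fl (locally a) -> filterlim g Fl (locally b) ->
  filterlim (fun t => f t - g t) Fl (locally (a - b)).
Proof.
  intros H1 H2. eapply (filterlim_comp_2 (F := Fl) f (fun t => - g t)); [exact H1| |apply (filterlim_plus a (- b))].
  eapply filterlim_comp; [exact H2|apply (filterlim_opp b)].
Qed.

(** [Y_n] at integer order. The entries at 0 and 1 are limits of [besselY_quot], and the higher ones
    follow the three-term recurrence. In this way [J] is differentiated in the order only at 0 and
    1, never at a negative integer, where [rGamma] would have to be differentiated at its zeros. *)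
Fixpoint bY (n : nat) (x : R) : R :=
  match n with
  | O => 2 / PI * besselJdot 0 x
  | S O => 2 / PI * (besselJdot 1 x - besselJ 0 x / x)
  | S (S m as p) => 2 * INR p / x * bY p x - bY m x
  end.

Lemma bY_SS (n : nat) (x : R) : bY (S (S n)) x = 2 * INR (S n) / x * bY (S n) x - bY n x.
Proof. reflexivity. Qed.

Lemma sin_PI_shift (mu : R) : sin ((mu + 1) * PI) = - sin (mu * PI).
Proof. rewrite Rmult_plus_distr_r, Rmult_1_l. apply neg_sin. Qed.
Lemma cos_PI_shift (mu : R) : cos ((mu + 1) * PI) = - cos (mu * PI).
Proof. rewrite Rmult_plus_distr_r, Rmult_1_l. apply neg_cos. Qed.

(** Both [sin (mu PI)] and [cos (mu PI)] change sign when [mu] moves by 1, which compensates for the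
    opposite direction of the recurrence at order [- mu]. *)
Lemma besselY_quot_rec (mu x : R) : 0 < x ->
  besselY_quot (mu + 1) x = 2 * mu / x * besselY_quot mu x - besselY_quot (mu - 1) x.
Proof.
  intros Hx. unfold besselY_quot.
  pose proof (sin_PI_shift (mu - 1)) as S2. pose proof (cos_PI_shift (mu - 1)) as C2.
  replace (mu - 1 + 1) with mu in S2, C2 by ring.
  replace (sin ((mu - 1) * PI)) with (- sin (mu * PI)) by lra.
  replace (cos ((mu - 1) * PI)) with (- cos (mu * PI)) by lra.
  rewrite sin_PI_shift, cos_PI_shift.
  rewrite (besselJ_rec mu x) by assumption.
  pose proof (besselJ_rec (- mu) x Hx) as E.
  replace (- mu + 1) with (- (mu - 1)) in E by ring.
  replace (- mu - 1) with (- (mu + 1)) in E by ring.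
  rewrite E. unfold Rdiv. rewrite Rinv_opp. ring.
Qed.

(** Two consecutive orders travel together because the recurrence is of second order; at orders 0
    and 1 the limits are of the form 0/0. *)
Lemma bY_limit (n : nat) (x : R) : 0 < x ->
  filterlim (fun h => besselY_quot (INR n + h) x) (locally' 0) (locally (bY n x)).
Proof.
  intros Hx.
  assert (D0 : is_derive (fun m => besselJ m x) 0 (besselJdot 0 x)) by (apply is_derive_besselJ_order; lra).
  assert (D1 : is_derive (fun m => besselJ m x) 1 (besselJdot 1 x)) by (apply is_derive_besselJ_order; lra).
  assert (d0 : Derive (fun m => besselJ m x) 0 = besselJdot 0 x) by now apply is_derive_unique.
  assert (d1 : Derive (fun m => besselJ m x) 1 = besselJdot 1 x) by now apply is_derive_unique.
  assert (e0 : ex_derive (fun m => besselJ m x) 0) by (eexists; exact D0).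
  assert (e1 : ex_derive (fun m => besselJ m x) 1) by (eexists; exact D1).
  assert (PP := PI_RGT_0).
  assert (H : filterlim (fun h => besselY_quot (INR n + h) x) (locally' 0) (locally (bY n x)) /\
              filterlim (fun h => besselY_quot (INR (S n) + h) x) (locally' 0) (locally (bY (S n) x)));
    [|apply H].
  induction n as [|n [IH1 IH2]].
  - split.
    + replace (bY 0 x) with ((2 * besselJdot 0 x) / PI) by (simpl; field; lra).
      apply (quotient_limit (fun mu => besselJ mu x * cos (mu * PI) - besselJ (- mu) x) (fun mu => sin (mu * PI)) 0).
      * auto_derive.
        -- rewrite Ropp_0. repeat split; exact e0.
        -- rewrite Ropp_0, d0, !Rmult_0_l, cos_0, sin_0. ring.
      * auto_derive; [easy|]. rewrite Rmult_0_l, cos_0. ring.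
      * rewrite Ropp_0, Rmult_0_l, cos_0. ring.
      * rewrite Rmult_0_l. apply sin_0.
      * lra.
    + replace (bY 1 x) with ((- (2 * besselJdot 1 x) + 2 / x * besselJ 0 x) / (- PI)) by (simpl; field; lra).
      (* The recurrence replaces [J_(-mu)] by the orders [1 - mu] and [2 - mu], which are near 0 and
         1 when [mu] is near 1. *)
      apply (filterlim_ext (fun h => (besselJ (1 + h) x * cos ((1 + h) * PI) -
        (2 * (1 - (1 + h)) / x * besselJ (1 - (1 + h)) x - besselJ (2 - (1 + h)) x)) / sin ((1 + h) * PI))).
      { intros h. unfold besselY_quot. f_equal. f_equal.
        pose proof (besselJ_rec (1 - (1 + h)) x Hx) as E.
        replace (1 - (1 + h) + 1) with (2 - (1 + h)) in E by ring.
        replace (1 - (1 + h) - 1) with (- (INR 1 + h)) in E by (simpl; ring). rewrite E. ring. }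
      apply (quotient_limit (fun mu => besselJ mu x * cos (mu * PI) -
        (2 * (1 - mu) / x * besselJ (1 - mu) x - besselJ (2 - mu) x)) (fun mu => sin (mu * PI)) 1).
      * replace 0 with (1 + - 1) in e0, d0 by ring. replace 1 with (2 + - 1) in e1, d1 by ring.
        auto_derive.
        -- replace 1 with (2 + - 1) at 1 by ring. repeat split; assumption.
        -- replace (Derive (fun x0 => besselJ x0 x) 1) with (besselJdot 1 x) by (symmetry; now apply is_derive_unique).
           replace (Derive (fun x0 => besselJ x0 x) (2 + - (1))) with (besselJdot 1 x)
             by (symmetry; replace (2 + - (1)) with 1 by ring; now apply is_derive_unique).
           rewrite (Rmult_1_l PI), cos_PI, sin_PI. replace (1 + - (1)) with 0 by ring. field. lra.
      * auto_derive; [easy|]. rewrite Rmult_1_l, cos_PI. ring.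
      * rewrite Rmult_1_l, cos_PI. replace (2 - 1) with 1 by ring. replace (1 - 1) with 0 by ring. field. lra.
      * rewrite Rmult_1_l. apply sin_PI.
      * lra.
  - split; [exact IH2|]. rewrite bY_SS.
    apply (filterlim_ext (fun h => (2 * (INR (S n) + h) / x) * besselY_quot (INR (S n) + h) x - besselY_quot (INR n + h) x)).
    { intros h. rewrite (S_INR (S n)). replace (INR (S n) + 1 + h) with (INR (S n) + h + 1) by ring.
      rewrite besselY_quot_rec by assumption. rewrite (S_INR n). f_equal. f_equal. ring. }
    apply filterlim_minus_R; [typeclasses eauto| |exact IH1].
    apply filterlim_mult_R; [typeclasses eauto| |exact IH2].
    assert (C : continuous (fun h => 2 * (INR (S n) + h) / x) 0)
      by (apply (ex_derive_continuous (fun h => 2 * (INR (S n) + h) / x)); auto_derive; lra).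
    unfold continuous in C. rewrite Rplus_0_r in C.
    eapply filterlim_filter_le_1; [|exact C]. apply filter_le_within.
Qed.

Lemma besselY_INR (n : nat) (x : R) : 0 < x -> besselY (INR n) x = bY n x.
Proof.
  intros Hx. unfold besselY. destruct (Req_EM_T (frac_part (INR n)) 0) as [_|Hne].
  - rewrite (is_lim_unique _ (INR n) (bY n x)); [reflexivity|].
    apply is_lim_spec. intros eps.
    destruct (proj1 (filterlim_locally _ _) (bY_limit n x Hx) eps) as [d Hd].
    exists d. intros y Hy Hne. specialize (Hd (y - INR n)).
    rewrite Rplus_minus in Hd. apply Hd; [|intros E; apply Hne; apply Rminus_diag_uniq; exact E].
    change (Rabs (y - INR n - 0) < d). rewrite Rminus_0_r. exact Hy.
  - exfalso. apply Hne. unfold frac_part. rewrite Int_part_INR, <- INR_IZR_INZ. ring.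
Qed.

Lemma bY_system (n : nat) (x : R) : 0 < x ->
  is_derive (bY n) x (INR n / x * bY n x - bY (S n) x) /\
  is_derive (bY (S n)) x (bY n x - (INR n + 1) / x * bY (S n) x).
Proof.
  intros Hx. assert (PP := PI_RGT_0).
  induction n as [|n [IH1 IH2]].
  - pose proof (is_derive_besselJdot 0 x Hx) as D0. pose proof (is_derive_besselJdot 1 x Hx) as D1.
    pose proof (is_derive_besselJ 0 x Hx) as E0.
    replace (0 + 1) with 1 in D0, E0 by ring.
    split.
    + simpl. eapply is_derive_eqr; [apply (is_derive_scal (besselJdot 0) x (2 / PI)); exact D0|]. field. lra.
    + simpl. auto_derive.
      * repeat split; [eexists; exact D1|eexists; exact E0|lra].
      * known_derive.
        rewrite besselJdot_rec by lra. replace (1 - 1) with 0 by ring. field. lra.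
  - split.
    + eapply is_derive_eqr; [exact IH2|]. rewrite bY_SS, S_INR. field. lra.
    + apply is_derive_ext with (fun x => 2 * INR (S n) / x * bY (S n) x - bY n x); [reflexivity|].
      set (f := bY (S n)) in *. set (g := bY n) in *.
      auto_derive.
      * repeat split; [lra|eexists; exact IH2|eexists; exact IH1].
      * known_derive.
        rewrite bY_SS. fold f g.
        rewrite ?S_INR. change (match n with 0%nat => 1 | S _ => INR n + 1 end) with (INR (S n)). rewrite ?S_INR. field. lra.
Qed.

Lemma besselY_quot_wronskian (mu x : R) : 0 < x -> sin (mu * PI) <> 0 ->
  x * (besselJ (mu + 1) x * besselY_quot mu x - besselJ mu x * besselY_quot (mu + 1) x)
  = - (2 * rGamma (mu + 1) * rGamma (- mu)) / sin (mu * PI).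
Proof.
  intros Hx Hs. rewrite <- (besselJ_wronskian mu x Hx). unfold besselY_quot.
  rewrite sin_PI_shift, cos_PI_shift. replace (- (mu + 1)) with (- mu - 1) by ring.
  field. exact Hs.
Qed.

Lemma filterlim_besselJ_order (nu x : R) : 0 <= nu ->
  filterlim (fun h => besselJ (nu + h) x) (locally' 0) (locally (besselJ nu x)).
Proof.
  intros Hnu.
  assert (C : continuous (fun h => besselJ (nu + h) x) 0).
  { apply (ex_derive_continuous (fun h => besselJ (nu + h) x)).
    exists (besselJdot nu x). 
    pose proof (is_derive_besselJ_order nu x Hnu) as D.
    replace nu with (nu + 0) in D at 1 by ring.
    eapply is_derive_eqr; [apply (is_derive_comp (fun m => besselJ m x) (fun h => nu + h) 0 _ 1 D)|].
    - auto_derive; [easy|ring].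
    - apply Rmult_1_l. }
  unfold continuous in C. rewrite Rplus_0_r in C.
  eapply filterlim_filter_le_1; [|exact C]. apply filter_le_within.
Qed.

(** At [n = 0] it is the limit of [besselY_quot_wronskian]: writing [rGamma (- h)] as
    [- h rGamma (1 - h)] leaves the factor [h / sin (h PI)], which tends to [1 / PI]. The recurrence
    carries the constant from [n] to [n + 1]. *)
Lemma bY_wronskian (n : nat) (x : R) : 0 < x ->
  x * (besselJ (INR n + 1) x * bY n x - besselJ (INR n) x * bY (S n) x) = 2 / PI.
Proof.
  intros Hx. assert (PP := PI_RGT_0).
  induction n as [|n IH].
  - simpl INR. rewrite Rplus_0_l.
    assert (L1 : filterlim (fun h => x * (besselJ (1 + h) x * besselY_quot (INR 0 + h) x - besselJ (0 + h) x * besselY_quot (INR 1 + h) x))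
      (locally' 0) (locally (x * (besselJ 1 x * bY 0 x - besselJ 0 x * bY 1 x)))).
    { apply filterlim_mult_R; [typeclasses eauto|apply filterlim_const|].
      apply filterlim_minus_R; [typeclasses eauto| |]; apply filterlim_mult_R; try typeclasses eauto.
      - apply filterlim_besselJ_order. lra.
      - now apply bY_limit.
      - apply filterlim_besselJ_order. lra.
      - now apply bY_limit. }
    assert (C : continuous (fun h => 2 * rGamma (1 + h) * rGamma (1 - h)) 0).
    { pose proof (is_derive_rGamma 1 Rlt_0_1) as D. 
      apply (ex_derive_continuous (fun h => 2 * rGamma (1 + h) * rGamma (1 - h))). auto_derive.
      rewrite Ropp_0, Rplus_0_r. repeat split; eexists; exact D. }
    assert (Q : filterlim (fun h => (0 + h) / sin ((0 + h) * PI)) (locally' 0) (locally (1 / PI))).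
    { apply (quotient_limit (fun h => h) (fun h => sin (h * PI))); [apply (is_derive_id 0)| |reflexivity| |lra].
      - auto_derive; [easy|]. rewrite Rmult_0_l, cos_0. ring.
      - rewrite Rmult_0_l. apply sin_0. }
    assert (L2 : filterlim (fun h => (2 * rGamma (1 + h) * rGamma (1 - h)) * ((0 + h) / sin ((0 + h) * PI)))
       (locally' 0) (locally (2 / PI))).
    { replace (2 / PI) with (2 * rGamma (1 + 0) * rGamma (1 - 0) * (1 / PI))
        by (rewrite Rplus_0_r, Rminus_0_r, rGamma_1; field; lra).
      apply filterlim_mult_R; [typeclasses eauto| |exact Q].
      eapply filterlim_filter_le_1; [|exact C]. apply filter_le_within. }
    apply (filterlim_locally_unique (F := Rbar_locally' (Finite 0))
       (fun h => x * (besselJ (1 + h) x * besselY_quot (INR 0 + h) x - besselJ (0 + h) x * besselY_quot (INR 1 + h) x))); [exact L1|].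
    apply (filterlim_ext_loc (fun h => (2 * rGamma (1 + h) * rGamma (1 - h)) * ((0 + h) / sin ((0 + h) * PI)))); [|exact L2].
    exists (mkposreal 1 Rlt_0_1). intros h Hh Hne. apply ball_R0 in Hh. simpl in Hh.
    assert (Hs : sin (h * PI) <> 0).
    { apply Rabs_def2 in Hh. destruct (Rlt_dec 0 h) as [P|P].
      - apply Rgt_not_eq, sin_gt_0; nra.
      - assert (h < 0) by (destruct (Rtotal_order h 0) as [?|[?|?]]; [assumption|contradiction|lra]).
        apply Rlt_not_eq. apply sin_lt_0_var; nra. }
    pose proof (besselY_quot_wronskian h x Hx Hs) as W. simpl INR.
    rewrite !Rplus_0_l, (Rplus_comm 1 h), W.
    rewrite (rGamma_shift (- h)). replace (- h + 1) with (1 - h) by ring. field. exact Hs.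
  - rewrite <- IH, bY_SS. rewrite (besselJ_rec (INR (S n)) x) by assumption.
    rewrite S_INR. replace (INR n + 1 - 1) with (INR n) by ring. field. lra.
Qed.

(** Bessel's equation as a first-order system, with [g] in the role of the function of order
    [nu + 1]. It is the common interface of [J] and [Y], behind which integer and noninteger orders
    look alike. *)
Definition bessel_pair (nu : R) (f g : R -> R) : Prop :=
  forall x : R, 0 < x -> is_derive f x (nu / x * f x - g x) /\ is_derive g x (f x - (nu + 1) / x * g x).

Lemma besselJ_pair (nu : R) : bessel_pair nu (besselJ nu) (besselJ (nu + 1)).
Proof.
  intros x Hx. split; [now apply is_derive_besselJ|].
  pose proof (is_derive_besselJ_down (nu + 1) x Hx) as D. now replace (nu + 1 - 1) with nu in D by ring.
Qed.

(** [K] is the constant Wronskian of [J_nu] and [Y_nu]; what matters later is that it is not zero.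
    For integer [nu] it is [2 / PI]; otherwise its numerator is a product of values of [rGamma] off
    its zeros. *)
Lemma besselY_pair (nu : R) : 0 <= nu ->
  exists (g : R -> R) (K : R), K <> 0 /\ bessel_pair nu (besselY nu) g /\
    forall x, 0 < x -> x * (besselJ (nu + 1) x * besselY nu x - besselJ nu x * g x) = K.
Proof.
  intros Hnu. assert (PP := PI_RGT_0).
  destruct (Req_dec (sin (nu * PI)) 0) as [Hs|Hs].
  - assert (E : exists n, nu = INR n).
    { apply sin_eq_0_0 in Hs. destruct Hs as [k Hk]. apply Rmult_eq_reg_r in Hk; [|lra].
      rewrite Hk in Hnu. apply le_IZR in Hnu. exists (Z.to_nat k).
      rewrite INR_IZR_INZ, Z2Nat.id by assumption. exact Hk. }
    destruct E as [n ->]. exists (bY (S n)), (2 / PI).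
    split; [|split].
    + apply Rgt_not_eq. apply Rdiv_lt_0_compat; lra.
    + intros x Hx. rewrite besselY_INR by assumption. destruct (bY_system n x Hx) as [D1 D2].
      split; [|exact D2].
      apply is_derive_ext_loc with (bY n); [|exact D1].
      exists (mkposreal x Hx). intros y Hy. apply ball_R in Hy. simpl in Hy. apply Rabs_def2 in Hy.
      symmetry. apply besselY_INR. lra.
    + intros x Hx. rewrite besselY_INR by assumption. now apply bY_wronskian.
  - assert (Hfr : frac_part nu <> 0).
    { intros E. apply fp_nat in E. destruct E as [k ->]. apply Hs. apply sin_eq_0_1. now exists k. }
    assert (EY : forall x, besselY nu x = besselY_quot nu x).
    { intros x. unfold besselY. destruct (Req_EM_T (frac_part nu) 0); [contradiction|reflexivity]. }
    assert (Hni : forall k : Z, nu <> IZR k).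
    { intros k ->. apply Hs. apply sin_eq_0_1. now exists k. }
    exists (besselY_quot (nu + 1)), (- (2 * rGamma (nu + 1) * rGamma (- nu)) / sin (nu * PI)).
    split; [|split].
    + apply Rmult_integral_contrapositive_currified; [|now apply Rinv_neq_0_compat].
      apply Ropp_neq_0_compat. apply Rmult_integral_contrapositive_currified.
      * apply Rmult_integral_contrapositive_currified; [lra|].
        apply rGamma_neq_0. intros n. pose proof (pos_INR n). lra.
      * apply rGamma_neq_0. intros n E. apply (Hni (Z.of_nat n)). rewrite <- INR_IZR_INZ. lra.
    + intros x Hx. rewrite EY.
      pose proof (is_derive_besselJ nu x Hx) as D1.
      pose proof (is_derive_besselJ_down (- nu) x Hx) as D2.
      pose proof (is_derive_besselJ_down (nu + 1) x Hx) as D3.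
      pose proof (is_derive_besselJ (- (nu + 1)) x Hx) as D4.
      replace (- (nu + 1) + 1) with (- nu) in D4 by ring.
      replace (nu + 1 - 1) with nu in D3 by ring.
      replace (- nu - 1) with (- (nu + 1)) in D2 by ring.
      split.
      * apply is_derive_ext with (besselY_quot nu); [intros; symmetry; apply EY|].
        unfold besselY_quot. auto_derive.
        -- repeat split; [eexists; exact D1|eexists; exact D2].
        -- known_derive.
           rewrite sin_PI_shift, cos_PI_shift. field. split; [exact Hs|lra].
      * unfold besselY_quot. rewrite sin_PI_shift, cos_PI_shift. auto_derive.
        -- repeat split; [eexists; exact D3|eexists; exact D4].
        -- known_derive.
           field. split; [exact Hs|lra].
    + intros x Hx. rewrite EY. now apply besselY_quot_wronskian.
Qed.

(** * The Sturm-Liouville solution as a power series in the spectral variable *)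

Lemma is_derive_continuous (f : R -> R) (x l : R) : is_derive f x l -> continuous f x.
Proof. intros H. apply (ex_derive_continuous f). now exists l. Qed.

Lemma is_derive_continuity_pt (f : R -> R) (x l : R) : is_derive f x l -> continuity_pt f x.
Proof. intros H. apply continuity_pt_filterlim. now apply (is_derive_continuous f x l). Qed.

Lemma incr_of_derive (f g : R -> R) (a b : R) : a <= b ->
  (forall x, a <= x <= b -> is_derive f x (g x)) -> (forall x, a <= x <= b -> 0 <= g x) -> f a <= f b.
Proof.
  intros Hab D P.
  destruct (MVT_gen f a b g) as [c [Hc E]].
  - intros x Hx. rewrite Rmin_left, Rmax_right in Hx by assumption. apply D. lra.
  - intros x Hx. rewrite Rmin_left, Rmax_right in Hx by assumption. apply is_derive_continuity_pt with (g x). now apply D.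
  - rewrite Rmin_left, Rmax_right in Hc by assumption. specialize (P c Hc). nra.
Qed.

Lemma pow_integral_bound_right (g g' : R -> R) (x0 x M : R) (k : nat) :
  x0 <= x -> (forall s, x0 <= s <= x -> is_derive g s (g' s)) ->
  (forall s, x0 <= s <= x -> Rabs (g' s) <= M * (s - x0) ^ k / INR (fact k)) -> g x0 = 0 ->
  Rabs (g x) <= M * (x - x0) ^ (S k) / INR (fact (S k)).
Proof.
  intros Hx D B G0.
  assert (P : forall s, is_derive (fun s => M * (s - x0) ^ (S k) / INR (fact (S k))) s (M * (s - x0) ^ k / INR (fact k))).
  { intros s.
    assert (Ef : INR (fact (S k)) = INR (S k) * INR (fact k)) by (rewrite <- mult_INR; reflexivity).
    pose proof (INR_fact_pos k). pose proof (not_0_INR (S k) ltac:(lia)).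
    rewrite Ef. set (n := S k) in *. auto_derive; [easy|].
    replace (Nat.pred n) with k by reflexivity. unfold Rminus. field. split; assumption || lra. }
  assert (Z : M * (x0 - x0) ^ S k / INR (fact (S k)) = 0).
  { rewrite Rminus_diag, pow_i by lia. unfold Rdiv. ring. }
  apply Rabs_le. split.
  - pose proof (incr_of_derive (fun s => M * (s - x0) ^ (S k) / INR (fact (S k)) + g s)
      (fun s => M * (s - x0) ^ k / INR (fact k) + g' s) x0 x Hx) as H.
    cbv beta in H. rewrite Z, G0 in H. cut (0 + 0 <= M * (x - x0) ^ S k / INR (fact (S k)) + g x); [lra|].
    apply H.
    + intros s Hs. apply (is_derive_plus (fun s => M * (s - x0) ^ (S k) / INR (fact (S k))) g); [apply P|now apply D].
    + intros s Hs. specialize (B s Hs). pose proof (Rabs_maj2 (g' s)). lra.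
  - pose proof (incr_of_derive (fun s => M * (s - x0) ^ (S k) / INR (fact (S k)) - g s)
      (fun s => M * (s - x0) ^ k / INR (fact k) - g' s) x0 x Hx) as H.
    cbv beta in H. rewrite Z, G0 in H. cut (0 - 0 <= M * (x - x0) ^ S k / INR (fact (S k)) - g x); [lra|].
    apply H.
    + intros s Hs. apply (is_derive_minus (fun s => M * (s - x0) ^ (S k) / INR (fact (S k))) g); [apply P|now apply D].
    + intros s Hs. specialize (B s Hs). pose proof (Rle_abs (g' s)). lra.
Qed.

(** To the left of [x0] the one-sided bound is applied to the reflection [s |-> g (2 x0 - s)]. *)
Lemma pow_integral_bound (g g' : R -> R) (x0 L x M : R) (k : nat) :
  (forall s, is_derive g s (g' s)) ->
  (forall s, Rabs (s - x0) <= L -> Rabs (g' s) <= M * Rabs (s - x0) ^ k / INR (fact k)) -> g x0 = 0 ->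
  Rabs (x - x0) <= L ->
  Rabs (g x) <= M * Rabs (x - x0) ^ (S k) / INR (fact (S k)).
Proof.
  intros D B G0 Hx. destruct (Rle_dec x0 x) as [H|H].
  - rewrite (Rabs_pos_eq (x - x0)) in * by lra.
    apply pow_integral_bound_right with g'; trivial.
    intros s Hs. specialize (B s). rewrite (Rabs_pos_eq (s - x0)) in B by lra. apply B. lra.
  - rewrite (Rabs_left1 (x - x0)) in * by lra.
    pose proof (pow_integral_bound_right (fun s => g (2 * x0 - s)) (fun s => - g' (2 * x0 - s)) x0 (2 * x0 - x) M k) as Q.
    cbv beta in Q. replace (2 * x0 - (2 * x0 - x)) with x in Q by ring.
    replace (2 * x0 - x0) with x0 in Q by ring.
    replace (2 * x0 - x - x0) with (- (x - x0)) in Q by ring.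
    apply Q; trivial; [lra| |].
    + intros s _. eapply is_derive_eqr; [apply (is_derive_comp g (fun s => 2 * x0 - s) s _ (-1) (D _))|].
      * auto_derive; [easy|unfold Rminus; ring].
      * change (scal (-1) (g' (2 * x0 - s))) with (-1 * g' (2 * x0 - s)). ring.
    + intros s Hs. rewrite Rabs_Ropp. specialize (B (2 * x0 - s)).
      replace (2 * x0 - s - x0) with (- (s - x0)) in B by ring.
      rewrite Rabs_Ropp, Rabs_pos_eq in B by lra. apply B. lra.
Qed.

(** Variation of constants: the solution of [g' = m g + f] with [g x0 = 0]. *)
Definition vint (x0 m : R) (f : R -> R) (x : R) : R :=
  exp (m * (x - x0)) * RInt (fun s => exp (- (m * (s - x0))) * f s) x0 x.

Lemma vint_integrand_continuous (x0 m : R) (f : R -> R) (x : R) :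
  continuous f x -> continuous (fun s => exp (- (m * (s - x0))) * f s) x.
Proof.
  intros C. apply (continuous_mult (fun s => exp (- (m * (s - x0)))) f); [|exact C].
  apply (ex_derive_continuous (fun s => exp (- (m * (s - x0))))). now auto_derive.
Qed.

Lemma is_derive_vint (x0 m : R) (f : R -> R) (x : R) :
  (forall y : R, continuous f y) -> is_derive (vint x0 m f) x (m * vint x0 m f x + f x).
Proof.
  intros C.
  pose proof (is_derive_RInt_R (fun s => exp (- (m * (s - x0))) * f s) x0 x
    (fun y => vint_integrand_continuous x0 m f y (C y))) as D.
  assert (D1 : is_derive (fun x => exp (m * (x - x0))) x (m * exp (m * (x - x0)))) by (auto_derive; [easy|unfold Rminus; ring]).
  eapply is_derive_eqr.
  - apply (is_derive_mult (fun x => exp (m * (x - x0))) (fun x => RInt (fun s => exp (- (m * (s - x0))) * f s) x0 x) x _ _ D1 D).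
    apply Rmult_comm.
  - change plus with Rplus. change mult with Rmult. unfold vint.
    rewrite <- (Rmult_assoc (exp (m * (x - x0)))), <- exp_plus, Rplus_opp_r, exp_0. ring.
Qed.

Lemma vint_x0 (x0 m : R) (f : R -> R) : vint x0 m f x0 = 0.
Proof. unfold vint. rewrite RInt_point. apply Rmult_0_r. Qed.

Lemma exp_le (a b : R) : a <= b -> exp a <= exp b.
Proof. intros [H| ->]; [now apply Rlt_le, exp_increasing|lra]. Qed.

Lemma vint_bound (x0 m : R) (f : R -> R) (L M x : R) (k : nat) :
  (forall y : R, continuous f y) ->
  (forall s, Rabs (s - x0) <= L -> Rabs (f s) <= M * Rabs (s - x0) ^ k / INR (fact k)) ->
  Rabs (x - x0) <= L ->
  Rabs (vint x0 m f x) <= exp (Rabs m * L) * (exp (Rabs m * L) * M) * Rabs (x - x0) ^ (S k) / INR (fact (S k)).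
Proof.
  intros C B Hx.
  assert (E : forall s, Rabs (s - x0) <= L -> exp (m * (s - x0)) <= exp (Rabs m * L) /\ exp (- (m * (s - x0))) <= exp (Rabs m * L)).
  { intros s Hs.
    assert (Q : Rabs (m * (s - x0)) <= Rabs m * L) by (rewrite Rabs_mult; apply Rmult_le_compat_l; [apply Rabs_pos|exact Hs]).
    pose proof (Rle_abs (m * (s - x0))). pose proof (Rabs_maj2 (m * (s - x0))).
    split; apply exp_le; lra. }
  unfold vint. rewrite Rabs_mult.
  replace (exp (Rabs m * L) * (exp (Rabs m * L) * M) * Rabs (x - x0) ^ S k / INR (fact (S k)))
    with (exp (Rabs m * L) * ((exp (Rabs m * L) * M) * Rabs (x - x0) ^ S k / INR (fact (S k)))) by (unfold Rdiv; ring).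
  apply Rmult_le_compat; try apply Rabs_pos.
  - rewrite Rabs_pos_eq by (apply Rlt_le, exp_pos). now apply E.
  - apply (pow_integral_bound (fun x => RInt (fun s => exp (- (m * (s - x0))) * f s) x0 x)
      (fun s => exp (- (m * (s - x0))) * f s) x0 L); trivial.
    + intros s. apply (is_derive_RInt_R (fun s => exp (- (m * (s - x0))) * f s)).
      intros y. now apply vint_integrand_continuous.
    + intros s Hs. rewrite Rabs_mult, (Rabs_pos_eq (exp _)) by (apply Rlt_le, exp_pos).
      replace (exp (Rabs m * L) * M * Rabs (s - x0) ^ k / INR (fact k))
        with (exp (Rabs m * L) * (M * Rabs (s - x0) ^ k / INR (fact k))) by (unfold Rdiv; ring).
      apply Rmult_le_compat; [apply Rlt_le, exp_pos|apply Rabs_pos|now apply E|now apply B].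
    + exact (RInt_point x0 (fun s => exp (- (m * (s - x0))) * f s)).
Qed.

Section Family.
Variables nu de x0 : R.

(** The solution of [u'' = nu^2 u] with [u = 1], [u' = de] at [x0]. The operator factors as
    [(d/dx + nu)(d/dx - nu)], so this and all later coefficients arise from first-order
    integrations; unlike a formula with [sinh (nu x) / nu], this form does not degenerate at
    [nu = 0]. *)
Definition uu0 (x : R) : R :=
  exp (nu * (x - x0)) + vint x0 nu (fun s => (de - nu) * exp (- (nu * (s - x0)))) x.

(** Coefficients of [lam ^ k] in [u] and in [p = u' - nu u], where
    [u'' = (nu^2 - lam exp (2 x)) u], [u x0 = 1], [u' x0 = de]. *)
Fixpoint up (k : nat) : (R -> R) * (R -> R) :=
  match k with
  | O => (uu0, fun x => (de - nu) * exp (- (nu * (x - x0))))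
  | S j => let p := vint x0 (- nu) (fun s => - exp (2 * s) * fst (up j) s) in (vint x0 nu p, p)
  end.
Definition uu (k : nat) : R -> R := fst (up k).
Definition pp (k : nat) : R -> R := snd (up k).
(** Coefficient of [u' - de u], since [u' = nu u + p]. In the variable [x = ln t] this is [t D u],
    so at [x = ln Ro] it is the coefficient of [F]. *)
Definition ff (k : nat) (x : R) : R := pp k x + (nu - de) * uu k x.
Definition uprev (k : nat) (x : R) : R := match k with O => 0 | S j => uu j x end.

Lemma up_derive (k : nat) (x : R) :
  is_derive (uu k) x (nu * uu k x + pp k x) /\
  is_derive (pp k) x (- nu * pp k x - exp (2 * x) * uprev k x).
Proof.
  revert x. induction k as [|k IH]; intros x.
  - assert (D : forall y, is_derive (fun x => (de - nu) * exp (- (nu * (x - x0)))) y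
        (- nu * ((de - nu) * exp (- (nu * (y - x0)))) - exp (2 * y) * 0)) by (intros y; auto_derive; [easy|unfold Rminus; ring]).
    split; [|apply D].
    unfold uu, pp; simpl. unfold uu0.
    pose proof (is_derive_vint x0 nu (fun s => (de - nu) * exp (- (nu * (s - x0)))) x
      (fun y => is_derive_continuous _ _ _ (D y))) as V.
    assert (D1 : is_derive (fun x => exp (nu * (x - x0))) x (nu * exp (nu * (x - x0)))) by (auto_derive; [easy|unfold Rminus; ring]).
    eapply is_derive_eqr; [exact (is_derive_plus _ _ _ _ _ D1 V)|].
    change plus with Rplus. cbv beta. ring.
  - assert (C : forall y : R, continuous (fun s => - exp (2 * s) * uu k s) y).
    { intros y. apply (continuous_mult (fun s => - exp (2 * s)) (uu k)).
      - apply (ex_derive_continuous (fun s => - exp (2 * s))). now auto_derive.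
      - exact (is_derive_continuous _ _ _ (proj1 (IH y))). }
    assert (D : forall y, is_derive (pp (S k)) y (- nu * pp (S k) y - exp (2 * y) * uprev (S k) y)).
    { intros y. eapply is_derive_eqr; [apply (is_derive_vint x0 (- nu) _ y C)|].
      unfold pp, uprev. simpl. fold (uu k). unfold uu. ring. }
    split; [|apply D].
    apply (is_derive_vint x0 nu (pp (S k))). intros y. eapply is_derive_continuous, D.
Qed.

Lemma is_derive_uu (k : nat) (x : R) : is_derive (uu k) x (ff k x + de * uu k x).
Proof. eapply is_derive_eqr; [exact (proj1 (up_derive k x))|]. unfold ff. ring. Qed.

Lemma is_derive_ff (k : nat) (x : R) :
  is_derive (ff k) x ((nu ^ 2 - de ^ 2) * uu k x - de * ff k x - exp (2 * x) * uprev k x).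
Proof.
  destruct (up_derive k x) as [D1 D2].
  eapply is_derive_eqr.
  - apply (is_derive_plus (pp k) (fun x => (nu - de) * uu k x)); [exact D2|].
    apply (is_derive_scal (uu k) x (nu - de) _ D1).
  - change plus with Rplus. unfold ff. change mult with Rmult. ring.
Qed.

Lemma uu_x0 (k : nat) : uu k x0 = match k with O => 1 | S _ => 0 end.
Proof.
  destruct k as [|k]; unfold uu; simpl; [|apply vint_x0].
  unfold uu0. rewrite vint_x0, Rminus_diag, Rmult_0_r, exp_0. ring.
Qed.

Lemma ff_x0 (k : nat) : ff k x0 = 0.
Proof.
  unfold ff. rewrite uu_x0. destruct k as [|k]; unfold pp; simpl; [|rewrite vint_x0; ring].
  rewrite Rminus_diag, Rmult_0_r, Ropp_0, exp_0. ring.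
Qed.

Lemma uu_continuous (k : nat) (x : R) : continuous (uu k) x.
Proof. eapply is_derive_continuous, is_derive_uu. Qed.

Lemma ff_continuous (k : nat) (x : R) : continuous (ff k) x.
Proof. eapply is_derive_continuous, is_derive_ff. Qed.

Lemma pow_fact_shift (L t : R) (k : nat) : 0 <= t <= L ->
  t ^ S k / INR (fact (S k)) <= L * (t ^ k / INR (fact k)).
Proof.
  intros Ht. replace (fact (S k)) with ((S k) * fact k)%nat by reflexivity. rewrite mult_INR.
  pose proof (INR_fact_pos k) as Pf. pose proof (pow_le t k (proj1 Ht)) as Pp.
  assert (Q : 1 <= INR (S k)) by (rewrite S_INR; pose proof (pos_INR k); lra).
  assert (Z : 0 <= t ^ k / INR (fact k)) by (apply Rdiv_le_0_compat; lra).
  replace (t ^ S k / (INR (S k) * INR (fact k))) with (t * / INR (S k) * (t ^ k / INR (fact k)))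
    by (rewrite <- tech_pow_Rmult; field; split; lra).
  apply Rmult_le_compat_r; [exact Z|].
  assert (/ INR (S k) <= 1) by (rewrite <- Rinv_1; apply Rinv_le_contravar; lra).
  pose proof (Rinv_0_lt_compat (INR (S k)) ltac:(lra)). nra.
Qed.

(** Each recursion step integrates twice. One integration supplies the factor [|x - x0| / (k + 1)]
    and hence the factorial; the gain of the other is traded for the interval length [L] by
    [pow_fact_shift]. *)
Lemma up_bound (L : R) : 0 < L ->
  exists A B, 0 <= A /\ 0 <= B /\ forall k x, Rabs (x - x0) <= L ->
    Rabs (uu k x) <= A * B ^ k / INR (fact k) /\ Rabs (ff k x) <= A * B ^ k / INR (fact k).
Proof.
  intros HL.
  set (E := exp (Rabs nu * L)). set (G := exp (2 * (Rabs x0 + L))).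
  assert (E1 : 1 <= E) by (rewrite <- exp_0; apply exp_le; pose proof (Rabs_pos nu); nra).
  assert (G0 : 0 < G) by apply exp_pos.
  set (d := Rabs (de - nu)). assert (d0 : 0 <= d) by apply Rabs_pos.
  assert (Hp0 : forall s, Rabs (s - x0) <= L -> Rabs ((de - nu) * exp (- (nu * (s - x0)))) <= d * E).
  { intros s Hs. rewrite Rabs_mult, (Rabs_pos_eq (exp _)) by (apply Rlt_le, exp_pos).
    apply Rmult_le_compat_l; [exact d0|]. apply exp_le.
    eapply Rle_trans; [apply Rle_abs|]. rewrite Rabs_Ropp, Rabs_mult. apply Rmult_le_compat_l; [apply Rabs_pos|exact Hs]. }
  set (A := E + E * (E * (d * E)) * L).
  assert (A0 : 0 <= A) by (unfold A; assert (0 <= E * (E * (d * E)) * L) by (repeat apply Rmult_le_pos; lra); lra).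
  set (Q := (E * E) * (E * E) * G * L).
  assert (Q0 : 0 <= Q) by (unfold Q; repeat apply Rmult_le_pos; lra).
  assert (ENn : exp (Rabs (- nu) * L) = E) by (rewrite Rabs_Ropp; reflexivity).
  assert (Hp : forall k, (forall x, Rabs (x - x0) <= L -> Rabs (uu k x) <= A * Q ^ k * Rabs (x - x0) ^ k / INR (fact k)) ->
     forall x, Rabs (x - x0) <= L -> Rabs (pp (S k) x) <= E * (E * (G * (A * Q ^ k))) * Rabs (x - x0) ^ S k / INR (fact (S k))).
  { intros k IH x Hx. rewrite <- ENn. unfold pp; simpl snd.
    apply (vint_bound x0 (- nu) (fun s => - exp (2 * s) * uu k s) L (G * (A * Q ^ k)) x k); [| |exact Hx].
    - intros y. apply (continuous_mult (fun s => - exp (2 * s)) (uu k)); [|apply uu_continuous].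
      apply (ex_derive_continuous (fun s => - exp (2 * s))). now auto_derive.
    - intros s Hs. rewrite Rabs_mult, Rabs_Ropp, (Rabs_pos_eq (exp _)) by (apply Rlt_le, exp_pos).
      replace (G * (A * Q ^ k) * Rabs (s - x0) ^ k / INR (fact k)) with (G * (A * Q ^ k * Rabs (s - x0) ^ k / INR (fact k)))
        by (unfold Rdiv; ring).
      apply Rmult_le_compat; [apply Rlt_le, exp_pos|apply Rabs_pos| |now apply IH].
      apply exp_le. pose proof (Rle_abs (s - x0)). pose proof (Rle_abs x0). lra. }
  assert (Hu : forall k x, Rabs (x - x0) <= L -> Rabs (uu k x) <= A * Q ^ k * Rabs (x - x0) ^ k / INR (fact k)).
  { induction k as [|k IH]; intros x Hx.
    - simpl. replace (A * 1 * 1 / 1) with A by field. unfold uu; simpl. unfold uu0.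
      eapply Rle_trans; [apply Rabs_triang|]. unfold A. apply Rplus_le_compat.
      + rewrite Rabs_pos_eq by (apply Rlt_le, exp_pos). apply exp_le.
        eapply Rle_trans; [apply Rle_abs|]. rewrite Rabs_mult. apply Rmult_le_compat_l; [apply Rabs_pos|exact Hx].
      + eapply Rle_trans; [apply (vint_bound x0 nu _ L (d * E) x 0); [| |exact Hx]|].
        * intros y. apply (ex_derive_continuous (fun s => (de - nu) * exp (- (nu * (s - x0))))). now auto_derive.
        * intros s Hs. simpl. replace (d * E * 1 / 1) with (d * E) by field. now apply Hp0.
        * fold E. simpl. replace (E * (E * (d * E)) * (Rabs (x - x0) * 1) / 1) with (E * (E * (d * E)) * Rabs (x - x0)) by field.
          apply Rmult_le_compat_l; [|exact Hx]. repeat apply Rmult_le_pos; lra.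
    - eapply Rle_trans; [apply (vint_bound x0 nu (pp (S k)) L (E * (E * (G * (A * Q ^ k)))) x (S k)); [| |exact Hx]|].
      + intros y. exact (is_derive_continuous _ _ _ (proj2 (up_derive (S k) y))).
      + intros s Hs. now apply Hp.
      + fold E. pose proof (pow_fact_shift L (Rabs (x - x0)) (S k) (conj (Rabs_pos _) Hx)) as PS.
        replace (A * Q ^ S k * Rabs (x - x0) ^ S k / INR (fact (S k))) with
          (E * (E * (E * (E * (G * (A * Q ^ k))))) * (L * (Rabs (x - x0) ^ S k / INR (fact (S k)))))
          by (rewrite <- (tech_pow_Rmult Q); unfold Q at 2; unfold Rdiv; ring).
        unfold Rdiv at 1. rewrite Rmult_assoc. apply Rmult_le_compat_l; [|exact PS].
        pose proof (pow_le Q k Q0). repeat apply Rmult_le_pos; lra. }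
  (* The added 1 gives [B >= 1], so that the bound of [pp (S k)] with exponent [k] may be weakened
     to exponent [S k]. *)
  set (B := Q * L + 1).
  assert (B1 : 1 <= B) by (unfold B; assert (0 <= Q * L) by (apply Rmult_le_pos; lra); lra).
  assert (QB : forall k, (Q * L) ^ k <= B ^ k)
    by (intros k; apply pow_incr; split; [apply Rmult_le_pos; lra|unfold B; lra]).
  set (A1 := A + d * E + E * (E * (G * A)) * L).
  assert (N0 : 0 <= d * E) by (apply Rmult_le_pos; lra).
  assert (N1 : 0 <= E * (E * (G * A)) * L) by (repeat apply Rmult_le_pos; lra).
  assert (U : forall k x, Rabs (x - x0) <= L -> Rabs (uu k x) <= A1 * B ^ k / INR (fact k)).
  { intros k x Hx. eapply Rle_trans; [now apply Hu|].
    apply Rmult_le_compat_r; [apply Rlt_le, Rinv_0_lt_compat, INR_fact_pos|].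
    rewrite Rmult_assoc, <- Rpow_mult_distr. apply Rmult_le_compat; [lra| | unfold A1; lra|].
    - apply pow_le. apply Rmult_le_pos; [lra|apply Rabs_pos].
    - eapply Rle_trans; [|apply QB]. apply pow_incr. split; [apply Rmult_le_pos; [lra|apply Rabs_pos]|].
      apply Rmult_le_compat_l; lra. }
  assert (P : forall k x, Rabs (x - x0) <= L -> Rabs (pp k x) <= A1 * B ^ k / INR (fact k)).
  { intros [|k] x Hx.
    - simpl. replace (A1 * 1 / 1) with A1 by field. eapply Rle_trans; [now apply Hp0|]. unfold A1. lra.
    - eapply Rle_trans; [apply Hp; [apply Hu|exact Hx]|].
      apply Rmult_le_compat_r; [apply Rlt_le, Rinv_0_lt_compat, INR_fact_pos|].
      pose proof (pow_le Q k Q0) as PQ.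
      apply Rle_trans with (E * (E * (G * (A * Q ^ k))) * L ^ S k).
      + apply Rmult_le_compat_l; [repeat apply Rmult_le_pos; lra|]. apply pow_incr. split; [apply Rabs_pos|exact Hx].
      + replace (E * (E * (G * (A * Q ^ k))) * L ^ S k) with (E * (E * (G * A)) * L * (Q * L) ^ k)
          by (rewrite Rpow_mult_distr, <- (tech_pow_Rmult L); ring).
        apply Rmult_le_compat; [exact N1| |unfold A1; lra|].
        * apply pow_le. apply Rmult_le_pos; lra.
        * eapply Rle_trans; [apply QB|]. apply Rle_pow; [lra|lia]. }
  exists (A1 + Rabs (nu - de) * A1), B.
  assert (A10 : 0 <= A1) by (unfold A1; lra). pose proof (Rabs_pos (nu - de)) as Nd.
  assert (0 <= Rabs (nu - de) * A1) by now apply Rmult_le_pos.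
  split; [lra|]. split; [lra|]. intros k x Hx.
  assert (W : 0 <= B ^ k / INR (fact k)) by (apply Rdiv_le_0_compat; [apply pow_le; lra|apply INR_fact_pos]).
  specialize (U k x Hx). specialize (P k x Hx). unfold Rdiv in *. rewrite !Rmult_assoc in *. split.
  - eapply Rle_trans; [exact U|]. apply Rmult_le_compat_r; lra.
  - unfold ff. eapply Rle_trans; [apply Rabs_triang|]. rewrite Rabs_mult, Rmult_plus_distr_r.
    apply Rplus_le_compat; [exact P|]. rewrite Rmult_assoc. apply Rmult_le_compat_l; [exact Nd|exact U].
Qed.

Definition geo (c : nat -> R) : Prop := exists M rho, 0 <= M /\ 0 <= rho /\ forall k, Rabs (c k) <= M * rho ^ k.

(** The weights [c] take the place of [lam ^ k]. The choices made later are [lam ^ k] for [u],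
    [k lam ^ (k - 1)] for its derivative in [lam], and the real and imaginary parts of the powers of
    a complex number. *)
Definition Vs (c : nat -> R) (x : R) : R := Series (fun k => c k * uu k x).
Definition Fs (c : nat -> R) (x : R) : R := Series (fun k => c k * ff k x).

Lemma geo_mult_bound (c : nat -> R) (M rho A B v : R) (k : nat) : 0 <= M -> 0 <= rho ->
  Rabs (c k) <= M * rho ^ k -> Rabs v <= A * B ^ k / INR (fact k) ->
  Rabs (c k * v) <= M * A * (rho * B) ^ k / INR (fact k).
Proof.
  intros HM Hr H1 H2. rewrite Rabs_mult, Rpow_mult_distr.
  replace (M * A * (rho ^ k * B ^ k) / INR (fact k)) with ((M * rho ^ k) * (A * B ^ k / INR (fact k))) by (unfold Rdiv; ring).
  apply Rmult_le_compat; trivial; apply Rabs_pos.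
Qed.

Lemma ex_series_uu (c : nat -> R) (x : R) : geo c -> ex_series (fun k => c k * uu k x).
Proof.
  intros (M & rho & HM & Hr & Hc).
  destruct (up_bound (Rabs (x - x0) + 1) ltac:(pose proof (Rabs_pos (x - x0)); lra)) as (A & B & HA & HB & H).
  apply ex_series_le_R with (fun k => M * A * (rho * B) ^ k / INR (fact k)); [|apply ex_series_exp].
  intros k. apply geo_mult_bound; trivial. apply H. lra.
Qed.

Lemma ex_series_ff (c : nat -> R) (x : R) : geo c -> ex_series (fun k => c k * ff k x).
Proof.
  intros (M & rho & HM & Hr & Hc).
  destruct (up_bound (Rabs (x - x0) + 1) ltac:(pose proof (Rabs_pos (x - x0)); lra)) as (A & B & HA & HB & H).
  apply ex_series_le_R with (fun k => M * A * (rho * B) ^ k / INR (fact k)); [|apply ex_series_exp].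
  intros k. apply geo_mult_bound; trivial. apply H. lra.
Qed.

Lemma geo_shift (c : nat -> R) : geo c -> geo (fun k => c (S k)).
Proof.
  intros (M & rho & HM & Hr & Hc). exists (M * rho), rho. repeat split; trivial; [now apply Rmult_le_pos|].
  intros k. eapply Rle_trans; [apply Hc|]. rewrite <- tech_pow_Rmult. lra.
Qed.

Lemma ex_series_uprev (c : nat -> R) (x : R) : geo c -> ex_series (fun k => c k * uprev k x).
Proof.
  intros G. apply ex_series_incr_1. apply (ex_series_uu (fun k => c (S k))). now apply geo_shift.
Qed.

Lemma Series_uprev (c : nat -> R) (x : R) : geo c ->
  Series (fun k => c k * uprev k x) = Vs (fun k => c (S k)) x.
Proof.
  intros G. rewrite Series_incr_1 by now apply ex_series_uprev. simpl. rewrite Rmult_0_r, Rplus_0_l. reflexivity.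
Qed.

Lemma is_derive_Vs (c : nat -> R) (x : R) : geo c -> is_derive (Vs c) x (Fs c x + de * Vs c x).
Proof.
  intros G. assert (Gc := G). destruct Gc as (M & rho & HM & Hr & Hc).
  destruct (up_bound (Rabs (x - x0) + 1) ltac:(pose proof (Rabs_pos (x - x0)); lra)) as (A & B & HA & HB & H).
  eapply is_derive_eqr.
  - apply (is_derive_series (fun k y => c k * uu k y) (fun k y => c k * (ff k y + de * uu k y))
      (fun k => M * (A + Rabs de * A) * (rho * B) ^ k / INR (fact k)) x (mkposreal 1 Rlt_0_1)); simpl.
    + intros k y _. apply (is_derive_scal (uu k)). apply is_derive_uu.
    + intros k y Hy. destruct (H k y) as [H1 H2].
      { replace (y - x0) with ((y - x) + (x - x0)) by ring. eapply Rle_trans; [apply Rabs_triang|]. lra. }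
      apply geo_mult_bound; trivial.
      eapply Rle_trans; [apply Rabs_triang|]. rewrite Rabs_mult. pose proof (Rabs_pos de).
      unfold Rdiv in *. rewrite Rmult_assoc, Rmult_plus_distr_r. rewrite !Rmult_assoc in *. apply Rplus_le_compat; [exact H2|].
      now apply Rmult_le_compat_l.
    + apply ex_series_exp.
    + intros y _. now apply ex_series_uu.
  - unfold Fs, Vs. rewrite <- Series_scal_l, <- Series_plus.
    + apply Series_ext. intros k. ring.
    + now apply ex_series_ff.
    + apply (ex_series_scal_R de). now apply ex_series_uu.
Qed.

(** In the recursion for the coefficients the index drops by one, which after summation shifts the
    weights. For [c k = lam ^ k] the shift is multiplication by [lam], and the equation becomes the
    spectral one. *)
Lemma is_derive_Fs (c : nat -> R) (x : R) : geo c ->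
  is_derive (Fs c) x ((nu ^ 2 - de ^ 2) * Vs c x - de * Fs c x - exp (2 * x) * Vs (fun k => c (S k)) x).
Proof.
  intros G. assert (Gc := G). destruct Gc as (M & rho & HM & Hr & Hc).
  assert (HL : 0 < Rabs (x - x0) + 1) by (pose proof (Rabs_pos (x - x0)); lra).
  destruct (up_bound _ HL) as (A & B & HA & HB & H).
  set (Eb := exp (2 * (Rabs x + 1))).
  assert (Ep : 0 < Eb) by apply exp_pos.
  pose proof (Rabs_pos (nu ^ 2 - de ^ 2)) as Pn. pose proof (Rabs_pos de) as Pd.
  eapply is_derive_eqr.
  - apply (is_derive_series (fun k y => c k * ff k y)
      (fun k y => c k * ((nu ^ 2 - de ^ 2) * uu k y - de * ff k y - exp (2 * y) * uprev k y))
      (fun k => (Rabs (nu ^ 2 - de ^ 2) + Rabs de) * (M * A * (rho * B) ^ k / INR (fact k))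
         + Eb * (match k with O => 0 | S j => M * rho * A * (rho * B) ^ j / INR (fact j) end)) x (mkposreal 1 Rlt_0_1)); simpl pos.
    + intros k y _. apply (is_derive_scal (ff k)). apply is_derive_ff.
    + intros k y Hy.
      assert (Hy' : Rabs (y - x0) <= Rabs (x - x0) + 1).
      { replace (y - x0) with ((y - x) + (x - x0)) by ring. eapply Rle_trans; [apply Rabs_triang|]. lra. }
      destruct (H k y Hy') as [H1 H2].
      assert (T1 := geo_mult_bound c M rho A B _ k HM Hr (Hc k) H1).
      assert (T2 := geo_mult_bound c M rho A B _ k HM Hr (Hc k) H2).
      assert (T3 : Rabs (c k * uprev k y) <= match k with O => 0 | S j => M * rho * A * (rho * B) ^ j / INR (fact j) end).
      { destruct k as [|j]; simpl uprev; [rewrite Rmult_0_r, Rabs_R0; lra|].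
        apply (geo_mult_bound (fun j => c (S j)) (M * rho) rho A B (uu j y) j); trivial; [now apply Rmult_le_pos| |apply H; exact Hy'].
        eapply Rle_trans; [apply Hc|]. rewrite <- tech_pow_Rmult. lra. }
      replace (c k * ((nu ^ 2 - de ^ 2) * uu k y - de * ff k y - exp (2 * y) * uprev k y)) with
        ((nu ^ 2 - de ^ 2) * (c k * uu k y) + - de * (c k * ff k y) + - exp (2 * y) * (c k * uprev k y)) by ring.
      eapply Rle_trans; [apply Rabs_triang|]. apply Rplus_le_compat.
      * eapply Rle_trans; [apply Rabs_triang|]. rewrite (Rabs_mult (nu ^ 2 - de ^ 2)), (Rabs_mult (- de)), Rabs_Ropp, Rmult_plus_distr_r.
        apply Rplus_le_compat; apply Rmult_le_compat_l; assumption.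
      * rewrite Rabs_mult, Rabs_Ropp, (Rabs_pos_eq (exp _)) by (apply Rlt_le, exp_pos).
        apply Rmult_le_compat; [apply Rlt_le, exp_pos|apply Rabs_pos| |exact T3].
        apply exp_le. apply Rabs_def2 in Hy. pose proof (Rle_abs x). lra.
    + apply (ex_series_plus (V := R_NormedModule)).
      * apply ex_series_scal_R, ex_series_exp.
      * apply ex_series_scal_R. apply ex_series_incr_1. apply ex_series_exp.
    + intros y _. now apply ex_series_ff.
  - rewrite <- Series_uprev by assumption. unfold Fs, Vs.
    assert (E1 := ex_series_scal_R (nu ^ 2 - de ^ 2) _ (ex_series_uu c x G)).
    assert (E2 := ex_series_scal_R de _ (ex_series_ff c x G)).
    assert (E3 := ex_series_scal_R (exp (2 * x)) _ (ex_series_uprev c x G)).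
    assert (E4 := ex_series_minus _ _ E1 E2).
    rewrite <- !Series_scal_l, <- Series_minus, <- Series_minus by assumption.
    apply Series_ext. intros k. ring.
Qed.

Lemma Vs_x0 (c : nat -> R) : geo c -> Vs c x0 = c 0%nat.
Proof.
  intros G. unfold Vs. rewrite Series_incr_1 by now apply ex_series_uu.
  rewrite uu_x0, Rmult_1_r. rewrite (Series_ext _ (fun k => 0 * c (S k))).
  - rewrite Series_scal_l. ring.
  - intros k. rewrite uu_x0. ring.
Qed.

Lemma Fs_x0 (c : nat -> R) : Fs c x0 = 0.
Proof.
  unfold Fs. rewrite (Series_ext _ (fun k => 0 * c k)).
  - rewrite Series_scal_l. ring.
  - intros k. rewrite ff_x0. ring.
Qed.
End Family.

(** * Pruefer angles *)

(** Strict positivity is asked at the left end alone: in the uses below the derivative is a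
    nonnegative quadratic expression in a solution, known to be positive at [x0] from the initial
    values. *)
Lemma strict_incr_of_derive (f g : R -> R) (a b : R) : a < b ->
  (forall x, a <= x <= b -> is_derive f x (g x)) -> (forall x, a <= x <= b -> 0 <= g x) ->
  continuous g a -> 0 < g a -> f a < f b.
Proof.
  intros Hab D P C Ga.
  assert (Hg2 : 0 < g a / 2) by lra.
  destruct (proj1 (filterlim_locally _ _) C (mkposreal _ Hg2)) as [d Hd].
  set (c := Rmin b (a + d / 2)).
  assert (Hd0 : 0 < d) by apply cond_pos.
  assert (Hc : a < c <= b) by (unfold c; split; [apply Rmin_glb_lt; lra|apply Rmin_l]).
  apply Rlt_le_trans with (f c).
  - destruct (MVT_gen f a c g) as [z [Hz E]].
    + intros x Hx. rewrite Rmin_left, Rmax_right in Hx by lra. apply D. lra.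
    + intros x Hx. rewrite Rmin_left, Rmax_right in Hx by lra. apply is_derive_continuity_pt with (g x). apply D. lra.
    + rewrite Rmin_left, Rmax_right in Hz by lra.
      assert (Q : ball (g a) (g a / 2) (g z)).
      { apply Hd. change (Rabs (z - a) < d). pose proof (Rmin_r b (a + d / 2)). fold c in H. rewrite Rabs_pos_eq; lra. }
      apply ball_R in Q. apply Rabs_def2 in Q. nra.
  - apply incr_of_derive with g; [lra| |]; intros x Hx; [apply D|apply P]; lra.
Qed.

Lemma continuity_RInt_param (g : R -> R -> R) (a b l0 : R) : a <= b ->
  (forall s, a <= s <= b -> continuity_2d_pt g s l0) ->
  (forall l, ex_RInt (fun s => g s l) a b) ->
  continuity_pt (fun l => RInt (fun s => g s l) a b) l0.
Proof.
  intros Hab C Ex. apply continuity_pt_locally. intros eps.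
  assert (He : 0 < eps / (b - a + 1)) by (apply Rdiv_lt_0_compat; [apply cond_pos|lra]).
  destruct (uniform_continuity_2d_1d g a b l0 C (mkposreal _ He)) as [d Hd].
  exists d. intros l Hl. apply ball_R in Hl.
  rewrite <- (RInt_minus (V := R_CompleteNormedModule)) by apply Ex.
  apply Rle_lt_trans with ((b - a) * (eps / (b - a + 1))).
  - apply (norm_RInt_le_const (V := R_NormedModule) (fun s => minus (g s l) (g s l0)) a b); [exact Hab| |].
    + intros s Hs. apply Rlt_le. apply Rabs_def2 in Hl. pose proof (cond_pos d).
      apply (Hd s l0 s l Hs); try lra. rewrite Rminus_diag, Rabs_R0. apply cond_pos.
    + apply (RInt_correct (V := R_CompleteNormedModule)). apply (ex_RInt_minus (V := R_CompleteNormedModule)); apply Ex.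
  - pose proof (cond_pos eps). apply Rmult_lt_reg_r with (b - a + 1); [lra|].
    replace ((b - a) * (eps / (b - a + 1)) * (b - a + 1)) with ((b - a) * eps) by (field; lra). nra.
Qed.

Lemma sin_shift_nPI (n : nat) (t : R) : sin (INR n * PI + t) = (-1) ^ n * sin t.
Proof.
  induction n as [|n IH]; [simpl; rewrite Rmult_0_l, Rplus_0_l; ring|].
  rewrite S_INR. replace ((INR n + 1) * PI + t) with (INR n * PI + t + PI) by ring.
  rewrite neg_sin, IH. simpl. ring.
Qed.

Lemma cos_shift_nPI (n : nat) (t : R) : cos (INR n * PI + t) = (-1) ^ n * cos t.
Proof.
  induction n as [|n IH]; [simpl; rewrite Rmult_0_l, Rplus_0_l; ring|].
  rewrite S_INR. replace ((INR n + 1) * PI + t) with (INR n * PI + t + PI) by ring.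
  rewrite neg_cos, IH. simpl. ring.
Qed.

Lemma sin_zero_small (t : R) : Rabs t < PI -> sin t = 0 -> t = 0.
Proof.
  intros H E. apply Rabs_def2 in H. destruct (Rtotal_order t 0) as [L|[L|L]]; trivial.
  - pose proof (sin_gt_0 (- t) ltac:(lra) ltac:(lra)) as Q. rewrite sin_neg in Q. lra.
  - pose proof (sin_gt_0 t ltac:(lra) ltac:(lra)). lra.
Qed.

Lemma Rabs_atan_le (y : R) : Rabs (atan y) <= Rabs y.
Proof.
  pose proof (abs_diff_le_of_derive atan (fun t => / (1 + t ^ 2)) 0 y 1) as H.
  rewrite atan_0, !Rminus_0_r, Rmult_1_l in H. apply H.
  - intros t _. apply is_derive_Reals.
    apply derivable_pt_lim_atan.
  - intros t _. assert (Q : 1 <= 1 + t ^ 2) by nra.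
    rewrite Rabs_pos_eq by (apply Rlt_le, Rinv_0_lt_compat; lra).
    rewrite <- Rinv_1. apply Rinv_le_contravar; lra.
Qed.

(** The weights of [d/dlam]. At [k = 0] the factor [INR 0] cancels the default value
    [pred 0 = 0]. *)
Definition dpow (lam : R) (k : nat) : R := INR k * lam ^ pred k.

Lemma geo_pow (lam : R) : geo (fun k => lam ^ k).
Proof.
  exists 1, (Rabs lam). repeat split; [lra|apply Rabs_pos|]. intros k. rewrite RPow_abs. lra.
Qed.

Lemma geo_dpow (lam : R) : geo (dpow lam).
Proof.
  pose proof (Rabs_pos lam) as Pl.
  exists 1, (2 * (Rabs lam + 1)). repeat split; [lra|lra|]. intros k. unfold dpow.
  rewrite Rmult_1_l, Rabs_mult, Rpow_mult_distr, <- RPow_abs, (Rabs_pos_eq (INR k)) by apply pos_INR.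
  apply Rmult_le_compat; [apply pos_INR|apply pow_le; lra| |].
  - induction k as [|k IH]; [simpl; lra|]. rewrite S_INR. simpl.
    assert (1 <= 2 ^ k) by (apply pow_R1_Rle; lra). lra.
  - apply Rle_trans with ((Rabs lam + 1) ^ pred k); [apply pow_incr; lra|].
    apply Rle_pow; [lra|lia].
Qed.

Section Spectral.
Variables nu de x0 : R.
Notation V c x := (Vs nu de x0 c x).

Definition usol (lam x : R) : R := Vs nu de x0 (fun k => lam ^ k) x.
Definition fsol (lam x : R) : R := Fs nu de x0 (fun k => lam ^ k) x.

Lemma V_lin (c d : nat -> R) (a b x : R) : geo c -> geo d ->
  V (fun k => a * c k + b * d k) x = a * V c x + b * V d x.
Proof.
  intros Hc Hd. unfold Vs. rewrite <- !Series_scal_l, <- Series_plus.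
  - apply Series_ext. intros k. ring.
  - apply ex_series_scal_R. now apply ex_series_uu.
  - apply ex_series_scal_R. now apply ex_series_uu.
Qed.

Lemma V_ext (c d : nat -> R) (x : R) : (forall k, c k = d k) -> V c x = V d x.
Proof. intros H. apply Series_ext. intros k. now rewrite H. Qed.

Lemma is_derive_usol (lam x : R) : is_derive (usol lam) x (fsol lam x + de * usol lam x).
Proof. apply is_derive_Vs, geo_pow. Qed.

Lemma is_derive_fsol (lam x : R) :
  is_derive (fsol lam) x ((nu ^ 2 - de ^ 2 - lam * exp (2 * x)) * usol lam x - de * fsol lam x).
Proof.
  eapply is_derive_eqr; [apply is_derive_Fs, geo_pow|].
  rewrite (V_ext (fun k => lam ^ S k) (fun k => lam * lam ^ k + 0 * lam ^ k)) by (intros; simpl; ring).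
  rewrite (V_lin (fun k => lam ^ k) (fun k => lam ^ k) lam 0 x) by apply geo_pow. unfold usol, fsol. ring.
Qed.

Lemma usol_x0 (lam : R) : usol lam x0 = 1.
Proof. unfold usol. rewrite Vs_x0 by apply geo_pow. reflexivity. Qed.

Lemma fsol_x0 (lam : R) : fsol lam x0 = 0.
Proof. apply Fs_x0. Qed.

Lemma dusol_continuous (lam x : R) : continuous (fun s => fsol lam s + de * usol lam s) x.
Proof.
  pose proof (is_derive_usol lam x) as D1. pose proof (is_derive_fsol lam x) as D2.
  apply (ex_derive_continuous (fun s => fsol lam s + de * usol lam s)).
  auto_derive. repeat split; eexists; eassumption.
Qed.

Lemma dfsol_continuous (lam x : R) :
  continuous (fun s => (nu ^ 2 - de ^ 2 - lam * exp (2 * s)) * usol lam s - de * fsol lam s) x.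
Proof.
  pose proof (is_derive_usol lam x) as D1. pose proof (is_derive_fsol lam x) as D2.
  apply (ex_derive_continuous (fun s => (nu ^ 2 - de ^ 2 - lam * exp (2 * s)) * usol lam s - de * fsol lam s)).
  auto_derive. repeat split; eexists; eassumption.
Qed.

Lemma is_derive_energy (lam K x : R) :
  is_derive (fun y => (usol lam y ^ 2 + fsol lam y ^ 2) * exp (K * (y - x0))) x
   ((2 * usol lam x * (fsol lam x + de * usol lam x) + 2 * fsol lam x * ((nu ^ 2 - de ^ 2 - lam * exp (2 * x)) * usol lam x - de * fsol lam x)
     + K * (usol lam x ^ 2 + fsol lam x ^ 2)) * exp (K * (x - x0))).
Proof.
  pose proof (is_derive_usol lam x) as D1. pose proof (is_derive_fsol lam x) as D2.
  auto_derive; [repeat split; eexists; eassumption|].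
  known_derive.
  unfold Rminus. ring.
Qed.

Lemma energy_derivative_bound (u v c d : R) :
  Rabs (2 * u * (v + d * u) + 2 * v * (c * u - d * v)) <= (1 + Rabs c + 2 * Rabs d) * (u ^ 2 + v ^ 2).
Proof.
  replace (2 * u * (v + d * u) + 2 * v * (c * u - d * v)) with ((1 + c) * (2 * u * v) + 2 * d * (u ^ 2 - v ^ 2)) by ring.
  eapply Rle_trans; [apply Rabs_triang|]. rewrite !Rabs_mult, (Rabs_pos_eq 2) by lra.
  assert (A1 : 2 * Rabs u * Rabs v <= u ^ 2 + v ^ 2).
  { rewrite <- (pow2_abs u), <- (pow2_abs v). pose proof (pow2_ge_0 (Rabs u - Rabs v)). lra. }
  assert (A2 : Rabs (u ^ 2 - v ^ 2) <= u ^ 2 + v ^ 2) by (apply Rabs_le; nra).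
  assert (A3 : Rabs (1 + c) <= 1 + Rabs c) by (eapply Rle_trans; [apply Rabs_triang|rewrite Rabs_R1; lra]).
  pose proof (Rabs_pos (1 + c)). pose proof (Rabs_pos d). pose proof (Rabs_pos u). pose proof (Rabs_pos v).
  assert (0 <= u ^ 2 + v ^ 2) by nra. pose proof (Rabs_pos (u ^ 2 - v ^ 2)).
  assert (B1 : Rabs (1 + c) * (2 * Rabs u * Rabs v) <= (1 + Rabs c) * (u ^ 2 + v ^ 2))
    by (apply Rmult_le_compat; trivial; nra).
  assert (B2 : 2 * Rabs d * Rabs (u ^ 2 - v ^ 2) <= 2 * Rabs d * (u ^ 2 + v ^ 2)) by (apply Rmult_le_compat_l; lra).
  lra.
Qed.

(** Gronwall: [E = u^2 + f^2] satisfies [|E'| <= K E], so to the right of [x0] the product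
    [E exp (K (x - x0))] increases from 1, and similarly to the left. Hence [(u, f)] never vanishes
    and has an angle on the whole line. *)
Lemma energy_pos (lam x : R) : 0 < usol lam x ^ 2 + fsol lam x ^ 2.
Proof.
  set (L := Rabs (x - x0)).
  set (K := 1 + (Rabs (nu ^ 2 - de ^ 2) + Rabs lam * exp (2 * (Rabs x0 + L))) + 2 * Rabs de).
  assert (Bd : forall y, Rabs (y - x0) <= L ->
    Rabs (2 * usol lam y * (fsol lam y + de * usol lam y) + 2 * fsol lam y * ((nu ^ 2 - de ^ 2 - lam * exp (2 * y)) * usol lam y - de * fsol lam y))
    <= K * (usol lam y ^ 2 + fsol lam y ^ 2)).
  { intros y Hy. eapply Rle_trans; [apply energy_derivative_bound|].
    apply Rmult_le_compat_r; [nra|]. unfold K.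
    assert (Rabs (nu ^ 2 - de ^ 2 - lam * exp (2 * y)) <= Rabs (nu ^ 2 - de ^ 2) + Rabs lam * exp (2 * (Rabs x0 + L))); [|lra].
    eapply Rle_trans; [apply Rabs_triang|]. apply Rplus_le_compat_l.
    rewrite Rabs_Ropp, Rabs_mult, (Rabs_pos_eq (exp _)) by (apply Rlt_le, exp_pos).
    apply Rmult_le_compat_l; [apply Rabs_pos|]. apply exp_le.
    pose proof (Rle_abs (y - x0)). pose proof (Rle_abs x0). lra. }
  assert (I0 : (usol lam x0 ^ 2 + fsol lam x0 ^ 2) = 1) by (rewrite usol_x0, fsol_x0; ring).
  destruct (Rle_dec x0 x) as [H|H].
  - pose proof (incr_of_derive _ _ x0 x H (fun y _ => is_derive_energy lam K y)) as Q. cbv beta in Q.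
    rewrite I0, Rminus_diag, Rmult_0_r, exp_0 in Q.
    assert (Q' : 1 * 1 <= (usol lam x ^ 2 + fsol lam x ^ 2) * exp (K * (x - x0))).
    { apply Q. intros y Hy. specialize (Bd y). unfold L in Bd. rewrite !Rabs_pos_eq with (x := _ - x0) in Bd by lra.
      specialize (Bd ltac:(lra)). apply Rabs_le_between in Bd.
      apply Rmult_le_pos; [lra|apply Rlt_le, exp_pos]. }
    pose proof (exp_pos (K * (x - x0))). nra.
  - assert (H' : x <= x0) by lra.
    pose proof (incr_of_derive (fun y => - ((usol lam y ^ 2 + fsol lam y ^ 2) * exp (- K * (y - x0)))) _ x x0 H'
      (fun y _ => is_derive_opp _ _ _ (is_derive_energy lam (- K) y))) as Q. cbv beta in Q.
    rewrite I0, Rminus_diag, Rmult_0_r, exp_0 in Q.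
    assert (Q' : - ((usol lam x ^ 2 + fsol lam x ^ 2) * exp (- K * (x - x0))) <= - (1 * 1)).
    { apply Q. intros y Hy. specialize (Bd y). unfold L in Bd. rewrite (Rabs_left1 (y - x0)), (Rabs_left1 (x - x0)) in Bd by lra.
      specialize (Bd ltac:(lra)). apply Rabs_le_between in Bd.
      change (opp ?z) with (- z). pose proof (exp_pos (- K * (y - x0))).
      rewrite Ropp_mult_distr_l. apply Rmult_le_pos; lra. }
    pose proof (exp_pos (- K * (x - x0))). nra.
Qed.

Definition theta (lam x : R) : R :=
  angle (usol lam) (fsol lam) (fun s => fsol lam s + de * usol lam s)
    (fun s => (nu ^ 2 - de ^ 2 - lam * exp (2 * s)) * usol lam s - de * fsol lam s) x0 0 x.

Lemma theta_polar (lam x : R) :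
  usol lam x = sqrt (usol lam x ^ 2 + fsol lam x ^ 2) * cos (theta lam x) /\
  fsol lam x = - sqrt (usol lam x ^ 2 + fsol lam x ^ 2) * sin (theta lam x).
Proof.
  apply angle_polar.
  - apply is_derive_usol.
  - apply is_derive_fsol.
  - apply dusol_continuous.
  - apply dfsol_continuous.
  - apply energy_pos.
  - rewrite usol_x0, fsol_x0, cos_0. replace (1 ^ 2 + 0 ^ 2) with 1 by ring. rewrite sqrt_1. ring.
  - rewrite fsol_x0, sin_0. ring.
Qed.

Lemma theta_continuity (lam x : R) : continuity_pt (theta lam) x.
Proof.
  eapply is_derive_continuity_pt. apply is_derive_angle.
  - apply is_derive_usol.
  - apply is_derive_fsol.
  - apply dusol_continuous.
  - apply dfsol_continuous.
  - apply energy_pos.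
Qed.

Lemma theta_x0 (lam : R) : theta lam x0 = 0.
Proof. unfold theta, angle. rewrite RInt_point. apply Rplus_0_l. Qed.

(** Dominated convergence along the neighbourhood filter of the plane, with a majorant uniform on
    the unit box around the point. *)
Lemma continuity_2d_series (w : nat -> R -> R) (s0 l0 : R) :
  (forall k s, continuous (w k) s) ->
  (forall L, 0 < L -> exists A B, 0 <= A /\ 0 <= B /\ forall k s, Rabs (s - x0) <= L -> Rabs (w k s) <= A * B ^ k / INR (fact k)) ->
  continuity_2d_pt (fun s l => Series (fun k => l ^ k * w k s)) s0 l0.
Proof.
  intros Cw Bw. apply continuity_2d_pt_filterlim. simpl.
  destruct (Bw (Rabs (s0 - x0) + 1)) as (A & B & HA & HB & H); [pose proof (Rabs_pos (s0 - x0)); lra|].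
  pose proof (Rabs_pos l0) as Pl.
  assert (Hb : forall s l, Rabs (s - s0) < 1 -> Rabs (l - l0) < 1 -> forall k,
     Rabs (l ^ k * w k s) <= 1 * A * ((Rabs l0 + 1) * B) ^ k / INR (fact k)).
  { intros s l Hs Hl k. apply (geo_mult_bound (fun k => l ^ k)); [lra|lra| |].
    - rewrite <- RPow_abs, Rmult_1_l. apply pow_incr. split; [apply Rabs_pos|].
      replace l with ((l - l0) + l0) by ring. eapply Rle_trans; [apply Rabs_triang|]. lra.
    - apply H. replace (s - x0) with ((s - s0) + (s0 - x0)) by ring. eapply Rle_trans; [apply Rabs_triang|]. lra. }
  assert (Hb0 := Hb s0 l0). rewrite !Rminus_diag, Rabs_R0 in Hb0. specialize (Hb0 Rlt_0_1 Rlt_0_1).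
  apply (tannery (locally (s0, l0)) (fun z k => snd z ^ k * w k (fst z)) _ (fun k => l0 ^ k * w k s0) _
    (fun k => 1 * A * ((Rabs l0 + 1) * B) ^ k / INR (fact k))).
  - apply ex_series_exp.
  - exists (mkposreal 1 Rlt_0_1). intros [s l] [Hs Hl] k. apply (Hb s l); assumption.
  - exact Hb0.
  - intros k. apply (continuous_mult (K := R_AbsRing) (U := prod_UniformSpace R_UniformSpace R_UniformSpace)
      (fun z : R * R => snd z ^ k) (fun z : R * R => w k (fst z)) (s0, l0)).
    + apply (continuous_comp (U := prod_UniformSpace R_UniformSpace R_UniformSpace) (fun z : R * R => snd z) (fun l => l ^ k)).
      * apply continuous_snd.
      * apply (ex_derive_continuous (fun l : R => l ^ k)). now auto_derive.
    + apply (continuous_comp (U := prod_UniformSpace R_UniformSpace R_UniformSpace) (fun z : R * R => fst z) (w k)).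
      * apply continuous_fst.
      * apply Cw.
  - exists (mkposreal 1 Rlt_0_1). intros [s l] [Hs Hl]. apply Series_correct.
    apply ex_series_le_R with (fun k => 1 * A * ((Rabs l0 + 1) * B) ^ k / INR (fact k)); [|apply ex_series_exp].
    apply (Hb s l); assumption.
  - apply Series_correct.
    apply ex_series_le_R with (fun k => 1 * A * ((Rabs l0 + 1) * B) ^ k / INR (fact k)); [exact Hb0|apply ex_series_exp].
Qed.

Lemma usol_continuity_2d (s0 l0 : R) : continuity_2d_pt (fun s l => usol l s) s0 l0.
Proof.
  apply (continuity_2d_series (uu nu de x0)); [apply uu_continuous|].
  intros L HL. destruct (up_bound nu de x0 L HL) as (A & B & HA & HB & H). exists A, B.
  repeat split; trivial. intros k s Hs. now apply H.
Qed.

Lemma fsol_continuity_2d (s0 l0 : R) : continuity_2d_pt (fun s l => fsol l s) s0 l0.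
Proof.
  apply (continuity_2d_series (ff nu de x0)); [apply ff_continuous|].
  intros L HL. destruct (up_bound nu de x0 L HL) as (A & B & HA & HB & H). exists A, B.
  repeat split; trivial. intros k s Hs. now apply H.
Qed.

(** The integrand is jointly continuous because [u] and [f] are and [u^2 + f^2] has no zero.
    Continuity is what is needed to identify [theta] with the angle [psi] below. *)
Lemma theta_continuity_lam (X l0 : R) : x0 <= X -> continuity_pt (fun lam => theta lam X) l0.
Proof.
  intros HX. unfold theta, angle.
  apply continuity_pt_plus; [apply continuity_pt_const; now intros ? ?|].
  apply (continuity_RInt_param (fun s l => (fsol l s * (fsol l s + de * usol l s) - usol l s * ((nu ^ 2 - de ^ 2 - l * exp (2 * s)) * usol l s - de * fsol l s))
     / (usol l s ^ 2 + fsol l s ^ 2))); [exact HX| |].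
  - intros s _. pose proof (usol_continuity_2d s l0) as CU. pose proof (fsol_continuity_2d s l0) as Cf.
    apply (continuity_2d_pt_mult (fun s l => fsol l s * (fsol l s + de * usol l s) - usol l s * ((nu ^ 2 - de ^ 2 - l * exp (2 * s)) * usol l s - de * fsol l s))
      (fun s l => / (usol l s ^ 2 + fsol l s ^ 2))).
    + apply (continuity_2d_pt_minus (fun s l => fsol l s * (fsol l s + de * usol l s)) (fun s l => usol l s * ((nu ^ 2 - de ^ 2 - l * exp (2 * s)) * usol l s - de * fsol l s))).
      * apply continuity_2d_pt_mult; [exact Cf|]. apply continuity_2d_pt_plus; [exact Cf|].
        apply (continuity_2d_pt_mult (fun _ _ => de)); [apply continuity_2d_pt_const|exact CU].
      * apply continuity_2d_pt_mult; [exact CU|].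
        apply (continuity_2d_pt_minus (fun s l => (nu ^ 2 - de ^ 2 - l * exp (2 * s)) * usol l s) (fun s l => de * fsol l s)).
        -- apply continuity_2d_pt_mult; [|exact CU].
           apply (continuity_2d_pt_minus (fun _ _ => nu ^ 2 - de ^ 2) (fun s l => l * exp (2 * s))); [apply continuity_2d_pt_const|].
           apply (continuity_2d_pt_mult (fun _ l => l) (fun s _ => exp (2 * s))); [apply continuity_2d_pt_id2|].
           apply (continuity_1d_2d_pt_comp (fun s => exp (2 * s)) (fun s _ => s)); [|apply continuity_2d_pt_id1].
           apply continuity_pt_filterlim. apply (ex_derive_continuous (fun s => exp (2 * s))). now auto_derive.
        -- apply (continuity_2d_pt_mult (fun _ _ => de)); [apply continuity_2d_pt_const|exact Cf].
    + apply (continuity_2d_pt_inv (fun s l => usol l s ^ 2 + fsol l s ^ 2)).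
      * apply continuity_2d_pt_plus.
        -- apply continuity_2d_pt_ext with (fun s l => usol l s * usol l s); [intros; ring|]. now apply continuity_2d_pt_mult.
        -- apply continuity_2d_pt_ext with (fun s l => fsol l s * fsol l s); [intros; ring|]. now apply continuity_2d_pt_mult.
      * apply Rgt_not_eq, energy_pos.
  - intros l. apply (ex_RInt_continuous (V := R_CompleteNormedModule)). intros s _.
    apply (angle_integrand_continuous (usol l) (fsol l) (fun s => fsol l s + de * usol l s)
     (fun s => (nu ^ 2 - de ^ 2 - l * exp (2 * s)) * usol l s - de * fsol l s)).
    + apply is_derive_usol.
    + apply is_derive_fsol.
    + apply dusol_continuous.
    + apply dfsol_continuous.
    + apply energy_pos.
Qed.
End Spectral.

(** * Counting the eigenvalues *)

Section Count.
Variables nu de x0 : R.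
Notation V c x := (Vs nu de x0 c x).
Notation F c x := (Fs nu de x0 c x).
Notation U := (usol nu de x0).
Notation f := (fsol nu de x0).
Notation theta := (theta nu de x0).

(** On weights, [(k + 1) lam ^ k] is [lam] times [k lam ^ (k - 1)] plus [lam ^ k]: the equation
    differentiated in [lam] acquires [u] as source term, which the Lagrange identity integrates. *)
Lemma dpow_shift_V (lam x : R) : V (fun k => dpow lam (S k)) x = lam * V (dpow lam) x + U lam x.
Proof.
  rewrite (V_ext _ _ _ _ (fun k => lam * dpow lam k + 1 * lam ^ k)).
  - rewrite (V_lin nu de x0 (dpow lam) (fun k => lam ^ k) lam 1 x) by (apply geo_dpow || apply geo_pow).
    unfold usol. ring.
  - intros k. unfold dpow. rewrite S_INR. destruct k as [|k]; simpl; [ring|].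
    change (match k with 0%nat => 1 | S _ => INR k + 1 end) with (INR (S k)). ring.
Qed.

(** Lagrange identity for [u] and [du/dlam]: the source of both the simplicity of the eigenvalues
    and the monotonicity of the angle in [lam]. *)
Lemma lagrange_neg (lam X : R) : x0 < X -> U lam X * F (dpow lam) X - f lam X * V (dpow lam) X < 0.
Proof.
  intros HX.
  pose (W := fun y => - (U lam y * F (dpow lam) y - f lam y * V (dpow lam) y)).
  assert (D : forall y, is_derive W y (exp (2 * y) * U lam y ^ 2)).
  { intros y.
    pose proof (is_derive_usol nu de x0 lam y) as D1. pose proof (is_derive_fsol nu de x0 lam y) as D2.
    pose proof (is_derive_Vs nu de x0 _ y (geo_dpow lam)) as D3.
    pose proof (is_derive_Fs nu de x0 _ y (geo_dpow lam)) as D4.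
    rewrite dpow_shift_V in D4.
    set (vv := Vs nu de x0 (dpow lam)) in *. set (gg := Fs nu de x0 (dpow lam)) in *.
    unfold W. auto_derive; [repeat split; eexists; eassumption|].
    known_derive.
    ring. }
  assert (S : W x0 < W X).
  { apply strict_incr_of_derive with (fun y => exp (2 * y) * U lam y ^ 2); [exact HX|intros; apply D| | |].
    - intros y _. apply Rmult_le_pos; [apply Rlt_le, exp_pos|apply pow2_ge_0].
    - pose proof (is_derive_usol nu de x0 lam x0) as D1.
      apply (ex_derive_continuous (fun y => exp (2 * y) * U lam y ^ 2)).
      auto_derive. eexists; exact D1.
    - rewrite usol_x0. pose proof (exp_pos (2 * x0)). lra. }
  unfold W in S. rewrite usol_x0, fsol_x0, Fs_x0 in S. lra.
Qed.

Lemma is_derive_lam (w : nat -> R) (lam : R) : exp_bounded w ->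
  is_derive (fun l => Series (fun k => l ^ k * w k)) lam (Series (fun k => dpow lam k * w k)) /\
  continuous (fun l => Series (fun k => dpow l k * w k)) lam.
Proof.
  intros Hw.
  assert (E : forall l, Series (fun k => dpow l k * w k) = PSeries (PS_derive w) l).
  { intros l. rewrite Series_incr_1.
    - unfold dpow at 1. simpl. rewrite !Rmult_0_l, Rplus_0_l.
      apply Series_ext. intros k. unfold PS_derive, dpow. simpl pred. ring.
    - apply ex_series_incr_1.
      apply ex_series_ext_R with (fun k => PS_derive w k * l ^ k).
      + intros k. unfold PS_derive, dpow. simpl pred. ring.
      + apply ex_pseries_R. apply CV_radius_inside. rewrite CV_radius_derive. now apply exp_bounded_radius. }
  split.
  - rewrite E. apply is_derive_ext with (PSeries w); [|now apply is_derive_PSeries, exp_bounded_radius].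
    intros l. unfold PSeries. apply Series_ext. intros k. ring.
  - apply (continuous_ext (PSeries (PS_derive w))); [intros; symmetry; apply E|].
    apply (ex_derive_continuous (PSeries (PS_derive w))). eexists. apply is_derive_PSeries.
    rewrite CV_radius_derive. now apply exp_bounded_radius.
Qed.

Lemma exp_bounded_uu (x : R) : exp_bounded (fun k => uu nu de x0 k x).
Proof.
  destruct (up_bound nu de x0 (Rabs (x - x0) + 1)) as (A & B & HA & HB & H); [pose proof (Rabs_pos (x - x0)); lra|].
  exists A, B. repeat split; trivial. intros k. apply H. lra.
Qed.

Lemma exp_bounded_ff (x : R) : exp_bounded (fun k => ff nu de x0 k x).
Proof.
  destruct (up_bound nu de x0 (Rabs (x - x0) + 1)) as (A & B & HA & HB & H); [pose proof (Rabs_pos (x - x0)); lra|].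
  exists A, B. repeat split; trivial. intros k. apply H. lra.
Qed.

(** The angle of the same vector [(u, f)] at [X], transported in [lam] from the value [theta l0 X].
    Its derivative has the sign given by [lagrange_neg], whereas [theta] is an integral over [x]
    whose monotonicity in [lam] is not visible. *)
Definition psi (X l0 l : R) : R :=
  angle (fun l => U l X) (fun l => f l X) (fun l => V (dpow l) X) (fun l => F (dpow l) X) l0 (theta l0 X) l.

Lemma psi_polar (X l0 l : R) :
  U l X = sqrt (U l X ^ 2 + f l X ^ 2) * cos (psi X l0 l) /\
  f l X = - sqrt (U l X ^ 2 + f l X ^ 2) * sin (psi X l0 l).
Proof.
  apply (angle_polar (fun l => U l X) (fun l => f l X) (fun l => V (dpow l) X) (fun l => F (dpow l) X)).
  - intros y. exact (proj1 (is_derive_lam _ y (exp_bounded_uu X))).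
  - intros y. exact (proj1 (is_derive_lam _ y (exp_bounded_ff X))).
  - intros y. exact (proj2 (is_derive_lam _ y (exp_bounded_uu X))).
  - intros y. exact (proj2 (is_derive_lam _ y (exp_bounded_ff X))).
  - intros y. apply energy_pos.
  - apply theta_polar.
  - apply theta_polar.
Qed.

Lemma is_derive_psi (X l0 l : R) :
  is_derive (psi X l0) l ((f l X * V (dpow l) X - U l X * F (dpow l) X) / (U l X ^ 2 + f l X ^ 2)).
Proof.
  apply (is_derive_angle (fun l => U l X) (fun l => f l X) (fun l => V (dpow l) X) (fun l => F (dpow l) X)).
  - intros y. exact (proj1 (is_derive_lam _ y (exp_bounded_uu X))).
  - intros y. exact (proj1 (is_derive_lam _ y (exp_bounded_ff X))).
  - intros y. exact (proj2 (is_derive_lam _ y (exp_bounded_uu X))).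
  - intros y. exact (proj2 (is_derive_lam _ y (exp_bounded_ff X))).
  - intros y. apply energy_pos.
Qed.

Lemma psi_l0 (X l0 : R) : psi X l0 l0 = theta l0 X.
Proof. unfold psi, angle. rewrite RInt_point. apply Rplus_0_r. Qed.

Lemma psi_increasing (X l0 a b : R) : x0 < X -> a < b -> psi X l0 a < psi X l0 b.
Proof.
  intros HX Hab.
  destruct (MVT_gen (psi X l0) a b (fun l => (f l X * V (dpow l) X - U l X * F (dpow l) X) / (U l X ^ 2 + f l X ^ 2))) as [z [Hz E]].
  - intros x _. apply is_derive_psi.
  - intros x _. eapply is_derive_continuity_pt, is_derive_psi.
  - assert (P : 0 < (f z X * V (dpow z) X - U z X * F (dpow z) X) / (U z X ^ 2 + f z X ^ 2)).
    { apply Rdiv_lt_0_compat; [|apply energy_pos]. pose proof (lagrange_neg z X HX). lra. }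
    nra.
Qed.

Lemma polar_unique (rho a b : R) : 0 < rho -> rho * cos a = rho * cos b -> - rho * sin a = - rho * sin b ->
  cos (a - b) = 1 /\ sin (a - b) = 0.
Proof.
  intros P H1 H2.
  assert (C : cos a = cos b) by (apply Rmult_eq_reg_l with rho; lra).
  assert (S : sin a = sin b) by (apply Rmult_eq_reg_l with (- rho); lra).
  rewrite cos_minus, sin_minus, C, S. pose proof (sin2_cos2 b) as Q. unfold Rsqr in Q. lra.
Qed.

(** The angle transported along [x] at fixed [lam] agrees with the one transported along [lam] at fixed [x]. *)
Lemma psi_theta (X l0 l1 : R) : x0 < X -> l0 <= l1 -> psi X l0 l1 = theta l1 X.
Proof.
  intros HX Hl.
  assert (Q : forall l, cos (psi X l0 l - theta l X) = 1 /\ sin (psi X l0 l - theta l X) = 0).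
  { intros l. destruct (psi_polar X l0 l) as [A1 A2]. destruct (theta_polar nu de x0 l X) as [B1 B2].
    apply (polar_unique (sqrt (U l X ^ 2 + f l X ^ 2))); [apply sqrt_lt_R0, energy_pos| |].
    - rewrite <- A1, <- B1. reflexivity.
    - rewrite <- A2, <- B2. reflexivity. }
  apply Rminus_diag_uniq. apply sin_zero_small; [|apply Q].
  (* Both angles belong to the same vector, so their difference is a multiple of [2 PI]; being
     continuous and 0 at [l0], it cannot reach [PI]. *)
  apply (angle_trapped (fun l => psi X l0 l - theta l X) l0 l1 Hl).
  - intros l _. apply continuity_pt_minus.
    + eapply is_derive_continuity_pt, is_derive_psi.
    + apply theta_continuity_lam. lra.
  - rewrite psi_l0, Rminus_diag, Rabs_R0. apply PI_RGT_0.
  - intros l _ E. destruct (Q l) as [C _].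
    unfold Rabs in E. destruct (Rcase_abs (psi X l0 l - theta l X)) as [L|L].
    + replace (psi X l0 l - theta l X) with (- PI) in C by lra. rewrite cos_neg, cos_PI in C. lra.
    + rewrite E, cos_PI in C. lra.
Qed.

(** The hypothesis makes [C = nu^2 - de^2 - lam exp (2 x)] positive, and [(u f)' = f^2 + C u^2].
    Hence [u f >= 0], so the square of [p = exp (- de (x - x0)) u] does not fall below its initial
    value 1. Thus [u] has no zero, the angle stays within [PI / 2] of 0, and [u f > 0] at [X] makes
    it negative. *)
Lemma theta_low (w X : R) : x0 < X -> de ^ 2 < w ^ 2 * exp (2 * x0) ->
  - PI < theta (- w ^ 2) X < 0.
Proof.
  intros HX Hw. set (lam := - w ^ 2).
  pose (p := fun y => exp (- de * (y - x0)) * U lam y).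
  pose (q := fun y => exp (de * (y - x0)) * f lam y).
  pose (C := fun y => nu ^ 2 - de ^ 2 - lam * exp (2 * y)).
  assert (Cpos : forall y, x0 <= y -> 0 < C y).
  { intros y Hy. unfold C, lam. assert (exp (2 * x0) <= exp (2 * y)) by (apply exp_le; lra).
    assert (w ^ 2 * exp (2 * x0) <= w ^ 2 * exp (2 * y)) by (apply Rmult_le_compat_l; [apply pow2_ge_0|assumption]).
    pose proof (pow2_ge_0 nu). lra. }
  assert (ee : forall y, exp (- de * (y - x0)) * exp (de * (y - x0)) = 1)
    by (intros; rewrite <- exp_plus; replace (- de * (y - x0) + de * (y - x0)) with 0 by ring; apply exp_0).
  assert (Dp : forall y, is_derive p y (exp (- de * (y - x0)) * f lam y)).
  { intros y. pose proof (is_derive_usol nu de x0 lam y) as D1. unfold p. auto_derive; [eexists; exact D1|].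
    known_derive.
    unfold Rminus. ring. }
  assert (Dq : forall y, is_derive q y (exp (de * (y - x0)) * (C y * U lam y))).
  { intros y. pose proof (is_derive_fsol nu de x0 lam y) as D1. unfold q. auto_derive; [eexists; exact D1|].
    replace (Derive (fun x => f lam x) y) with (C y * U lam y - de * f lam y) by (symmetry; now apply is_derive_unique).
    unfold Rminus. ring. }
  assert (Epq : forall y, p y * q y = U lam y * f lam y).
  { intros y. unfold p, q. transitivity ((exp (- de * (y - x0)) * exp (de * (y - x0))) * (U lam y * f lam y)); [ring|].
    rewrite ee. ring. }
  assert (Dpq : forall y, is_derive (fun y => U lam y * f lam y) y (f lam y ^ 2 + C y * U lam y ^ 2)).
  { intros y. pose proof (is_derive_usol nu de x0 lam y) as D1. pose proof (is_derive_fsol nu de x0 lam y) as D2.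
    auto_derive; [repeat split; eexists; eassumption|].
    replace (Derive (fun x => U lam x) y) with (f lam y + de * U lam y) by (symmetry; now apply is_derive_unique).
    replace (Derive (fun x => f lam x) y) with (C y * U lam y - de * f lam y) by (symmetry; now apply is_derive_unique).
    ring. }
  assert (pq0 : forall y, x0 <= y -> 0 <= U lam y * f lam y).
  { intros y Hy. replace 0 with (U lam x0 * f lam x0) by (rewrite fsol_x0; ring).
    apply (incr_of_derive _ _ x0 y Hy (fun z _ => Dpq z)).
    intros z Hz. pose proof (Cpos z ltac:(lra)). pose proof (pow2_ge_0 (f lam z)). pose proof (pow2_ge_0 (U lam z)). nra. }
  assert (p1 : forall y, x0 <= y -> 1 <= p y ^ 2).
  { intros y Hy.
    assert (I : p x0 ^ 2 = 1) by (unfold p; rewrite usol_x0, Rminus_diag, Rmult_0_r, exp_0; ring).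
    rewrite <- I. apply (incr_of_derive (fun y => p y ^ 2) (fun y => 2 * p y * (exp (- de * (y - x0)) * f lam y)) x0 y Hy).
    - intros z _. pose proof (Dp z) as D. auto_derive; [eexists; exact D|].
      known_derive. ring.
    - intros z Hz. unfold p.
      replace (2 * (exp (- de * (z - x0)) * U lam z) * (exp (- de * (z - x0)) * f lam z))
        with (2 * (exp (- de * (z - x0)) * exp (- de * (z - x0))) * (U lam z * f lam z)) by ring.
      pose proof (pq0 z ltac:(lra)). pose proof (exp_pos (- de * (z - x0))).
      apply Rmult_le_pos; [nra|assumption]. }
  assert (Une : forall y, x0 <= y -> U lam y <> 0).
  { intros y Hy E. pose proof (p1 y Hy) as Q. unfold p in Q. rewrite E in Q. lra. }
  assert (cosne : forall y, x0 <= y <= X -> cos (theta lam y) <> 0).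
  { intros y Hy E. destruct (theta_polar nu de x0 lam y) as [A _]. rewrite E, Rmult_0_r in A. now apply (Une y). }
  (* [angle_trapped] has threshold [PI]; applied to the doubled angle it keeps [theta] within
     [PI / 2]. *)
  assert (T : Rabs (2 * theta lam X) < PI).
  { apply (angle_trapped (fun y => 2 * theta lam y) x0 X).
    - lra.
    - intros y _. apply continuity_pt_mult; [apply continuity_pt_const; now intros ? ?|apply theta_continuity].
    - rewrite theta_x0, Rmult_0_r, Rabs_R0. apply PI_RGT_0.
    - intros y Hy E. apply (cosne y Hy). unfold Rabs in E. destruct (Rcase_abs (2 * theta lam y)) as [L|L].
      + replace (theta lam y) with (- (PI / 2)) by lra. rewrite cos_neg. apply cos_PI2.
      + replace (theta lam y) with (PI / 2) by lra. apply cos_PI2. }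
  apply Rabs_def2 in T. assert (PP := PI_RGT_0).
  split; [lra|].
  destruct (Rlt_dec (theta lam X) 0) as [L|L]; [exact L|exfalso].
  assert (S : 0 < U lam X * f lam X).
  { replace 0 with (U lam x0 * f lam x0) by (rewrite fsol_x0; ring).
    apply (strict_incr_of_derive _ _ x0 X HX (fun z _ => Dpq z)).
    - intros z Hz. pose proof (Cpos z ltac:(lra)). pose proof (pow2_ge_0 (f lam z)). pose proof (pow2_ge_0 (U lam z)). nra.
    - pose proof (is_derive_usol nu de x0 lam x0) as D1. pose proof (is_derive_fsol nu de x0 lam x0) as D2.
      unfold C. apply (ex_derive_continuous (fun y => f lam y ^ 2 + (nu ^ 2 - de ^ 2 - lam * exp (2 * y)) * U lam y ^ 2)).
      auto_derive. repeat split; eexists; eassumption.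
    - rewrite fsol_x0, usol_x0. pose proof (Cpos x0 ltac:(lra)). lra. }
  destruct (theta_polar nu de x0 lam X) as [A B].
  pose proof (sqrt_lt_R0 _ (energy_pos nu de x0 lam X)) as Rp.
  set (rho := sqrt (U lam X ^ 2 + f lam X ^ 2)) in *.
  rewrite A, B in S.
  assert (cos (theta lam X) > 0) by (apply cos_gt_0; lra).
  assert (0 <= sin (theta lam X)) by (apply sin_ge_0; lra).
  assert (0 <= rho * cos (theta lam X) * (rho * sin (theta lam X))) by (repeat apply Rmult_le_pos; lra).
  lra.
Qed.

(** For large [w] the angle [theta] turns very unevenly. Up to the factor [sqrt t], [(U, Z)] is the
    pair [(v, v' / w)] for [v = sqrt t u], whose angle [ph] advances by [w dt] with a small error.
    Hence [ph X] is near [(s + 1/2) PI]; since the vectors of [theta] and [ph] are never opposite,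
    the sign of [f] at [X] then places [theta] in the same interval. *)
Lemma theta_high (w X : R) (s : nat) : x0 < X -> 0 < w ->
  w * (exp X - exp x0) = (INR s + 1 / 2) * PI ->
  (nu ^ 2 + 1) * (X - x0) / (w * exp x0) + Rabs (de + 1 / 2) / (w * exp x0) <= 1 / 2 ->
  INR s * PI < theta (w ^ 2) X < (INR s + 1) * PI.
Proof.
  intros HX Hw Hs Hsmall. set (lam := w ^ 2). set (kap := de + 1 / 2) in *.
  assert (PP : 3 < PI) by (pose proof PI2_3_2; lra).
  (* [f + kap u = u' + u / 2], where the extra 1/2 is the logarithmic derivative of [sqrt t] in the
     variable [ln t]. *)
  pose (Z := fun y => (f lam y + kap * U lam y) / (w * exp y)).
  pose (dU := fun y => w * exp y * Z y - U lam y / 2).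
  pose (dZ := fun y => - (w * exp y) * U lam y + (nu ^ 2 - 1 / 4) / (w * exp y) * U lam y - Z y / 2).
  assert (wp : forall y, 0 < w * exp y) by (intros; apply Rmult_lt_0_compat; [exact Hw|apply exp_pos]).
  assert (EZ : forall y, w * exp y * Z y = f lam y + kap * U lam y)
    by (intros y; unfold Z; pose proof (exp_pos y); field; split; lra).
  assert (DU : forall y, is_derive (U lam) y (dU y)).
  { intros y. eapply is_derive_eqr; [apply is_derive_usol|]. unfold dU. rewrite EZ. unfold kap. lra. }
  assert (DZ : forall y, is_derive Z y (dZ y)).
  { intros y. pose proof (is_derive_usol nu de x0 lam y) as D1. pose proof (is_derive_fsol nu de x0 lam y) as D2.
    pose proof (wp y) as Wy. pose proof (exp_pos y) as Ey.
    unfold Z at 1. auto_derive; [repeat split; [eexists; exact D2|eexists; exact D1|lra]|].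
    known_derive.
    unfold dZ, Z, lam, kap. replace (exp (2 * y)) with (exp y * exp y) by (rewrite <- exp_plus; f_equal; ring).
    field. split; lra. }
  assert (CU : forall y : R, continuous dU y).
  { intros y. pose proof (DU y) as D1. pose proof (DZ y) as D2. unfold dU.
    apply (ex_derive_continuous (fun y => w * exp y * Z y - U lam y / 2)). auto_derive. repeat split; eexists; eassumption. }
  assert (CZ : forall y : R, continuous dZ y).
  { intros y. pose proof (DU y) as D1. pose proof (DZ y) as D2. pose proof (wp y). unfold dZ.
    apply (ex_derive_continuous (fun y => - (w * exp y) * U lam y + (nu ^ 2 - 1 / 4) / (w * exp y) * U lam y - Z y / 2)).
    auto_derive. repeat split; try (eexists; eassumption). lra. }
  assert (EE : forall y, 0 < U lam y ^ 2 + Z y ^ 2).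
  { intros y. destruct (Req_dec (U lam y) 0) as [U0|U0].
    - pose proof (energy_pos nu de x0 lam y) as Q. rewrite U0 in *.
      assert (f lam y <> 0) by (intros E; rewrite E in Q; lra).
      assert (Z y <> 0) by (intros E; pose proof (EZ y) as E2; rewrite E, U0 in E2; lra).
      pose proof (pow2_gt_0 (Z y) H0). lra.
    - pose proof (pow2_gt_0 _ U0). pose proof (pow2_ge_0 (Z y)). lra. }
  set (ph0 := - atan (kap / (w * exp x0))).
  pose (ph := angle (U lam) Z dU dZ x0 ph0).
  assert (Zx0 : Z x0 = kap / (w * exp x0)) by (unfold Z; rewrite fsol_x0, usol_x0; f_equal; ring).
  assert (pol : forall y, U lam y = sqrt (U lam y ^ 2 + Z y ^ 2) * cos (ph y) /\
                          Z y = - sqrt (U lam y ^ 2 + Z y ^ 2) * sin (ph y)).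
  { intros y.
    assert (Sq : 0 < sqrt (1 + (kap / (w * exp x0))²)) by (apply sqrt_lt_R0; pose proof (Rle_0_sqr (kap / (w * exp x0))); lra).
    apply angle_polar; trivial; rewrite usol_x0, Zx0; unfold ph0;
      replace (1 ^ 2 + (kap / (w * exp x0)) ^ 2) with (1 + (kap / (w * exp x0))²) by (unfold Rsqr; ring).
    - rewrite cos_neg, cos_atan. field. lra.
    - rewrite sin_neg, sin_atan. pose proof (exp_pos x0). field. repeat split; lra. }
  assert (Dph : forall y, is_derive ph y (w * exp y - (nu ^ 2 - 1 / 4) / (w * exp y) * (U lam y ^ 2 / (U lam y ^ 2 + Z y ^ 2)))).
  { intros y. eapply is_derive_eqr; [apply (is_derive_angle (U lam) Z dU dZ x0 ph0 DU DZ CU CZ EE)|].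
    unfold dU, dZ. pose proof (EE y). pose proof (wp y). pose proof (exp_pos y). field. repeat split; lra. }
  assert (phx0 : ph x0 = ph0) by (unfold ph, angle; rewrite RInt_point; apply Rplus_0_r).
  (* The deviation from the middle consists of the integrated perturbation, bounded with
     [|nu^2 - 1/4| <= nu^2 + 1], and the initial phase [ph0]. Half a radian is below [PI / 3],
     whence [cos eta > 1/2] later. *)
  pose (eta := ph X - (INR s + 1 / 2) * PI).
  assert (Heta : Rabs eta <= 1 / 2).
  { unfold eta. rewrite <- Hs.
    replace (ph X - w * (exp X - exp x0)) with ((ph X - w * exp X - (ph x0 - w * exp x0)) + ph0) by (rewrite phx0; ring).
    eapply Rle_trans; [apply Rabs_triang|]. eapply Rle_trans; [|exact Hsmall]. apply Rplus_le_compat.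
    - replace ((nu ^ 2 + 1) * (X - x0) / (w * exp x0)) with ((nu ^ 2 + 1) / (w * exp x0) * Rabs (X - x0))
        by (rewrite Rabs_pos_eq by lra; unfold Rdiv; ring).
      apply (abs_diff_le_of_derive (fun y => ph y - w * exp y) (fun y => - ((nu ^ 2 - 1 / 4) / (w * exp y) * (U lam y ^ 2 / (U lam y ^ 2 + Z y ^ 2))))).
      + intros t _. pose proof (Dph t) as D. auto_derive; [eexists; exact D|].
        known_derive. ring.
      + intros t Ht. rewrite Rmin_left, Rmax_right in Ht by lra.
        rewrite Rabs_Ropp, Rabs_mult.
        pose proof (wp t) as Wt. pose proof (wp x0) as W0. pose proof (EE t) as Et. pose proof (pow2_ge_0 (U lam t)). pose proof (pow2_ge_0 (Z t)).
        assert (R1 : 0 <= U lam t ^ 2 / (U lam t ^ 2 + Z t ^ 2) <= 1).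
        { split; [apply Rdiv_le_0_compat; assumption|]. apply Rmult_le_reg_r with (U lam t ^ 2 + Z t ^ 2); [exact Et|].
          unfold Rdiv. rewrite Rmult_assoc, Rinv_l by lra. lra. }
        rewrite (Rabs_pos_eq (U lam t ^ 2 / _)) by lra.
        rewrite <- (Rmult_1_r ((nu ^ 2 + 1) / (w * exp x0))).
        apply Rmult_le_compat; [apply Rabs_pos|lra| |lra].
        unfold Rdiv. rewrite Rabs_mult, (Rabs_pos_eq (/ _)) by (apply Rlt_le, Rinv_0_lt_compat, Wt).
        apply Rmult_le_compat; [apply Rabs_pos|apply Rlt_le, Rinv_0_lt_compat, Wt| |].
        * pose proof (pow2_ge_0 nu). apply Rabs_le. lra.
        * apply Rinv_le_contravar; [exact W0|]. apply Rmult_le_compat_l; [lra|]. apply exp_le. lra.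
    - unfold ph0. rewrite Rabs_Ropp. eapply Rle_trans; [apply Rabs_atan_le|].
      unfold Rdiv. rewrite Rabs_mult, (Rabs_pos_eq (/ _)) by (apply Rlt_le, Rinv_0_lt_compat, wp). apply Rle_refl. }
  assert (kapsmall : Rabs kap <= w * exp x0 / 2).
  { pose proof (wp x0) as W0.
    assert (Q : 0 <= (nu ^ 2 + 1) * (X - x0) / (w * exp x0)).
    { apply Rdiv_le_0_compat; [|exact W0]. pose proof (pow2_ge_0 nu). apply Rmult_le_pos; lra. }
    assert (Q2 : Rabs kap / (w * exp x0) <= 1 / 2) by lra.
    apply Rmult_le_reg_r with (/ (w * exp x0)); [now apply Rinv_0_lt_compat|].
    replace (w * exp x0 / 2 * / (w * exp x0)) with (1 / 2) by (pose proof (exp_pos x0); field; lra). exact Q2. }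
  (* [(u, f)] and [(u, Z)] are related by a lower triangular matrix with positive diagonal, so they are never opposite. *)
  assert (T : Rabs (ph X - theta lam X) < PI).
  { apply (angle_trapped (fun y => ph y - theta lam y) x0 X); [lra| | |].
    - intros y _. apply continuity_pt_minus; [|apply theta_continuity].
      eapply is_derive_continuity_pt, Dph.
    - rewrite phx0, theta_x0, Rminus_0_r. unfold ph0. rewrite Rabs_Ropp.
      pose proof (atan_bound (kap / (w * exp x0))). apply Rabs_def1; lra.
    - intros y Hy E.
      destruct (pol y) as [A1 A2]. destruct (theta_polar nu de x0 lam y) as [B1 B2].
      pose proof (sqrt_lt_R0 _ (EE y)) as R2. pose proof (sqrt_lt_R0 _ (energy_pos nu de x0 lam y)) as R1.
      set (r2 := sqrt (U lam y ^ 2 + Z y ^ 2)) in *. set (r1 := sqrt (U lam y ^ 2 + f lam y ^ 2)) in *.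
      assert (CS : cos (ph y) = - cos (theta lam y) /\ sin (ph y) = - sin (theta lam y)).
      { unfold Rabs in E. destruct (Rcase_abs (ph y - theta lam y)) as [L|L].
        - replace (ph y) with (theta lam y - PI) by lra. rewrite cos_minus, sin_minus, cos_PI, sin_PI. lra.
        - replace (ph y) with (theta lam y + PI) by lra. rewrite neg_cos, neg_sin. lra. }
      destruct CS as [C1 S1]. rewrite C1 in A1. rewrite S1 in A2.
      assert (c0 : cos (theta lam y) = 0) by nra.
      assert (U0 : U lam y = 0) by (rewrite B1, c0; ring).
      pose proof (EZ y) as E2. rewrite U0, Rmult_0_r, Rplus_0_r, A2, B2 in E2.
      pose proof (wp y) as Wy.
      assert (s0 : sin (theta lam y) = 0).
      { assert (Q : (w * exp y * r2 + r1) * sin (theta lam y) = 0) by lra.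
        apply Rmult_integral in Q. destruct Q as [Q|Q]; [|exact Q].
        assert (0 < w * exp y * r2) by (apply Rmult_lt_0_compat; lra). lra. }
      pose proof (sin2_cos2 (theta lam y)) as SC. unfold Rsqr in SC. rewrite c0, s0 in SC. lra. }
  apply Rabs_def2 in T. apply Rabs_le_between in Heta.
  (* Being within [PI] of [PI / 2 + eta], [tau] lies in [(- PI, 2 PI)], where the sine is positive
     exactly on [(0, PI)]. The sign of [sin tau] is that of [w exp X cos eta - kap sin eta], from
     the two polar expressions for [f] at [X]. *)
  set (tau := theta lam X - INR s * PI).
  assert (Etau : theta lam X = INR s * PI + tau) by (unfold tau; ring).
  assert (Eph : ph X = INR s * PI + (PI / 2 + eta)) by (unfold eta; field).
  assert (Htau : - PI < tau < 2 * PI) by (unfold tau; lra).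
  assert (sgn : 0 < sin tau).
  { destruct (pol X) as [A1 A2]. destruct (theta_polar nu de x0 lam X) as [B1 B2].
    pose proof (sqrt_lt_R0 _ (EE X)) as R2. pose proof (sqrt_lt_R0 _ (energy_pos nu de x0 lam X)) as R1.
    set (r2 := sqrt (U lam X ^ 2 + Z X ^ 2)) in *. set (r1 := sqrt (U lam X ^ 2 + f lam X ^ 2)) in *.
    rewrite Eph, cos_shift_nPI in A1. rewrite Eph, sin_shift_nPI in A2. rewrite Etau, sin_shift_nPI in B2.
    rewrite cos_plus, cos_PI2, sin_PI2 in A1. rewrite sin_plus, cos_PI2, sin_PI2 in A2.
    pose proof (EZ X) as E2.
    assert (Q : (-1) ^ s * (r1 * sin tau) = (-1) ^ s * (r2 * (w * exp X * cos eta - kap * sin eta))).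
    { transitivity (- f lam X); [rewrite B2; ring|]. 
      transitivity (- (w * exp X * Z X - kap * U lam X)); [lra|]. rewrite A1, A2. ring. }
    apply Rmult_eq_reg_l in Q; [|apply pow_nonzero; lra].
    assert (ce : 1 / 2 < cos eta).
    { rewrite <- cos_PI3. destruct (Rle_dec 0 eta) as [L|L].
      - apply cos_decreasing_1; lra.
      - rewrite <- (cos_neg eta). apply cos_decreasing_1; lra. }
    assert (We : w * exp x0 <= w * exp X) by (apply Rmult_le_compat_l; [lra|apply exp_le; lra]).
    pose proof (wp x0) as W0.
    assert (ks : kap * sin eta <= w * exp X * (1 / 2)).
    { eapply Rle_trans; [apply Rle_abs|]. rewrite Rabs_mult.
      assert (Rabs (sin eta) <= 1) by (pose proof (SIN_bound eta); apply Rabs_le; lra).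
      pose proof (Rabs_pos kap). pose proof (Rabs_pos (sin eta)). nra. }
    assert (P : 0 < w * exp X * cos eta - kap * sin eta).
    { assert (w * exp X * (1 / 2) < w * exp X * cos eta) by (apply Rmult_lt_compat_l; lra). lra. }
    assert (0 < r2 * (w * exp X * cos eta - kap * sin eta)) by (apply Rmult_lt_0_compat; lra).
    rewrite <- Q in H. apply Rmult_lt_reg_l with r1; lra. }
  assert (0 < tau).
  { destruct (Rlt_dec 0 tau) as [L|L]; [exact L|exfalso].
    pose proof (sin_ge_0 (- tau) ltac:(lra) ltac:(lra)) as Q. rewrite sin_neg in Q. lra. }
  assert (tau < PI).
  { destruct (Rlt_dec tau PI) as [L|L]; [exact L|exfalso].
    pose proof (sin_le_0 tau ltac:(lra) ltac:(lra)). lra. }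
  rewrite Etau. lra.
Qed.

Lemma real_zeros (w X : R) (s : nat) : x0 < X -> 0 < w ->
  w * (exp X - exp x0) = (INR s + 1 / 2) * PI ->
  (nu ^ 2 + 1) * (X - x0) / (w * exp x0) + Rabs (de + 1 / 2) / (w * exp x0) <= 1 / 2 ->
  de ^ 2 < w ^ 2 * exp (2 * x0) ->
  exists l : list R, NoDup l /\ length l = (s + 1)%nat /\
    forall lam, In lam l <-> - w ^ 2 < lam < w ^ 2 /\ f lam X = 0.
Proof.
  intros HX Hw Hs Hsm Hd. assert (PP := PI_RGT_0).
  assert (w2 : - w ^ 2 < w ^ 2) by (pose proof (pow_lt w 2 Hw); lra).
  pose proof (theta_low w X HX Hd) as L. pose proof (theta_high w X s HX Hw Hs Hsm) as H.
  pose (P := psi X (- w ^ 2)).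
  assert (PL : P (- w ^ 2) = theta (- w ^ 2) X) by apply psi_l0.
  assert (PH : P (w ^ 2) = theta (w ^ 2) X) by (apply psi_theta; lra).
  assert (inc : forall a b, a < b -> P a < P b) by (intros; now apply psi_increasing).
  assert (inj : forall a b, P a = P b -> a = b).
  { intros a b E. destruct (Rtotal_order a b) as [Q|[Q|Q]]; trivial; apply inc in Q; lra. }
  assert (Z : forall lam, f lam X = 0 <-> sin (P lam) = 0).
  { intros lam. destruct (psi_polar X (- w ^ 2) lam) as [_ B]. fold P in B.
    pose proof (sqrt_lt_R0 _ (energy_pos nu de x0 lam X)) as R1.
    set (r1 := sqrt (U lam X ^ 2 + f lam X ^ 2)) in *. split; intros E.
    - rewrite E in B. apply Rmult_eq_reg_l with (- r1); lra.
    - rewrite B. change (sin (psi X (- w ^ 2) lam)) with (sin (P lam)). rewrite E. ring. }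
  (* The values taken are [j PI] for [j = 0, ..., s], as the lower end lies in [(- PI, 0)] and the
     upper one between [s PI] and [(s + 1) PI]. Each is attained by continuity, and only once by
     monotonicity. *)
  assert (K : forall m, (m <= s + 1)%nat -> exists l : list R, NoDup l /\ length l = m /\
    forall lam, In lam l <-> - w ^ 2 < lam < w ^ 2 /\ exists j, (j < m)%nat /\ P lam = INR j * PI).
  { induction m as [|m IH]; intros Hm.
    - exists nil. split; [constructor|]. split; [reflexivity|]. intros lam. split; [easy|]. intros [_ [j [Hj _]]]. lia.
    - destruct (IH ltac:(lia)) as (l & N & Len & Hl).
      assert (Hms : INR m <= INR s) by (apply le_INR; lia). pose proof (pos_INR m).
      destruct (Ranalysis5.IVT_interv (fun t => P t - INR m * PI) (- w ^ 2) (w ^ 2)) as [z [Hz Ez]].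
      + intros a _. apply continuity_pt_minus; [eapply is_derive_continuity_pt, is_derive_psi|].
        apply continuity_pt_const. now intros ? ?.
      + exact w2.
      + rewrite PL. nra.
      + rewrite PH. nra.
      + assert (Ez' : P z = INR m * PI) by lra.
        assert (Hz' : - w ^ 2 < z < w ^ 2).
        { split.
          - destruct (Req_dec z (- w ^ 2)) as [->|]; [|lra]. rewrite PL in Ez'. nra.
          - destruct (Req_dec z (w ^ 2)) as [->|]; [|lra]. rewrite PH in Ez'. nra. }
        exists (z :: l). split; [|split].
        * constructor; [|exact N]. intros Hin. apply Hl in Hin. destruct Hin as [_ [j [Hj E]]].
          rewrite Ez' in E. apply Rmult_eq_reg_r in E; [|lra]. apply INR_eq in E. lia.
        * simpl. now rewrite Len.
        * intros lam. simpl. split.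
          -- intros [<-|Hin]; [split; [exact Hz'|exists m; split; [lia|exact Ez']]|].
             apply Hl in Hin. destruct Hin as [I [j [Hj E]]]. split; [exact I|]. exists j. split; [lia|exact E].
          -- intros [I [j [Hj E]]]. destruct (Nat.eq_dec j m) as [->|Hne].
             ++ left. apply inj. now rewrite E.
             ++ right. apply Hl. split; [exact I|]. exists j. split; [lia|exact E]. }
  destruct (K (s + 1)%nat (Nat.le_refl _)) as (l & N & Len & Hl).
  exists l. split; [exact N|]. split; [exact Len|]. intros lam. rewrite Hl, Z. split.
  - intros [I [j [Hj E]]]. split; [exact I|]. rewrite E. apply sin_eq_0_1. exists (Z.of_nat j). now rewrite INR_IZR_INZ.
  - intros [I E]. split; [exact I|]. apply sin_eq_0_0 in E. destruct E as [k Ek].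
    pose proof (inc (- w ^ 2) lam (proj1 I)) as I1. pose proof (inc lam (w ^ 2) (proj2 I)) as I2.
    rewrite PL in I1. rewrite PH in I2.
    assert (K1 : (-1 < k)%Z) by (apply lt_IZR; apply Rmult_lt_reg_r with PI; lra).
    assert (K2 : (k < Z.of_nat s + 1)%Z).
    { apply lt_IZR. rewrite plus_IZR, <- INR_IZR_INZ. apply Rmult_lt_reg_r with PI; lra. }
    exists (Z.to_nat k). split; [lia|]. rewrite INR_IZR_INZ, Z2Nat.id by lia. exact Ek.
Qed.

Lemma simple_zero (lam X : R) : x0 < X -> f lam X = 0 -> F (dpow lam) X <> 0.
Proof. intros HX E Z. pose proof (lagrange_neg lam X HX) as L. rewrite E, Z in L. lra. Qed.

(** Green's identity for the real and imaginary parts of [u]. *)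
Lemma zeros_real (a b : nat -> R) (al be X : R) : x0 < X -> geo a -> geo b -> a 0%nat = 1 ->
  (forall k, a (S k) = al * a k + - be * b k) -> (forall k, b (S k) = al * b k + be * a k) ->
  F a X = 0 -> F b X = 0 -> be = 0.
Proof.
  intros HX Ga Gb A0 Ra Rb Fa Fb.
  pose (G := fun y => V a y * F b y - V b y * F a y).
  assert (D : forall y, is_derive G y (- be * (exp (2 * y) * (V a y ^ 2 + V b y ^ 2)))).
  { intros y.
    pose proof (is_derive_Vs nu de x0 a y Ga) as D1. pose proof (is_derive_Fs nu de x0 a y Ga) as D2.
    pose proof (is_derive_Vs nu de x0 b y Gb) as D3. pose proof (is_derive_Fs nu de x0 b y Gb) as D4.
    rewrite (V_ext nu de x0 (fun k => a (S k)) (fun k => al * a k + - be * b k)), (V_lin nu de x0 a b) in D2 by assumption.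
    rewrite (V_ext nu de x0 (fun k => b (S k)) (fun k => al * b k + be * a k)), (V_lin nu de x0 b a) in D4 by assumption.
    unfold G. set (va := Vs nu de x0 a) in *. set (vb := Vs nu de x0 b) in *.
    set (fa := Fs nu de x0 a) in *. set (fb := Fs nu de x0 b) in *.
    auto_derive; [repeat split; eexists; eassumption|].
    known_derive.
    ring. }
  destruct (Req_dec be 0) as [E|E]; [exact E|exfalso].
  (* Divided by [- be], Green's identity exhibits a strictly increasing function, although [G]
     vanishes at both ends. *)
  assert (S : - / be * G x0 < - / be * G X).
  { apply (strict_incr_of_derive (fun y => - / be * G y) (fun y => exp (2 * y) * (V a y ^ 2 + V b y ^ 2)) x0 X HX).
    - intros y _. eapply is_derive_eqr; [apply (is_derive_scal G y (- / be) _ (D y))|]. change mult with Rmult. field. exact E.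
    - intros y _. apply Rmult_le_pos; [apply Rlt_le, exp_pos|]. pose proof (pow2_ge_0 (V a y)). pose proof (pow2_ge_0 (V b y)). lra.
    - pose proof (is_derive_Vs nu de x0 a x0 Ga) as D1. pose proof (is_derive_Vs nu de x0 b x0 Gb) as D3.
      set (va := Vs nu de x0 a) in *. set (vb := Vs nu de x0 b) in *.
      apply (ex_derive_continuous (fun y => exp (2 * y) * (va y ^ 2 + vb y ^ 2))).
      auto_derive. repeat split; eexists; eassumption.
    - rewrite !Vs_x0, A0 by assumption. pose proof (pow2_ge_0 (b 0%nat)). apply Rmult_lt_0_compat; [apply exp_pos|lra]. }
  unfold G in S. rewrite !Fs_x0, Fa, Fb in S. lra.
Qed.

(** With [e = exp (- nu (x - x0))] one has [ff 0 = (nu - de) (u - e)] and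
    [(e (u - e))' = (nu + de) e^2]. By the mean value theorem [ff 0] at [X] is [nu^2 - de^2] times a
    positive number, uniformly in [nu >= 0]. *)
Lemma ff0_zero (X : R) : 0 <= nu -> x0 < X -> (ff nu de x0 0 X = 0 <-> nu = Rabs de).
Proof.
  intros Hnu HX.
  pose (e := fun y => exp (- (nu * (y - x0)))).
  assert (Eff : ff nu de x0 0 X = (nu - de) * (uu nu de x0 0 X - e X)).
  { unfold ff, pp, e; simpl. ring. }
  destruct (MVT_gen (fun y => e y * (uu nu de x0 0 y - e y)) x0 X (fun y => (nu + de) * (e y * e y))) as [z [_ Ez]].
  - intros y _. pose proof (proj1 (up_derive nu de x0 0 y)) as D. change (pp nu de x0 0 y) with ((de - nu) * e y) in D.
    set (v := uu nu de x0 0) in *.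
    unfold e at 1 2. auto_derive; [eexists; exact D|].
    known_derive.
    unfold e, Rminus. ring.
  - intros y _. pose proof (proj1 (up_derive nu de x0 0 y)) as D.
    set (v := uu nu de x0 0) in *. apply continuity_pt_filterlim. unfold e.
    apply (ex_derive_continuous (fun y => exp (- (nu * (y - x0))) * (v y - exp (- (nu * (y - x0)))))).
    auto_derive. repeat split. eexists; exact D.
  - assert (I0 : uu nu de x0 0 x0 - e x0 = 0).
    { rewrite uu_x0. unfold e. rewrite Rminus_diag, Rmult_0_r, Ropp_0, exp_0. ring. }
    rewrite I0, Rmult_0_r, Rminus_0_r in Ez.
    assert (eX : 0 < e X) by apply exp_pos. assert (ez : 0 < e z * e z) by (apply Rmult_lt_0_compat; apply exp_pos).
    rewrite Eff. split.
    + intros Q. apply Rmult_integral in Q. destruct Q as [Q|Q].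
      * rewrite Rabs_pos_eq; lra.
      * rewrite Q, Rmult_0_r in Ez.
        assert (nu + de = 0).
        { apply Rmult_eq_reg_r with (e z * e z * (X - x0)); [|apply Rgt_not_eq, Rmult_lt_0_compat; lra]. lra. }
        rewrite Rabs_left1; lra.
    + intros Q. unfold Rabs in Q. destruct (Rcase_abs de).
      * replace (nu + de) with 0 in Ez by lra. rewrite !Rmult_0_l in Ez.
        apply Rmult_integral in Ez. destruct Ez as [Ez|Ez]; [lra|]. rewrite Ez. ring.
      * rewrite Q. ring.
Qed.
End Count.

(** * Complex power series *)

Notation is_Cseries := (@is_series C_AbsRing C_NormedModule).

Lemma pow_n_Cpow (z : C) (k : nat) : @pow_n C_Ring z k = (z ^ k)%C.
Proof. induction k as [|k IH]; [reflexivity|]. simpl. now rewrite IH. Qed.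

Lemma Rabs_fst_le (z : C) : Rabs (fst z) <= Cmod z.
Proof. eapply Rle_trans; [apply Rmax_l|apply Rmax_Cmod]. Qed.
Lemma Rabs_snd_le (z : C) : Rabs (snd z) <= Cmod z.
Proof. eapply Rle_trans; [apply Rmax_r|apply Rmax_Cmod]. Qed.

(** A total sum operator, so that values of complex series can be written before convergence is
    known; it agrees with the limit whenever there is one. *)
Definition Csum (a : nat -> C) : C := (Series (fun k => fst (a k)), Series (fun k => snd (a k))).

Lemma sum_n_fst (a : nat -> C) (n : nat) : fst (@sum_n C_NormedModule a n) = sum_n (fun k => fst (a k)) n.
Proof. induction n as [|n IH]; [now rewrite !sum_O|]. rewrite !sum_Sn, <- IH. reflexivity. Qed.
Lemma sum_n_snd (a : nat -> C) (n : nat) : snd (@sum_n C_NormedModule a n) = sum_n (fun k => snd (a k)) n.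
Proof. induction n as [|n IH]; [now rewrite !sum_O|]. rewrite !sum_Sn, <- IH. reflexivity. Qed.

Lemma Csum_unique (a : nat -> C) (l : C) : is_Cseries a l -> Csum a = l.
Proof.
  intros H. rewrite (surjective_pairing l). unfold Csum. f_equal; apply is_series_unique.
  - unfold is_series. eapply filterlim_ext; [intros n; apply sum_n_fst|].
    eapply filterlim_comp; [exact H|]. apply (continuous_fst (U := R_UniformSpace) (V := R_UniformSpace)).
  - unfold is_series. eapply filterlim_ext; [intros n; apply sum_n_snd|].
    eapply filterlim_comp; [exact H|]. apply (continuous_snd (U := R_UniformSpace) (V := R_UniformSpace)).
Qed.

Lemma Csum_correct (a : nat -> C) (B : nat -> R) :
  (forall k, Cmod (a k) <= B k) -> ex_series B -> is_Cseries a (Csum a).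
Proof.
  intros H HB.
  destruct (ex_series_le (V := C_CompleteNormedModule) a B H HB) as [l Hl].
  now rewrite (Csum_unique a l).
Qed.

Lemma norm_sum_le (a : nat -> C) (n : nat) : Cmod (@sum_n C_NormedModule a n) <= sum_n (fun k => Cmod (a k)) n.
Proof.
  induction n as [|n IH]; [rewrite !sum_O; lra|]. rewrite !sum_Sn.
  eapply Rle_trans; [apply Cmod_triangle|]. apply Rplus_le_compat_r, IH.
Qed.

Lemma sum_n_le_R (a b : nat -> R) (n : nat) : (forall k, a k <= b k) -> sum_n a n <= sum_n b n.
Proof.
  intros H. induction n as [|n IH]; [rewrite !sum_O; apply H|]. rewrite !sum_Sn. apply Rplus_le_compat; [exact IH|apply H].
Qed.

Lemma sum_n_term_le (a : nat -> R) (n m : nat) : (forall k, 0 <= a k) -> (m <= n)%nat -> a m <= sum_n a n.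
Proof.
  intros H. revert m. induction n as [|n IH]; intros m Hm.
  - replace m with 0%nat by lia. rewrite sum_O. lra.
  - rewrite sum_Sn. change plus with Rplus. destruct (Nat.eq_dec m (S n)) as [->|Hne].
    + assert (0 <= sum_n a n) by (eapply Rle_trans; [apply (H 0%nat)|apply IH; lia]). lra.
    + specialize (IH m ltac:(lia)). specialize (H (S n)). lra.
Qed.

Lemma sum_n_extend (a : nat -> C) (n m : nat) : (forall k, (n < k)%nat -> a k = RtoC 0) -> (n <= m)%nat ->
  @sum_n C_NormedModule a m = @sum_n C_NormedModule a n.
Proof.
  intros H. induction m as [|m IH]; intros Hm.
  - now replace n with 0%nat by lia.
  - destruct (Nat.eq_dec n (S m)) as [->|Hne]; [reflexivity|].
    rewrite sum_Sn, IH, H by lia. apply Cplus_0_r.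
Qed.

Lemma sum_n_extend_R (a : nat -> R) (n m : nat) : (forall k, (n < k)%nat -> a k = 0) -> (n <= m)%nat -> sum_n a m = sum_n a n.
Proof.
  intros H. induction m as [|m IH]; intros Hm.
  - now replace n with 0%nat by lia.
  - destruct (Nat.eq_dec n (S m)) as [->|Hne]; [reflexivity|].
    rewrite sum_Sn, IH, H by lia. apply Rplus_0_r.
Qed.

Lemma sum_n_mono (a : nat -> R) (n m : nat) : (forall k, 0 <= a k) -> (n <= m)%nat -> sum_n a n <= sum_n a m.
Proof.
  intros H Hm. induction Hm as [|m Hm IH]; [lra|]. rewrite sum_Sn. change plus with Rplus. specialize (H (S m)). lra.
Qed.

Lemma is_Cseries_sum_n (P : nat -> nat -> C) (d : nat -> C) (M : nat) :
  (forall m, is_Cseries (fun k => P k m) (d m)) ->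
  is_Cseries (fun k => @sum_n C_NormedModule (P k) M) (@sum_n C_NormedModule d M).
Proof.
  intros H. induction M as [|M IH].
  - rewrite sum_O. eapply is_series_ext; [|apply (H 0%nat)]. intros k. simpl. now rewrite sum_O.
  - rewrite sum_Sn. eapply is_series_ext; [|apply (is_series_plus _ _ _ _ IH (H (S M)))].
    intros k. simpl. now rewrite sum_Sn.
Qed.

(** Weierstrass's double series theorem. *)
Lemma series_of_polynomials (P : nat -> nat -> C) (deg : nat -> nat) (B : nat -> R) (r : R) (w : C) :
  Cmod w <= r -> 0 < r ->
  (forall k m, (deg k < m)%nat -> P k m = RtoC 0) ->
  (forall k, sum_n (fun m => Cmod (P k m) * r ^ m) (deg k) <= B k) -> ex_series B ->
  @is_pseries C_AbsRing C_NormedModule (fun m => Csum (fun k => P k m)) w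
    (Csum (fun k => @sum_n C_NormedModule (fun m => (w ^ m * P k m)%C) (deg k))).
Proof.
  intros Hw Hr Hdeg HB HexB.
  assert (nn : forall k m, 0 <= Cmod (P k m) * r ^ m) by (intros; apply Rmult_le_pos; [apply Cmod_ge_0|apply pow_le; lra]).
  assert (Hall : forall k M, sum_n (fun m => Cmod (P k m) * r ^ m) M <= B k).
  { intros k M. eapply Rle_trans; [|apply HB]. destruct (Nat.le_ge_cases M (deg k)) as [L|L].
    - now apply sum_n_mono.
    - rewrite (sum_n_extend_R _ (deg k) M); [lra| |exact L]. intros j Hj. rewrite Hdeg, Cmod_0 by exact Hj. ring. }
  assert (Hw2 : forall k m, Cmod (w ^ m * P k m) <= Cmod (P k m) * r ^ m).
  { intros k m. rewrite Cmod_mult, Cmod_pow, Rmult_comm. apply Rmult_le_compat_l; [apply Cmod_ge_0|].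
    apply pow_incr. split; [apply Cmod_ge_0|exact Hw]. }
  assert (Hd : forall m, is_Cseries (fun k => P k m) (Csum (fun k => P k m))).
  { intros m. apply Csum_correct with (fun k => / r ^ m * B k).
    - intros k. assert (0 < r ^ m) by (apply pow_lt; lra).
      apply Rmult_le_reg_l with (r ^ m); [assumption|]. rewrite <- Rmult_assoc, Rinv_r, Rmult_1_l by lra.
      rewrite Rmult_comm. eapply Rle_trans; [|apply (Hall k m)].
      apply (sum_n_term_le (fun m => Cmod (P k m) * r ^ m)); [apply nn|lia].
    - now apply ex_series_scal_R. }
  assert (Hdw : forall m, is_Cseries (fun k => (w ^ m * P k m)%C) (w ^ m * Csum (fun k => P k m))%C).
  { intros m. exact (is_series_scal (V := C_NormedModule) (w ^ m)%C _ _ (Hd m)). }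
  unfold is_pseries, is_series.
  apply filterlim_ext with (fun M => @sum_n C_NormedModule (fun m => (w ^ m * Csum (fun k => P k m))%C) M).
  { intros M. apply sum_n_ext. intros m. now rewrite <- pow_n_Cpow. }
  (* For fixed [M] the partial sum in [m] is itself a series in [k], so exchanging the sums is
     dominated convergence as [M] tends to infinity. *)
  apply (tannery (V := C_NormedModule) eventually
    (fun M k => @sum_n C_NormedModule (fun m => (w ^ m * P k m)%C) M) _
    (fun k => @sum_n C_NormedModule (fun m => (w ^ m * P k m)%C) (deg k)) _ B).
  - exact HexB.
  - exists 0%nat. intros M _ k. change norm with Cmod. eapply Rle_trans; [apply norm_sum_le|].
    eapply Rle_trans; [|apply (Hall k M)]. apply sum_n_le_R. intros m. apply Hw2.
  - intros k. change norm with Cmod. eapply Rle_trans; [apply norm_sum_le|].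
    eapply Rle_trans; [|apply (Hall k (deg k))]. apply sum_n_le_R. intros m. apply Hw2.
  - intros k. apply filterlim_ext_loc with (fun _ => @sum_n C_NormedModule (fun m => (w ^ m * P k m)%C) (deg k)).
    + exists (deg k). intros M HM. symmetry. apply sum_n_extend; [|exact HM].
      intros m Hm. rewrite Hdeg by exact Hm. apply Cmult_0_r.
    + apply filterlim_const.
  - exists 0%nat. intros M _. apply (is_Cseries_sum_n (fun k m => (w ^ m * P k m)%C)). exact Hdw.
  - apply Csum_correct with B; [|exact HexB].
    intros k. eapply Rle_trans; [apply norm_sum_le|].
    eapply Rle_trans; [|apply (Hall k (deg k))]. apply sum_n_le_R. intros m. apply Hw2.
Qed.

(** Coefficient of [w ^ m] in [(z0 + w) ^ n]. *)
Fixpoint pcoef (z0 : C) (n m : nat) : C :=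
  match n with
  | O => match m with O => RtoC 1 | S _ => RtoC 0 end
  | S n' => (z0 * pcoef z0 n' m + match m with O => RtoC 0 | S m' => pcoef z0 n' m' end)%C
  end.

Lemma pcoef_large (z0 : C) (n m : nat) : (n < m)%nat -> pcoef z0 n m = RtoC 0.
Proof.
  revert m. induction n as [|n IH]; intros m Hm; (destruct m as [|m]; [lia|]); [reflexivity|].
  simpl. rewrite !IH by lia. ring.
Qed.

Lemma sum_n_shift_C (a : nat -> C) (n : nat) :
  @sum_n C_NormedModule (fun m => match m with O => RtoC 0 | S j => a j end) (S n) = @sum_n C_NormedModule a n.
Proof.
  induction n as [|n IH]; [rewrite sum_Sn, !sum_O; apply Cplus_0_l|]. rewrite sum_Sn, IH, sum_Sn. reflexivity.
Qed.

Lemma sum_n_shift_R (a : nat -> R) (n : nat) : sum_n (fun m => match m with O => 0 | S j => a j end) (S n) = sum_n a n.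
Proof.
  induction n as [|n IH]; [rewrite sum_Sn, !sum_O; apply Rplus_0_l|]. rewrite sum_Sn, IH, sum_Sn. reflexivity.
Qed.

Lemma pcoef_sum (z0 w : C) (n : nat) : @sum_n C_NormedModule (fun m => (w ^ m * pcoef z0 n m)%C) n = ((z0 + w) ^ n)%C.
Proof.
  induction n as [|n IH]; [rewrite sum_O; simpl; ring|].
  transitivity (z0 * @sum_n C_NormedModule (fun m => (w ^ m * pcoef z0 n m)%C) (S n)
     + w * @sum_n C_NormedModule (fun m => (w ^ m * pcoef z0 n m)%C) n)%C.
  - rewrite <- (sum_n_shift_C (fun m => (w ^ m * pcoef z0 n m)%C) n).
    rewrite <- (sum_n_mult_l (K := C_Ring) z0), <- (sum_n_mult_l (K := C_Ring) w).
    etransitivity; [|apply (sum_n_plus (G := C_AbelianMonoid))]. apply sum_n_ext. intros [|m]; simpl;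
      change plus with Cplus; change mult with Cmult; ring.
  - rewrite (sum_n_extend _ n (S n)), IH; [|intros k Hk; rewrite pcoef_large by exact Hk; ring|lia]. simpl. ring.
Qed.

Lemma pcoef_norm (z0 : C) (r : R) (n : nat) : 0 <= r ->
  sum_n (fun m => Cmod (pcoef z0 n m) * r ^ m) n <= (Cmod z0 + r) ^ n.
Proof.
  intros Hr. induction n as [|n IH].
  - rewrite sum_O. simpl. rewrite Cmod_1. lra.
  - apply Rle_trans with (Cmod z0 * sum_n (fun m => Cmod (pcoef z0 n m) * r ^ m) (S n)
      + r * sum_n (fun m => Cmod (pcoef z0 n m) * r ^ m) n).
    + rewrite <- (sum_n_shift_R (fun m => Cmod (pcoef z0 n m) * r ^ m) n).
      rewrite <- (sum_n_mult_l (K := R_Ring) (Cmod z0)), <- (sum_n_mult_l (K := R_Ring) r).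
      eapply Rle_trans; [|apply Req_le, (sum_n_plus (G := R_AbelianMonoid))].
      apply sum_n_le_R. intros [|m]; simpl; change plus with Rplus; change mult with Rmult.
      * rewrite Cplus_0_r, Cmod_mult. lra.
      * assert (0 <= r * r ^ m) by (apply Rmult_le_pos; [exact Hr|now apply pow_le]).
        pose proof (Cmod_triangle (z0 * pcoef z0 n (S m)) (pcoef z0 n m)) as T. rewrite Cmod_mult in T. nra.
    + rewrite (sum_n_extend_R _ n (S n)); [|intros k Hk; rewrite pcoef_large, Cmod_0 by exact Hk; ring|lia].
      pose proof (Cmod_ge_0 z0). simpl. nra.
Qed.

Lemma pcoef_0 (z0 : C) (n : nat) : pcoef z0 n 0 = (z0 ^ n)%C.
Proof. induction n as [|n IH]; [reflexivity|]. simpl. rewrite IH. ring. Qed.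

Lemma pcoef_1 (z0 : C) (n : nat) : (z0 * pcoef z0 n 1 = RtoC (INR n) * z0 ^ n)%C.
Proof.
  induction n as [|n IH]; [simpl; ring|].
  change (pcoef z0 (S n) 1) with (z0 * pcoef z0 n 1 + pcoef z0 n 0)%C.
  rewrite pcoef_0, IH, S_INR, RtoC_plus. simpl. ring.
Qed.

(** Each power of [z0 + w] is expanded binomially and the double sum rearranged; the majorant is the
    series of absolute values at [|z0| + 1], which converges because [g] is [exp_bounded]. *)
Lemma even_series_taylor (g : nat -> R) (z0 w : C) : exp_bounded g -> Cmod w <= 1 ->
  @is_pseries C_AbsRing C_NormedModule (fun m => Csum (fun k => (RtoC (g k) * pcoef z0 (2 * k) m)%C)) w
    (Csum (fun k => (RtoC (g k) * ((z0 + w) ^ 2) ^ k)%C)).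
Proof.
  intros Hg Hw.
  replace (Csum (fun k => (RtoC (g k) * ((z0 + w) ^ 2) ^ k)%C)) with
    (Csum (fun k => @sum_n C_NormedModule (fun m => (w ^ m * (RtoC (g k) * pcoef z0 (2 * k) m))%C) (2 * k))).
  - apply (series_of_polynomials (fun k m => (RtoC (g k) * pcoef z0 (2 * k) m)%C) (fun k => (2 * k)%nat)
      (fun k => Rabs (g k * ((Cmod z0 + 1) ^ 2) ^ k)) 1); [exact Hw|lra| | |].
    + intros k m Hm. rewrite pcoef_large by exact Hm. ring.
    + intros k. rewrite Rabs_mult, <- pow_mult, (Rabs_pos_eq (_ ^ _)) by (apply pow_le; pose proof (Cmod_ge_0 z0); lra).
      eapply Rle_trans; [|apply Rmult_le_compat_l; [apply Rabs_pos|apply (pcoef_norm z0 1 (2 * k) Rle_0_1)]].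
      rewrite <- (sum_n_mult_l (K := R_Ring) (Rabs (g k))). apply Req_le, sum_n_ext. intros m.
      rewrite Cmod_mult, Cmod_R. apply Rmult_assoc.
    + now apply exp_bounded_ex_series.
  - assert (E : forall k, @sum_n C_NormedModule (fun m => (w ^ m * (RtoC (g k) * pcoef z0 (2 * k) m))%C) (2 * k)
        = (RtoC (g k) * ((z0 + w) ^ 2) ^ k)%C).
    { intros k. rewrite <- Cpow_mult_r, <- (pcoef_sum z0 w (2 * k)).
      etransitivity; [|apply (sum_n_mult_l (K := C_Ring) (RtoC (g k)))].
      apply sum_n_ext. intros m.
      change ((w ^ m * (RtoC (g k) * pcoef z0 (2 * k) m))%C = (RtoC (g k) * (w ^ m * pcoef z0 (2 * k) m))%C). ring. }
    unfold Csum. f_equal; apply Series_ext; intros k; now rewrite E.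
Qed.

Lemma inv_square_partial (q : C) (n : nat) :
  ((1 - q) ^ 2 * @sum_n C_NormedModule (fun k => RtoC (INR k + 1) * q ^ k) n
   = 1 - RtoC (INR n + 2) * q ^ (S n) + RtoC (INR n + 1) * q ^ (S (S n)))%C.
Proof.
  induction n as [|n IH].
  - rewrite sum_O. simpl INR. simpl Cpow. rewrite !RtoC_plus. ring.
  - rewrite sum_Sn. change plus with Cplus. rewrite Cmult_plus_distr_l, IH, S_INR, !RtoC_plus. simpl Cpow. ring.
Qed.

(** The series [sum (k + 1) q^k] at [q = - w / z0], from the closed form of its partial sums. The
    radius [|z0| / 4] is chosen so that [|q| <= 1/4] against [n + 2 <= 2 * 2^n] leaves a remainder
    of order [(1/2)^n]. *)
Lemma inv_square_taylor (z0 w : C) : z0 <> RtoC 0 -> Cmod w <= Cmod z0 / 4 ->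
  @is_pseries C_AbsRing C_NormedModule (fun n => (RtoC ((-1) ^ n * (INR n + 1)) / z0 ^ (n + 2))%C) w (/ (z0 + w) ^ 2)%C.
Proof.
  intros Hz Hw.
  assert (Pz : 0 < Cmod z0) by now apply Cmod_gt_0.
  set (q := (- w / z0)%C).
  assert (Eq : (1 - q = (z0 + w) / z0)%C) by (unfold q; field; exact Hz).
  assert (Hzw : (z0 + w <> RtoC 0)%C).
  { intros E. assert (E2 : z0 = (- w)%C) by (replace z0 with (z0 + w - w)%C by ring; rewrite E; ring).
    apply (f_equal Cmod) in E2. rewrite Cmod_opp in E2. lra. }
  assert (Mq : Cmod q <= / 4).
  { unfold q. unfold Cdiv. rewrite Cmod_mult, Cmod_opp, Cmod_inv by exact Hz.
    apply Rmult_le_reg_r with (Cmod z0); [exact Pz|]. rewrite Rmult_assoc, Rinv_l by lra. lra. }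
  assert (L : filterlim (fun n => @sum_n C_NormedModule (fun k => RtoC (INR k + 1) * q ^ k)%C n) eventually
     (@locally C_NormedModule (/ (1 - q) ^ 2)%C)).
  { assert (N1 : (1 - q <> RtoC 0)%C).
    { rewrite Eq. intros E. apply Hzw. replace (z0 + w)%C with ((z0 + w) / z0 * z0)%C by (field; exact Hz).
      rewrite E. ring. }
    assert (lim0 : is_lim_seq (fun n => 3 * Cmod (/ (1 - q) ^ 2) * (/ 2) ^ n) 0).
    { replace (Finite 0) with (Rbar_mult (3 * Cmod (/ (1 - q) ^ 2)) 0) by (simpl; f_equal; ring).
      apply is_lim_seq_scal_l. apply is_lim_seq_geom. rewrite Rabs_pos_eq; lra. }
    intros P HP. apply locally_norm_le_locally in HP. destruct HP as [eps HP].
    apply is_lim_seq_spec in lim0. destruct (lim0 eps) as [N HN]. exists N. intros n Hn. apply HP.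
    unfold ball_norm. change norm with Cmod.
    set (S := @sum_n C_NormedModule (fun k => RtoC (INR k + 1) * q ^ k)%C n).
    pose proof (inv_square_partial q n) as IS. fold S in IS.
    change (Cmod (S - / (1 - q) ^ 2)%C < eps).
    replace (S - / (1 - q) ^ 2)%C with ((/ (1 - q) ^ 2) * ((1 - q) ^ 2 * S - 1))%C by (field; exact N1).
    rewrite IS. specialize (HN n Hn). rewrite Rminus_0_r in HN. eapply Rle_lt_trans; [|exact HN].
    eapply Rle_trans; [|apply Rle_abs]. rewrite Cmod_mult, (Rmult_comm 3), Rmult_assoc.
    apply Rmult_le_compat_l; [apply Cmod_ge_0|].
    replace (1 - RtoC (INR n + 2) * q ^ Datatypes.S n + RtoC (INR n + 1) * q ^ Datatypes.S (Datatypes.S n) - 1)%C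
      with (q ^ Datatypes.S n * (RtoC (INR n + 1) * q - RtoC (INR n + 2)))%C by (simpl; ring).
    rewrite Cmod_mult, Cmod_pow.
    assert (M1 : Cmod (RtoC (INR n + 1) * q - RtoC (INR n + 2)) <= 2 * (INR n + 2)).
    { eapply Rle_trans; [apply Cmod_triangle|]. rewrite Cmod_opp, Cmod_mult, !Cmod_R.
      pose proof (pos_INR n). rewrite !Rabs_pos_eq by lra. pose proof (Cmod_ge_0 q). nra. }
    assert (M2 : Cmod q ^ Datatypes.S n <= (/ 4) ^ Datatypes.S n) by (apply pow_incr; split; [apply Cmod_ge_0|exact Mq]).
    assert (M3 : INR n + 2 <= 2 * 2 ^ n).
    { clear. induction n as [|n IH]; [simpl; lra|]. rewrite S_INR. simpl. pose proof (pos_INR n). lra. }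
    pose proof (Cmod_ge_0 (RtoC (INR n + 1) * q - RtoC (INR n + 2))) as G1. pose proof (pow_le (Cmod q) (Datatypes.S n) (Cmod_ge_0 q)) as G2.
    eapply Rle_trans; [apply Rmult_le_compat; [exact G2|exact G1|exact M2|exact M1]|].
    assert (E4 : (/ 4) ^ n * 2 ^ n = (/ 2) ^ n) by (rewrite <- Rpow_mult_distr; f_equal; lra).
    simpl. assert (0 < (/ 4) ^ n) by (apply pow_lt; lra).
    apply Rle_trans with (/ 4 * (/ 4) ^ n * (2 * (2 * 2 ^ n))); [apply Rmult_le_compat_l; nra|].
    replace (/ 4 * (/ 4) ^ n * (2 * (2 * 2 ^ n))) with ((/ 4) ^ n * 2 ^ n) by field.
    rewrite E4. pose proof (pow_lt (/ 2) n ltac:(lra)). lra. }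
  assert (L2 : is_Cseries (fun k => RtoC (INR k + 1) * q ^ k)%C (/ (1 - q) ^ 2)%C) by exact L.
  apply (is_series_scal (V := C_NormedModule) (/ z0 ^ 2)%C) in L2.
  replace (/ (z0 + w) ^ 2)%C with (/ z0 ^ 2 * / (1 - q) ^ 2)%C.
  - eapply is_series_ext; [|exact L2]. intros n. rewrite pow_n_Cpow.
    change (/ z0 ^ 2 * (RtoC (INR n + 1) * q ^ n) = w ^ n * (RtoC ((-1) ^ n * (INR n + 1)) / z0 ^ (n + 2)))%C.
    assert (Eqn : (q ^ n = RtoC ((-1) ^ n) * w ^ n / z0 ^ n)%C).
    { assert (E1 : RtoC (-1) = (- RtoC 1)%C) by (apply injective_projections; simpl; lra).
      unfold q. replace (- w / z0)%C with (RtoC (-1) * w * / z0)%C by (rewrite E1; field; exact Hz).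
      rewrite !Cpow_mult_l, Cpow_inv, RtoC_pow by exact Hz. reflexivity. }
    rewrite Eqn, RtoC_mult, Cpow_add_r. field. split; [exact Hz|]. now apply Cpow_nz.
  - rewrite Eq. field. split; assumption.
Qed.

(** * The analytic extension and the identity theorem *)

Lemma exp_bounded_shift (g : nat -> R) : exp_bounded g -> exp_bounded (fun k => g (S k)).
Proof.
  intros (M & c & HM & Hc & H). exists (M * c), c. split; [now apply Rmult_le_pos|]. split; [exact Hc|].
  intros k. eapply Rle_trans; [apply H|].
  replace (M * c * c ^ k) with (M * c ^ S k) by (simpl; ring).
  apply Rmult_le_compat_l; [apply Rmult_le_pos; [exact HM|now apply pow_le]|].
  apply Rinv_le_contravar; [apply INR_fact_pos|]. apply le_INR.
  replace (fact (S k)) with ((S k) * fact k)%nat by reflexivity. nia.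
Qed.

Lemma is_Cseries_pow (g : nat -> R) (l : C) : exp_bounded g ->
  is_Cseries (fun k => (RtoC (g k) * l ^ k)%C) (Csum (fun k => (RtoC (g k) * l ^ k)%C)).
Proof.
  intros H. apply Csum_correct with (fun k => Rabs (g k * Cmod l ^ k)); [|now apply exp_bounded_ex_series].
  intros k. rewrite Cmod_mult, Cmod_R, Cmod_pow, Rabs_mult, (Rabs_pos_eq (_ ^ _)) by (apply pow_le, Cmod_ge_0). lra.
Qed.

Lemma Csum_incr_1 (g : nat -> R) (l : C) : exp_bounded g ->
  (Csum (fun k => RtoC (g k) * l ^ k) = RtoC (g 0%nat) + l * Csum (fun k => RtoC (g (S k)) * l ^ k))%C.
Proof.
  intros H. apply Csum_unique.
  pose proof (is_Cseries_pow _ l (exp_bounded_shift g H)) as S1.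
  apply (is_series_scal (V := C_NormedModule) l) in S1.
  apply (is_series_decr_1 (V := C_NormedModule)).
  eapply is_series_ext; [|replace (plus _ _) with (l * Csum (fun k => RtoC (g (S k)) * l ^ k))%C; [exact S1|]].
  - intros k. change (l * (RtoC (g (S k)) * l ^ k) = RtoC (g (S k)) * (l * l ^ k))%C. ring.
  - change (l * Csum (fun k => RtoC (g (S k)) * l ^ k) =
      (RtoC (g 0%nat) + l * Csum (fun k => RtoC (g (S k)) * l ^ k)) + - (RtoC (g 0%nat) * RtoC 1))%C. ring.
Qed.

(** [F (z^2) / z^2] for [F l = sum_k g k l^k]; the value at [0] is the limit when [g 0 = 0]. *)
Definition hext (g : nat -> R) (z : C) : C :=
  if Ceq_dec z (RtoC 0) then RtoC (g 1%nat)
  else (RtoC (g 0%nat) / z ^ 2 + Csum (fun k => RtoC (g (S k)) * (z ^ 2) ^ k))%C.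

Lemma hext_nz (g : nat -> R) (z : C) : z <> RtoC 0 ->
  hext g z = (RtoC (g 0%nat) / z ^ 2 + Csum (fun k => RtoC (g (S k)) * (z ^ 2) ^ k))%C.
Proof. intros H. unfold hext. now destruct (Ceq_dec z (RtoC 0)). Qed.

Lemma hext_eq (g : nat -> R) (z : C) : exp_bounded g -> z <> RtoC 0 ->
  (z ^ 2 * hext g z = Csum (fun k => RtoC (g k) * (z ^ 2) ^ k))%C.
Proof.
  intros H Hz. rewrite hext_nz, (Csum_incr_1 g) by assumption. field. exact Hz.
Qed.

Lemma taylor_0 (f : C -> C) (z0 : C) (c : nat -> C) : taylor_at f z0 c -> c 0%nat = f z0.
Proof.
  intros [eps [He H]]. specialize (H z0).
  replace (z0 - z0)%C with (RtoC 0) in H by ring. rewrite Cmod_0 in H. specialize (H He).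
  apply Csum_unique in H. rewrite <- H. symmetry. apply Csum_unique.
  exact (is_pseries_0 (V := C_NormedModule) c).
Qed.

Definition hext_c (g : nat -> R) (z0 : C) (n : nat) : C :=
  (RtoC (g 0%nat) * (RtoC ((-1) ^ n * (INR n + 1)) / z0 ^ (n + 2))
   + Csum (fun k => RtoC (g (S k)) * pcoef z0 (2 * k) n))%C.

Lemma hext_taylor (g : nat -> R) (z0 : C) : exp_bounded g -> z0 <> RtoC 0 -> taylor_at (hext g) z0 (hext_c g z0).
Proof.
  intros H Hz. assert (Pz : 0 < Cmod z0) by now apply Cmod_gt_0.
  exists (Rmin 1 (Cmod z0 / 4)). split; [apply Rmin_glb_lt; lra|].
  intros z Hw. pose proof (Rmin_l 1 (Cmod z0 / 4)). pose proof (Rmin_r 1 (Cmod z0 / 4)).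
  set (w := (z - z0)%C) in *. assert (Ez : z = (z0 + w)%C) by (unfold w; ring).
  assert (Hnz : z <> RtoC 0).
  { intros E. assert (E2 : z0 = (- w)%C) by (unfold w; rewrite E; ring).
    apply (f_equal Cmod) in E2. rewrite Cmod_opp in E2. lra. }
  rewrite hext_nz by exact Hnz. rewrite Ez.
  pose proof (inv_square_taylor z0 w Hz ltac:(lra)) as T1.
  pose proof (even_series_taylor (fun k => g (S k)) z0 w (exp_bounded_shift g H) ltac:(lra)) as T2.
  apply (is_pseries_scal (V := C_NormedModule) (RtoC (g 0%nat))) in T1; [|apply Cmult_comm].
  exact (is_pseries_plus (V := C_NormedModule) _ _ _ _ _ T1 T2).
Qed.

Lemma hext_taylor_0 (g : nat -> R) : exp_bounded g -> g 0%nat = 0 ->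
  taylor_at (hext g) (RtoC 0) (fun m => Csum (fun k => (RtoC (g (S k)) * pcoef (RtoC 0) (2 * k) m)%C)).
Proof.
  intros H G0. exists 1. split; [lra|]. intros z Hz.
  set (w := (z - RtoC 0)%C) in *. assert (Ez : z = (RtoC 0 + w)%C) by (unfold w; ring).
  pose proof (even_series_taylor (fun k => g (S k)) (RtoC 0) w (exp_bounded_shift g H) ltac:(lra)) as T2.
  replace (hext g z) with (Csum (fun k => (RtoC (g (S k)) * ((RtoC 0 + w) ^ 2) ^ k)%C)); [exact T2|].
  rewrite <- Ez. destruct (Ceq_dec z (RtoC 0)) as [E|E].
  - unfold hext. destruct (Ceq_dec z (RtoC 0)); [|contradiction]. rewrite E.
    rewrite (Csum_incr_1 (fun k => g (S k))) by now apply exp_bounded_shift. ring.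
  - rewrite hext_nz, G0 by exact E. field. exact E.
Qed.

(** Relates the first Taylor coefficient at a zero to [F' (z0^2) = sum_k (k+1) g (k+1) z0^(2k)]. *)
Lemma hext_c1 (g : nat -> R) (z0 : C) : exp_bounded g -> z0 <> RtoC 0 -> hext g z0 = RtoC 0 ->
  (z0 * hext_c g z0 1 = 2 * Csum (fun k => RtoC ((INR k + 1) * g (S k)) * (z0 ^ 2) ^ k))%C.
Proof.
  intros H Hz E0. pose proof (exp_bounded_shift g H) as H1.
  assert (Hk : exp_bounded (fun k => INR k * g (S k))).
  { destruct H1 as (M & c & HM & Hc & B). exists M, (2 * c). split; [exact HM|]. split; [lra|].
    intros k. rewrite Rabs_mult, (Rabs_pos_eq (INR k)), Rpow_mult_distr by apply pos_INR.
    assert (K : INR k <= 2 ^ k).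
    { clear. induction k as [|k IH]; [simpl; lra|]. rewrite S_INR. simpl. assert (1 <= 2 ^ k) by (apply pow_R1_Rle; lra). lra. }
    replace (M * (2 ^ k * c ^ k) / INR (fact k)) with (2 ^ k * (M * c ^ k / INR (fact k))) by (unfold Rdiv; ring).
    apply Rmult_le_compat; [apply pos_INR|apply Rabs_pos|exact K|apply B]. }
  pose proof (is_Cseries_pow _ (z0 ^ 2)%C Hk) as S1. pose proof (is_Cseries_pow _ (z0 ^ 2)%C H1) as S2.
  assert (A : Csum (fun k => RtoC ((INR k + 1) * g (S k)) * (z0 ^ 2) ^ k)%C
     = (Csum (fun k => RtoC (INR k * g (S k)) * (z0 ^ 2) ^ k) + Csum (fun k => RtoC (g (S k)) * (z0 ^ 2) ^ k))%C).
  { apply Csum_unique. eapply is_series_ext; [|exact (is_series_plus (V := C_NormedModule) _ _ _ _ S1 S2)].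
    intros k. change ((RtoC (INR k * g (S k)) * (z0 ^ 2) ^ k + RtoC (g (S k)) * (z0 ^ 2) ^ k)%C
      = (RtoC ((INR k + 1) * g (S k)) * (z0 ^ 2) ^ k)%C). rewrite !RtoC_mult, RtoC_plus. ring. }
  assert (B : (z0 * Csum (fun k => RtoC (g (S k)) * pcoef z0 (2 * k) 1) = 2 * Csum (fun k => RtoC (INR k * g (S k)) * (z0 ^ 2) ^ k))%C).
  { apply (is_series_scal (V := C_NormedModule) (2 / z0)%C) in S1.
    assert (Q : Csum (fun k => RtoC (g (S k)) * pcoef z0 (2 * k) 1)%C = (2 / z0 * Csum (fun k => RtoC (INR k * g (S k)) * (z0 ^ 2) ^ k))%C).
    { apply Csum_unique. eapply is_series_ext; [|exact S1]. intros k.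
      change ((2 / z0 * (RtoC (INR k * g (S k)) * (z0 ^ 2) ^ k))%C = (RtoC (g (S k)) * pcoef z0 (2 * k) 1)%C).
      replace (pcoef z0 (2 * k) 1) with (z0 * pcoef z0 (2 * k) 1 / z0)%C by (field; exact Hz).
      rewrite pcoef_1, mult_INR, <- Cpow_mult_r, !RtoC_mult. simpl (INR 2). rewrite RtoC_plus. field. exact Hz. }
    rewrite Q. field. exact Hz. }
  rewrite hext_nz in E0 by exact Hz.
  set (S0 := Csum (fun k => RtoC (g (S k)) * (z0 ^ 2) ^ k)%C) in *.
  rewrite A. unfold hext_c. rewrite Cmult_plus_distr_l, B.
  replace (RtoC ((-1) ^ 1 * (INR 1 + 1))) with (- RtoC 2)%C by (simpl; rewrite <- RtoC_opp; f_equal; ring).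
  replace S0 with (- (RtoC (g 0%nat) / z0 ^ 2))%C by (replace S0 with (RtoC (g 0%nat) / z0 ^ 2 + S0 - RtoC (g 0%nat) / z0 ^ 2)%C by ring; rewrite E0; ring).
  replace (1 + 2)%nat with 3%nat by reflexivity. field. exact Hz.
Qed.

(** If [c k] were the first nonzero coefficient, then at a zero [z0 + w] the term [|c k| |w|^k]
    would be at most the tail of the series, which is of order [|w|^(k+1)]; for small [w] this is
    impossible. *)
Lemma isolated_zeros (d : C -> C) (z0 : C) (c : nat -> C) :
  taylor_at d z0 c ->
  (forall e, 0 < e -> exists z, z <> z0 /\ Cmod (z - z0) < e /\ d z = RtoC 0) ->
  forall k, c k = RtoC 0.
Proof.
  intros [eps [He H]] Hac.
  set (rho := eps / 2). assert (Hrho : 0 < rho) by (unfold rho; lra).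
  (* A Cauchy-type estimate: the partial sums at radius [rho] converge, hence they are bounded, and
     so are their differences. *)
  assert (HM : exists M, 0 <= M /\ forall k, Cmod (c k) * rho ^ k <= M).
  { specialize (H (z0 + RtoC rho)%C). replace (z0 + RtoC rho - z0)%C with (RtoC rho) in H by ring.
    rewrite Cmod_R, Rabs_pos_eq in H by lra. specialize (H ltac:(unfold rho; lra)).
    set (a := fun k => (RtoC rho ^ k * c k)%C).
    destruct (filterlim_bounded (K := C_AbsRing) (V := C_NormedModule) (@sum_n C_NormedModule a)) as [M HM].
    - eexists. eapply (is_series_ext (V := C_NormedModule)); [|exact H]. intros k. unfold a. now rewrite <- pow_n_Cpow.
    - assert (Ha : forall k, Cmod (a k) <= 2 * M).
      { intros [|k].
        - specialize (HM 0%nat). rewrite sum_O in HM. change (Cmod (a 0%nat) <= M) in HM. pose proof (Cmod_ge_0 (a 0%nat)). lra.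
        - pose proof (HM k) as H1. pose proof (HM (S k)) as H2. rewrite sum_Sn in H2.
          set (s := @sum_n C_NormedModule a k) in *.
          change (Cmod s <= M) in H1. change (Cmod (s + a (S k)) <= M) in H2.
          replace (a (S k)) with ((s + a (S k)) + - s)%C by ring.
          eapply Rle_trans; [apply Cmod_triangle|]. rewrite Cmod_opp. lra. }
      exists (2 * M). assert (Q : forall k, Cmod (c k) * rho ^ k <= 2 * M).
      { intros k. specialize (Ha k). unfold a in Ha.
        rewrite Cmod_mult, Cmod_pow, Cmod_R, (Rabs_pos_eq rho) in Ha by lra. lra. }
      split; [|exact Q]. eapply Rle_trans; [|apply (Q 0%nat)]. apply Rmult_le_pos; [apply Cmod_ge_0|apply pow_le; lra]. }
  destruct HM as [M [HM0 HM]].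
  apply (well_founded_induction Wf_nat.lt_wf). intros k IH.
  destruct (Ceq_dec (c k) (RtoC 0)) as [E|E]; [exact E|exfalso].
  assert (Pc : 0 < Cmod (c k)) by now apply Cmod_gt_0.
  assert (Pr : 0 < rho ^ S k) by now apply pow_lt.
  (* The first bound makes [q = |w| / rho] less than 1/2, so the geometric tail is at most
     [2 M q^(k+1)]; the second makes this smaller than [|c k| |w|^k]. *)
  set (e := Rmin (rho / 2) (Cmod (c k) * rho ^ S k / (2 * M + 1))).
  assert (Pe : 0 < e).
  { apply Rmin_glb_lt; [lra|]. apply Rdiv_lt_0_compat; [now apply Rmult_lt_0_compat|lra]. }
  destruct (Hac e Pe) as (z & Hne & Hze & Hz).
  set (w := (z - z0)%C) in *.
  assert (Pw : 0 < Cmod w).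
  { apply Cmod_gt_0. intros Ew. apply Hne. replace z with (z0 + w)%C by (unfold w; ring). rewrite Ew. ring. }
  assert (W1 : Cmod w < rho / 2) by (eapply Rlt_le_trans; [exact Hze|apply Rmin_l]).
  assert (W2 : Cmod w < Cmod (c k) * rho ^ S k / (2 * M + 1)) by (eapply Rlt_le_trans; [exact Hze|apply Rmin_r]).
  specialize (H z). fold w in H. specialize (H ltac:(unfold rho in *; lra)). rewrite Hz in H.
  set (q := Cmod w / rho).
  assert (Hq : 0 < q < / 2).
  { unfold q. split; [now apply Rdiv_lt_0_compat|]. apply Rmult_lt_reg_r with rho; [exact Hrho|].
    unfold Rdiv. rewrite Rmult_assoc, Rinv_l by lra. lra. }
  assert (SB : is_series (fun j => M * q ^ j) (M * / (1 - q))).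
  { apply (is_series_scal (V := R_NormedModule) M). apply is_series_geom. rewrite Rabs_pos_eq; lra. }
  assert (H' : is_Cseries (fun j => (w ^ j * c j)%C) (RtoC 0)).
  { eapply is_series_ext; [|exact H]. intros j. now rewrite pow_n_Cpow. }
  pose proof (series_tail_le (V := C_NormedModule) (fun j => (w ^ j * c j)%C) (RtoC 0) (fun j => M * q ^ j) _ k H' SB) as T.
  assert (Bj : forall j, Cmod (w ^ j * c j) <= M * q ^ j).
  { intros j. rewrite Cmod_mult, Cmod_pow. unfold q. unfold Rdiv. rewrite Rpow_mult_distr, pow_inv.
    specialize (HM j). assert (0 < rho ^ j) by now apply pow_lt.
    apply Rmult_le_reg_r with (rho ^ j); [assumption|].
    replace (M * (Cmod w ^ j * / rho ^ j) * rho ^ j) with (Cmod w ^ j * M) by (field; lra).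
    rewrite Rmult_assoc. apply Rmult_le_compat_l; [apply pow_le, Cmod_ge_0|exact HM]. }
  specialize (T Bj).
  assert (Sk : @sum_n C_NormedModule (fun j => (w ^ j * c j)%C) k = (w ^ k * c k)%C).
  { destruct k as [|k]; [apply sum_O|]. rewrite sum_Sn.
    replace (@sum_n C_NormedModule (fun j => (w ^ j * c j)%C) k) with (RtoC 0); [apply Cplus_0_l|].
    symmetry. clear - IH. assert (Q : forall n, (n <= k)%nat -> @sum_n C_NormedModule (fun j => (w ^ j * c j)%C) n = RtoC 0).
    { induction n as [|n In]; intros Hn; [rewrite sum_O, IH by lia; apply Cmult_0_r|].
      rewrite sum_Sn, In, IH, Cmult_0_r by lia. apply Cplus_0_l. }
    apply Q. lia. }
  rewrite Sk in T.
  assert (SBk : sum_n (fun j => M * q ^ j) k = M * ((1 - q ^ S k) / (1 - q))).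
  { clear - Hq. induction k as [|k IH]; [rewrite sum_O; simpl; field; lra|].
    rewrite sum_Sn, IH. change plus with Rplus. simpl. field. lra. }
  rewrite SBk in T.
  change (Cmod (RtoC 0 - w ^ k * c k) <= M * / (1 - q) - M * ((1 - q ^ S k) / (1 - q))) in T.
  replace (RtoC 0 - w ^ k * c k)%C with (- (w ^ k * c k))%C in T by ring.
  rewrite Cmod_opp, Cmod_mult, Cmod_pow in T.
  replace (M * / (1 - q) - M * ((1 - q ^ S k) / (1 - q))) with (M * q ^ S k * / (1 - q)) in T by (field; lra).
  assert (I1 : / (1 - q) <= 2) by (replace 2 with (/ / 2) by lra; apply Rinv_le_contravar; lra).
  assert (Pq : 0 <= M * q ^ S k) by (apply Rmult_le_pos; [exact HM0|apply pow_le; lra]).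
  assert (T2 : Cmod w ^ k * Cmod (c k) <= M * q ^ S k * 2) by (eapply Rle_trans; [exact T|now apply Rmult_le_compat_l]).
  assert (Eq : q ^ S k * rho ^ S k = Cmod w ^ S k) by (unfold q; rewrite <- Rpow_mult_distr; f_equal; field; lra).
  assert (Pwk : 0 < Cmod w ^ k) by now apply pow_lt.
  assert (T3 : Cmod w ^ k * (Cmod (c k) * rho ^ S k) <= Cmod w ^ k * (2 * M * Cmod w)).
  { apply Rmult_le_compat_r with (r := rho ^ S k) in T2; [|lra].
    replace (M * q ^ S k * 2 * rho ^ S k) with (M * 2 * (q ^ S k * rho ^ S k)) in T2 by ring.
    rewrite Eq in T2. simpl in T2 |- *. lra. }
  apply Rmult_le_reg_l in T3; [|exact Pwk].
  apply Rmult_lt_compat_r with (r := 2 * M + 1) in W2; [|lra].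
  unfold Rdiv in W2. rewrite Rmult_assoc, Rinv_l, Rmult_1_r in W2 by lra. lra.
Qed.

Lemma zero_near (d : C -> C) (z0 : C) :
  analytic_at d z0 ->
  (forall e, 0 < e -> exists z, z <> z0 /\ Cmod (z - z0) < e /\ d z = RtoC 0) ->
  exists e, 0 < e /\ forall z, Cmod (z - z0) < e -> d z = RtoC 0.
Proof.
  intros [c T] Hac. pose proof (isolated_zeros d z0 c T Hac) as Z.
  destruct T as [e [He H]]. exists e. split; [exact He|]. intros z Hz. specialize (H z Hz).
  apply Csum_unique in H. rewrite <- H. unfold Csum.
  apply injective_projections; simpl; rewrite (Series_ext _ (fun k => 0 * 0)); try (rewrite Series_scal_l; ring);
  intros k; rewrite Z; change (fst (@pow_n C_Ring (z - z0)%C k * RtoC 0)%C = 0 * 0) ||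
    change (snd (@pow_n C_Ring (z - z0)%C k * RtoC 0)%C = 0 * 0); rewrite Cmult_0_r; simpl; ring.
Qed.

(** Let [T] be the supremum of the parameters up to which [d] vanishes on the segment from 1. Zeros
    accumulate at [T], so [d] vanishes in a disk around that point, and [T] can only be 1. When
    [T = 0] the accumulating zeros are taken on the positive axis. *)
Lemma zero_along_segment (d : C -> C) (z : C) :
  (forall t, 0 <= t <= 1 -> analytic_at d (1 + RtoC t * (z - 1))%C) ->
  z <> RtoC 1 -> (forall x, 0 < x -> d (RtoC x) = RtoC 0) -> d z = RtoC 0.
Proof.
  intros Han Hz1 Hpos.
  set (ga := fun t => (1 + RtoC t * (z - 1))%C) in *.
  assert (Pz : 0 < Cmod (z - 1)).
  { apply Cmod_gt_0. intros E. apply Hz1. replace z with (z - 1 + 1)%C by ring. rewrite E. ring. }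
  assert (dist : forall s t, Cmod (ga s - ga t) = Rabs (s - t) * Cmod (z - 1)).
  { intros s t. unfold ga. replace (1 + RtoC s * (z - 1) - (1 + RtoC t * (z - 1)))%C with (RtoC (s - t) * (z - 1))%C
      by (rewrite RtoC_minus; ring). now rewrite Cmod_mult, Cmod_R. }
  assert (inj : forall s t, s <> t -> ga s <> ga t).
  { intros s t Hst E. pose proof (dist s t) as D. rewrite E in D. replace (ga t - ga t)%C with (RtoC 0) in D by ring.
    rewrite Cmod_0 in D. symmetry in D. apply Rmult_integral in D. destruct D as [D|D]; [|lra].
    apply Rabs_eq_0 in D. lra. }
  pose (E := fun t => 0 <= t <= 1 /\ forall s, 0 <= s <= t -> d (ga s) = RtoC 0).
  assert (ga0 : ga 0 = RtoC 1) by (unfold ga; ring).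
  assert (E0 : E 0).
  { split; [lra|]. intros s Hs. replace s with 0 by lra. rewrite ga0. apply Hpos. lra. }
  destruct (completeness E) as [T [HT1 HT2]].
  { exists 1. intros t [Ht _]. lra. }
  { now exists 0. }
  assert (HT : 0 <= T <= 1) by (split; [apply HT1, E0|apply HT2; intros t [Ht _]; lra]).
  assert (below : forall s, 0 <= s < T -> d (ga s) = RtoC 0).
  { intros s Hs. destruct (classic (exists t, E t /\ s < t)) as [[t [Et Hst]]|N].
    - apply Et. lra.
    - exfalso. assert (T <= s); [|lra]. apply HT2. intros t Et. destruct (Rle_dec t s); [assumption|]. exfalso. apply N. exists t. split; [exact Et|lra]. }
  destruct (zero_near d (ga T) (Han T HT)) as [e [He Hnear]].
  { intros e He. destruct (Req_dec T 0) as [->|HT0].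
    - rewrite ga0. exists (RtoC (1 + e / 2)). split; [|split].
      + intros Q. apply RtoC_inj in Q. lra.
      + rewrite <- RtoC_minus, Cmod_R, Rabs_pos_eq; lra.
      + apply Hpos. lra.
    - set (dl := Rmin (T / 2) (e / (2 * Cmod (z - 1)))).
      assert (Pd : 0 < dl) by (apply Rmin_glb_lt; [lra|apply Rdiv_lt_0_compat; lra]).
      pose proof (Rmin_l (T / 2) (e / (2 * Cmod (z - 1)))) as D1. pose proof (Rmin_r (T / 2) (e / (2 * Cmod (z - 1)))) as D2. fold dl in D1, D2.
      exists (ga (T - dl)). split; [apply inj; lra|]. split; [|apply below; lra].
      rewrite dist. replace (T - dl - T) with (- dl) by ring. rewrite Rabs_Ropp, Rabs_pos_eq by lra.
      apply Rle_lt_trans with (e / (2 * Cmod (z - 1)) * Cmod (z - 1)); [apply Rmult_le_compat_r; lra|].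
      replace (e / (2 * Cmod (z - 1)) * Cmod (z - 1)) with (e / 2) by (field; lra). lra. }
  set (dl := e / (2 * Cmod (z - 1))).
  assert (Pd : 0 < dl) by (apply Rdiv_lt_0_compat; lra).
  assert (ext : forall s, T <= s <= T + dl -> d (ga s) = RtoC 0).
  { intros s Hs. apply Hnear. rewrite dist, Rabs_pos_eq by lra.
    apply Rle_lt_trans with (dl * Cmod (z - 1)); [apply Rmult_le_compat_r; lra|].
    unfold dl. replace (e / (2 * Cmod (z - 1)) * Cmod (z - 1)) with (e / 2) by (field; lra). lra. }
  assert (T1 : T = 1).
  { destruct (Req_dec T 1) as [Q|Q]; [exact Q|exfalso].
    assert (EE : E (Rmin 1 (T + dl))).
    { assert (0 <= Rmin 1 (T + dl)) by (apply Rmin_glb; lra). pose proof (Rmin_l 1 (T + dl)). pose proof (Rmin_r 1 (T + dl)).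
      split; [lra|]. intros s Hs. destruct (Rlt_dec s T); [apply below; lra|apply ext; lra]. }
    apply HT1 in EE. assert (T < Rmin 1 (T + dl)) by (apply Rmin_glb_lt; lra). lra. }
  replace z with (ga 1) by (unfold ga; ring). apply ext. lra.
Qed.

(** The segment from 1 to a nonreal point avoids the origin, where [d] may be singular. Real points,
    and the origin if [d] is analytic there, are then accumulation points of nonreal zeros. *)
Lemma identity_theorem (d : C -> C) :
  (forall z, z <> RtoC 0 -> analytic_at d z) -> (forall x, 0 < x -> d (RtoC x) = RtoC 0) ->
  forall z, z <> RtoC 0 \/ analytic_at d z -> d z = RtoC 0.
Proof.
  intros Han Hpos.
  assert (A : forall z, snd z <> 0 -> d z = RtoC 0).
  { intros z Hz. apply zero_along_segment; [|intros ->; apply Hz; reflexivity|exact Hpos].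
    intros t Ht. apply Han. intros E. destruct (Req_dec t 0) as [->|Ht0].
    - apply (f_equal fst) in E. simpl in E. lra.
    - apply (f_equal snd) in E. simpl in E. apply Hz. apply Rmult_eq_reg_l with t; lra. }
  intros z Hz.
  destruct (zero_near d z) as [e [He H]].
  - destruct Hz as [Hz|Hz]; [now apply Han|exact Hz].
  - intros e He. 
    assert (Q : exists y, snd z + y <> 0 /\ y <> 0 /\ Rabs y < e).
    { destruct (Req_dec (snd z + e / 2) 0) as [Q|Q].
      - exists (e / 3). split; [lra|]. split; [lra|]. rewrite Rabs_pos_eq; lra.
      - exists (e / 2). split; [exact Q|]. split; [lra|]. rewrite Rabs_pos_eq; lra. }
    destruct Q as (y & Q1 & Q2 & Q3).
    exists (fst z, snd z + y). split; [|split].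
    + intros Ez. apply (f_equal snd) in Ez. simpl in Ez. lra.
    + replace (((fst z, (snd z + y)%R) : C) - z)%C with (RtoC y * Ci)%C.
      * rewrite Cmod_mult, Cmod_R. replace (Cmod Ci) with 1; [lra|]. unfold Cmod, Ci; simpl.
        replace (0 * (0 * 1) + 1 * (1 * 1)) with 1 by ring. now rewrite sqrt_1.
      * apply injective_projections; simpl; ring.
    + apply A. exact Q1.
  - apply H. replace (z - z)%C with (RtoC 0) by ring. now rewrite Cmod_0.
Qed.

Lemma analytic_minus (f g : C -> C) (z : C) : analytic_at f z -> analytic_at g z -> analytic_at (fun z => f z - g z)%C z.
Proof.
  intros [c [e1 [H1 T1]]] [c' [e2 [H2 T2]]]. exists (PS_minus (V := C_NormedModule) c c'), (Rmin e1 e2).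
  split; [now apply Rmin_glb_lt|]. intros w Hw.
  apply (is_pseries_minus (V := C_NormedModule)).
  - apply T1. eapply Rlt_le_trans; [exact Hw|apply Rmin_l].
  - apply T2. eapply Rlt_le_trans; [exact Hw|apply Rmin_r].
Qed.

Lemma taylor_at_ext (f g : C -> C) (z0 : C) (c : nat -> C) (e : R) : 0 < e ->
  (forall z, Cmod (z - z0) < e -> f z = g z) -> taylor_at f z0 c -> taylor_at g z0 c.
Proof.
  intros He H [e1 [H1 T1]]. exists (Rmin e e1). split; [now apply Rmin_glb_lt|].
  intros z Hz. rewrite <- H.
  - apply T1. eapply Rlt_le_trans; [exact Hz|apply Rmin_r].
  - eapply Rlt_le_trans; [exact Hz|apply Rmin_l].
Qed.

(** * Zeros of the cross product *)

(** The Wronskian of [U] and [y |-> phi (x exp y)] is constant in [y]. *)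
Lemma bessel_transfer (nu de x0 X x : R) (phi g : R -> R) : bessel_pair nu phi g -> 0 < x ->
  let U := usol nu de x0 (x ^ 2) X in
  let tX := x * exp X in let t0 := x * exp x0 in
  U * (nu * phi tX - tX * g tX - de * phi tX) - fsol nu de x0 (x ^ 2) X * phi tX
  = nu * phi t0 - t0 * g t0 - de * phi t0.
Proof.
  intros HB Hx U tX t0. unfold U. clear U.
  pose (W := fun y => usol nu de x0 (x ^ 2) y * (nu * phi (x * exp y) - x * exp y * g (x * exp y))
     - (fsol nu de x0 (x ^ 2) y + de * usol nu de x0 (x ^ 2) y) * phi (x * exp y)).
  assert (E : W X = W x0).
  { apply derive_zero_const. intros y.
    assert (Pt : 0 < x * exp y) by (apply Rmult_lt_0_compat; [exact Hx|apply exp_pos]).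
    destruct (HB _ Pt) as [D1 D2].
    pose proof (is_derive_usol nu de x0 (x ^ 2) y) as D3. pose proof (is_derive_fsol nu de x0 (x ^ 2) y) as D4.
    set (u := usol nu de x0 (x ^ 2)) in *. set (v := fsol nu de x0 (x ^ 2)) in *.
    unfold W. auto_derive; [repeat split; eexists; eassumption|].
    known_derive.
    replace (exp (2 * y)) with (exp y * exp y) by (rewrite <- exp_plus; f_equal; ring).
    pose proof (exp_pos y). field. split; lra. }
  unfold W in E. rewrite usol_x0, fsol_x0 in E. fold tX t0 in E. lra.
Qed.

(** With [T phi = t phi' - de phi], the transfer identity reads
    [T phi (t0) = u T phi (tX) - f phi (tX)] for [J] and for [Y]. In the determinant
    [TJ(tX) TY(t0) - TJ(t0) TY(tX)] the terms with [u] cancel, leaving [f] times the Wronskian. The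
    divisor [a b x^2] is the product of the two values of [t]. *)
Lemma h_real_fsol (a b nu de : R) : 0 < b -> b < a -> 0 <= nu ->
  exists K, K <> 0 /\ forall x, 0 < x ->
    h_real a b nu de x = K * fsol nu de (ln b) (x ^ 2) (ln a) / x ^ 2.
Proof.
  intros Hb Hab Hnu. destruct (besselY_pair nu Hnu) as (Y1 & K & HK & HY & HW).
  exists (K / (a * b)). split.
  { apply Rmult_integral_contrapositive_currified; [exact HK|]. apply Rinv_neq_0_compat. apply Rgt_not_eq. nra. }
  intros x Hx.
  pose proof (bessel_transfer nu de (ln b) (ln a) x _ _ (besselJ_pair nu) Hx) as TJ.
  pose proof (bessel_transfer nu de (ln b) (ln a) x _ _ HY Hx) as TY.
  cbv zeta in TJ, TY. rewrite !exp_ln, !(Rmult_comm x) in TJ, TY by lra.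
  assert (Pa : 0 < a * x) by nra. assert (Pb : 0 < b * x) by nra.
  pose proof (HW _ Pa) as W.
  set (u := usol nu de (ln b) (x ^ 2) (ln a)) in *. set (F := fsol nu de (ln b) (x ^ 2) (ln a)) in *.
  unfold h_real, besselJ', besselY'.
  destruct (besselJ_pair nu _ Pa) as [DJa _]. destruct (besselJ_pair nu _ Pb) as [DJb _].
  destruct (HY _ Pa) as [DYa _]. destruct (HY _ Pb) as [DYb _].
  rewrite (is_derive_unique _ _ _ DJa), (is_derive_unique _ _ _ DJb), (is_derive_unique _ _ _ DYa), (is_derive_unique _ _ _ DYb).
  set (Ja := besselJ nu (a * x)) in *. set (Jb := besselJ nu (b * x)) in *.
  set (Ja1 := besselJ (nu + 1) (a * x)) in *. set (Jb1 := besselJ (nu + 1) (b * x)) in *.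
  set (Ya := besselY nu (a * x)) in *. set (Yb := besselY nu (b * x)) in *.
  set (Ya1 := Y1 (a * x)) in *. set (Yb1 := Y1 (b * x)) in *.
  apply Rmult_eq_reg_l with (a * b * x ^ 2); [|apply Rgt_not_eq; simpl; assert (0 < a * b) by nra; nra].
  transitivity ((nu * Ja - a * x * Ja1 - de * Ja) * (nu * Yb - b * x * Yb1 - de * Yb)
     - (nu * Jb - b * x * Jb1 - de * Jb) * (nu * Ya - a * x * Ya1 - de * Ya)).
  - field. repeat split; lra.
  - rewrite <- TJ, <- TY. rewrite <- W. field. repeat split; lra.
Qed.

Lemma Csum_real (a : nat -> R) (l : R) :
  Csum (fun k => RtoC (a k) * RtoC l ^ k)%C = RtoC (Series (fun k => l ^ k * a k)).
Proof.
  unfold Csum, RtoC. f_equal.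
  - apply Series_ext. intros k. fold (RtoC l). rewrite <- RtoC_pow. simpl. ring.
  - rewrite (Series_ext _ (fun k => 0 * 0)); [rewrite Series_scal_l; ring|].
    intros k. fold (RtoC l). rewrite <- RtoC_pow. simpl. ring.
Qed.

(** * From eigenvalues to the zeros in the disk *)

Definition csqrt (l : R) : C := if Rle_dec 0 l then RtoC (sqrt l) else (0, sqrt (- l)).

Lemma csqrt_sq (l : R) : (csqrt l ^ 2 = RtoC l)%C.
Proof.
  unfold csqrt. destruct (Rle_dec 0 l) as [H|H].
  - rewrite <- RtoC_pow. f_equal. now apply pow2_sqrt.
  - pose proof (sqrt_sqrt (- l) ltac:(lra)). apply injective_projections; simpl; nra.
Qed.

Lemma square_roots (l : R) (z : C) : (z ^ 2 = RtoC l)%C <-> z = csqrt l \/ z = (- csqrt l)%C.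
Proof.
  pose proof (csqrt_sq l) as S. split.
  - intros E. destruct (Ceq_dec (z - csqrt l)%C (RtoC 0)) as [Q|Q].
    + left. replace z with (z - csqrt l + csqrt l)%C by ring. rewrite Q. ring.
    + right. assert (P : ((z - csqrt l) * (z + csqrt l) = RtoC 0)%C).
      { replace ((z - csqrt l) * (z + csqrt l))%C with (z ^ 2 - csqrt l ^ 2)%C by ring. rewrite E, S. ring. }
      assert (P2 : (z + csqrt l = RtoC 0)%C).
      { replace (z + csqrt l)%C with (/ (z - csqrt l) * ((z - csqrt l) * (z + csqrt l)))%C by (field; exact Q). rewrite P. ring. }
      replace z with (z + csqrt l - csqrt l)%C by ring. rewrite P2. ring.
  - intros [-> | ->]; [exact S|]. rewrite <- S. ring.
Qed.

(** Both square roots of each eigenvalue, with multiplicity one. They are distinct provided 0 is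
    kept out of [l]. *)
Definition zero_list (l : list R) : list (C * nat) :=
  flat_map (fun lam => (csqrt lam, 1%nat) :: ((- csqrt lam)%C, 1%nat) :: nil) l.

Lemma zero_list_in (l : list R) (z : C) :
  In z (map fst (zero_list l)) <-> exists lam, In lam l /\ (z ^ 2 = RtoC lam)%C.
Proof.
  induction l as [|a l IH]; simpl.
  - split; [easy|]. now intros [lam [[] _]].
  - rewrite IH. split.
    + intros [H|[H|[lam [H1 H2]]]].
      * exists a. split; [now left|]. apply square_roots. now left.
      * exists a. split; [now left|]. apply square_roots. now right.
      * exists lam. split; [now right|exact H2].
    + intros [lam [[<-|H1] H2]].
      * apply square_roots in H2. destruct H2 as [-> | ->]; [now left|right; now left].
      * right. right. now exists lam.
Qed.

Lemma zero_list_nodup (l : list R) : NoDup l -> ~ In 0 l -> NoDup (map fst (zero_list l)).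
Proof.
  induction l as [|a l IH]; intros N Z; [constructor|]. inversion N as [|? ? Na Nl]; subst.
  assert (sq : forall z, (z ^ 2 = RtoC a)%C -> ~ In z (map fst (zero_list l))).
  { intros z Hz Hin. apply zero_list_in in Hin. destruct Hin as [lam [H1 H2]]. rewrite Hz in H2.
    apply RtoC_inj in H2. subst. contradiction. }
  simpl. constructor; [|constructor].
  - intros [H|H].
    + assert (E : csqrt a = RtoC 0).
      { replace (csqrt a) with (RtoC (1 / 2) * (csqrt a - - csqrt a))%C by (apply injective_projections; simpl; field).
        rewrite H. ring. }
      apply Z. left. apply RtoC_inj. rewrite <- csqrt_sq, E. ring.
    + revert H. apply sq, csqrt_sq.
  - apply sq. apply square_roots. now right.
  - apply IH; [exact Nl|]. intros H. apply Z. now right.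
Qed.

Lemma zero_list_sum (l : list R) : list_sum (map snd (zero_list l)) = (2 * length l)%nat.
Proof. induction l as [|a l IH]; [reflexivity|]. simpl in *. rewrite IH. lia. Qed.

Lemma zero_list_mult (l : list R) (z : C) (m : nat) : In (z, m) (zero_list l) -> m = 1%nat.
Proof.
  induction l as [|a l IH]; simpl; [easy|]. intros [H|[H|H]]; [now injection H|now injection H|now apply IH].
Qed.

Section Assembly.
Variables (a b nu de K : R).
Hypothesis Hb : 0 < b.
Hypothesis Hab : b < a.
Hypothesis Hnu : 0 <= nu.
Hypothesis HK : K <> 0.
Hypothesis Hreal : forall x, 0 < x -> h_real a b nu de x = K * fsol nu de (ln b) (x ^ 2) (ln a) / x ^ 2.
Let x0 := ln b.
Let X := ln a.

Definition gco (k : nat) : R := K * ff nu de x0 k X.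
Notation H := (hext gco).

Lemma ln_ab : x0 < X.
Proof. apply ln_increasing; lra. Qed.

Lemma exp_bounded_gco : exp_bounded gco.
Proof.
  destruct (exp_bounded_ff nu de x0 X) as (M & c & HM & Hc & B).
  pose proof (Rabs_pos K). exists (Rabs K * M), c. split; [now apply Rmult_le_pos|]. split; [exact Hc|].
  intros k. unfold gco. rewrite Rabs_mult. unfold Rdiv. rewrite !Rmult_assoc in *. 
  apply Rmult_le_compat_l; [assumption|]. specialize (B k). unfold Rdiv in B. rewrite Rmult_assoc in B. exact B.
Qed.

Lemma Series_gco (c : nat -> R) : Series (fun k => c k * gco k) = K * Fs nu de x0 c X.
Proof. unfold Fs. rewrite <- Series_scal_l. apply Series_ext. intros k. unfold gco. ring. Qed.

Lemma hext_real (z : C) (lam : R) : z <> RtoC 0 -> (z ^ 2 = RtoC lam)%C ->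
  (z ^ 2 * H z = RtoC (K * fsol nu de x0 lam X))%C.
Proof.
  intros Hz E. rewrite (hext_eq gco z exp_bounded_gco Hz), E, Csum_real. f_equal.
  apply (Series_gco (fun k => lam ^ k)).
Qed.

Lemma gco_0 : gco 0 = 0 <-> nu = Rabs de.
Proof.
  rewrite <- (ff0_zero nu de x0 X Hnu ln_ab). unfold gco. split; intros E.
  - apply Rmult_integral in E. now destruct E.
  - rewrite E. ring.
Qed.

Lemma hext_is_extension : is_h_extension a b nu de H.
Proof.
  split.
  - intros z Hz. destruct (Ceq_dec z (RtoC 0)) as [->|Hne].
    + destruct Hz as [Hz|Hz]; [contradiction|]. eexists. apply hext_taylor_0; [apply exp_bounded_gco|now apply gco_0].
    + eexists. apply hext_taylor; [apply exp_bounded_gco|exact Hne].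
  - intros x Hx.
    assert (Hz : RtoC x <> RtoC 0) by (intros E; apply RtoC_inj in E; lra).
    pose proof (hext_real (RtoC x) (x ^ 2) Hz (eq_sym (RtoC_pow x 2))) as E.
    replace (H (RtoC x)) with (/ RtoC x ^ 2 * (RtoC x ^ 2 * H (RtoC x)))%C by (field; exact Hz).
    rewrite E, Hreal by exact Hx. fold x0 X. unfold Rdiv.
    rewrite <- RtoC_pow, <- RtoC_inv, <- RtoC_mult by (apply pow_nonzero; lra). f_equal. ring.
Qed.

(** [hext gco] witnesses that an extension exists, so the function chosen by [epsilon] is one as
    well; the identity theorem makes the two agree on the domain, including the origin when
    [nu = |delta|]. *)
Lemma h_tilde_hext (z : C) : h_dom nu de z -> h_tilde a b nu de z = H z.
Proof.
  intros Hz.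
  assert (S : is_h_extension a b nu de (h_tilde a b nu de)).
  { unfold h_tilde. apply epsilon_spec. exists H. apply hext_is_extension. }
  destruct S as [S1 S2]. destruct hext_is_extension as [T1 T2].
  replace (h_tilde a b nu de z) with (h_tilde a b nu de z - H z + H z)%C by ring.
  replace (h_tilde a b nu de z - H z)%C with (RtoC 0); [ring|]. symmetry.
  apply (identity_theorem (fun z => h_tilde a b nu de z - H z)%C).
  - intros y Hy. apply analytic_minus; [apply S1|apply T1]; now left.
  - intros x Hx. rewrite S2, T2 by exact Hx. ring.
  - right. apply analytic_minus; [now apply S1|now apply T1].
Qed.

Lemma h_tilde_taylor (z0 : C) : z0 <> RtoC 0 -> taylor_at (h_tilde a b nu de) z0 (hext_c gco z0).
Proof.
  intros Hz. apply (taylor_at_ext H _ z0 _ (Cmod z0)); [now apply Cmod_gt_0| |apply hext_taylor; [apply exp_bounded_gco|exact Hz]].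
  intros z Hw. symmetry. apply h_tilde_hext. left. intros ->.
  replace (RtoC 0 - z0)%C with (- z0)%C in Hw by ring. rewrite Cmod_opp in Hw. lra.
Qed.

Lemma pow_2_neq_0 (z : C) : z <> RtoC 0 -> (z ^ 2)%C <> RtoC 0.
Proof. apply Cpow_nz. Qed.

(** The real and imaginary parts of the powers of [z^2] are weights that satisfy the recurrences of
    [zeros_real], which forces [z^2] to be real at a zero. *)
Lemma hext_zero_iff (z : C) : z <> RtoC 0 ->
  (H z = RtoC 0 <-> exists lam, (z ^ 2 = RtoC lam)%C /\ fsol nu de x0 lam X = 0).
Proof.
  intros Hz. split.
  - intros E. pose proof (hext_eq gco z exp_bounded_gco Hz) as Q. rewrite E, Cmult_0_r in Q.
    set (l := (z ^ 2)%C) in *.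
    assert (Gf : geo (fun k => fst (l ^ k)%C)).
    { exists 1, (Cmod l). repeat split; [lra|apply Cmod_ge_0|]. intros k. rewrite Rmult_1_l, <- Cmod_pow. apply Rabs_fst_le. }
    assert (Gs : geo (fun k => snd (l ^ k)%C)).
    { exists 1, (Cmod l). repeat split; [lra|apply Cmod_ge_0|]. intros k. rewrite Rmult_1_l, <- Cmod_pow. apply Rabs_snd_le. }
    assert (F1 : Fs nu de x0 (fun k => fst (l ^ k)%C) X = 0).
    { apply Rmult_eq_reg_l with K; [|exact HK]. rewrite Rmult_0_r, <- (Series_gco (fun k => fst (l ^ k)%C)).
      apply (f_equal fst) in Q. simpl in Q. rewrite Q. apply Series_ext. intros k. simpl. ring. }
    assert (F2 : Fs nu de x0 (fun k => snd (l ^ k)%C) X = 0).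
    { apply Rmult_eq_reg_l with K; [|exact HK]. rewrite Rmult_0_r, <- (Series_gco (fun k => snd (l ^ k)%C)).
      apply (f_equal snd) in Q. simpl in Q. rewrite Q. apply Series_ext. intros k. simpl. ring. }
    assert (I : snd l = 0).
    { apply (zeros_real nu de x0 (fun k => fst (l ^ k)%C) (fun k => snd (l ^ k)%C) (fst l) (snd l) X ln_ab Gf Gs); trivial; intros k; simpl; ring. }
    exists (fst l). assert (El : l = RtoC (fst l)) by (apply injective_projections; [reflexivity|exact I]).
    split; [exact El|]. rewrite <- F1. unfold fsol, Fs. apply Series_ext. intros k. f_equal.
    rewrite El at 2. now rewrite <- RtoC_pow.
  - intros [lam [E1 E2]]. pose proof (hext_real z lam Hz E1) as Q. rewrite E2, Rmult_0_r in Q.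
    replace (H z) with (/ z ^ 2 * (z ^ 2 * H z))%C by (field; exact Hz). rewrite Q. ring.
Qed.

(** At a zero, [z] times the derivative of the extension is [2 K F'(z^2)], and [F'] does not vanish
    at an eigenvalue. *)
Lemma hext_c1_neq_0 (z : C) (lam : R) : z <> RtoC 0 -> (z ^ 2 = RtoC lam)%C -> fsol nu de x0 lam X = 0 ->
  hext_c gco z 1 <> RtoC 0.
Proof.
  intros Hz E F0 C0.
  assert (H0 : H z = RtoC 0) by (apply hext_zero_iff; [exact Hz|now exists lam]).
  pose proof (hext_c1 gco z exp_bounded_gco Hz H0) as Q. rewrite C0, Cmult_0_r, E, Csum_real in Q.
  rewrite <- RtoC_mult in Q. apply RtoC_inj in Q.
  assert (Fd : K * Fs nu de x0 (dpow lam) X = 0).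
  { rewrite <- Series_gco, Series_incr_1.
    - unfold dpow at 1. simpl INR. rewrite Rmult_0_l, Rmult_0_l, Rplus_0_l.
      transitivity (Series (fun k => lam ^ k * ((INR k + 1) * gco (S k)))); [|lra].
      apply Series_ext. intros k. unfold dpow. rewrite S_INR. simpl pred. ring.
    - unfold gco. apply ex_series_ext_R with (fun k => K * (dpow lam k * ff nu de x0 k X)); [intros; ring|].
      apply ex_series_scal_R. apply ex_series_ff, geo_dpow. }
  apply Rmult_integral in Fd. destruct Fd as [Fd|Fd]; [contradiction|].
  now apply (simple_zero nu de x0 lam X ln_ab F0).
Qed.

(** Here 0 is an eigenvalue, and [gco 1 = K F'(0)] is nonzero by simplicity. It is also the value of
    the extension at the origin, which is therefore no zero. *)
Lemma gco_1_neq_0 : nu = Rabs de -> gco 1 <> 0.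
Proof.
  intros E. apply gco_0 in E.
  assert (F0 : fsol nu de x0 0 X = 0).
  { apply Rmult_eq_reg_l with K; [|exact HK]. rewrite Rmult_0_r. unfold fsol. rewrite <- Series_gco, Series_incr_1.
    - rewrite E, Rmult_0_r, Rplus_0_l. rewrite (Series_ext _ (fun k => 0 * gco (S k))); [rewrite Series_scal_l; ring|].
      intros k. simpl. ring.
    - unfold gco. apply ex_series_ext_R with (fun k => K * (0 ^ k * ff nu de x0 k X)); [intros; ring|].
      apply ex_series_scal_R. apply (ex_series_ff nu de x0 (fun k => 0 ^ k)), geo_pow. }
  pose proof (simple_zero nu de x0 0 X ln_ab F0) as S. intros G1. apply S.
  unfold gco in G1. apply Rmult_integral in G1. destruct G1 as [G1|G1]; [contradiction|].
  unfold Fs. rewrite (Series_ext _ (fun k => 0 * 0)); [rewrite Series_scal_l; ring|].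
  intros [|[|k]]; unfold dpow.
  - simpl. ring.
  - rewrite G1. ring.
  - simpl pred. simpl pow. ring.
Qed.

Lemma fsol_0 : fsol nu de x0 0 X = 0 <-> nu = Rabs de.
Proof.
  rewrite <- (ff0_zero nu de x0 X Hnu ln_ab). unfold fsol, Fs. rewrite Series_incr_1.
  - rewrite (Series_ext _ (fun k => 0 * 0)); [|intros k; simpl; ring]. rewrite Series_scal_l. simpl.
    rewrite Rmult_1_l, Rmult_0_l, Rplus_0_r. reflexivity.
  - apply (ex_series_ff nu de x0 (fun k => 0 ^ k)), geo_pow.
Qed.

(** The list holds only the nonzero eigenvalues. The last hypothesis settles the origin: either it
    is outside the domain or the extension is nonzero there. *)
Lemma count_zeros (w : R) (l : list R) : 0 < w -> NoDup l -> ~ In 0 l ->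
  (forall lam, lam <> 0 -> (In lam l <-> - w ^ 2 < lam < w ^ 2 /\ fsol nu de x0 lam X = 0)) ->
  (nu <> Rabs de \/ gco 1 <> 0) ->
  number_of_zeros (h_tilde a b nu de) (fun z => h_dom nu de z /\ Cmod z < w) (2 * length l).
Proof.
  intros Hw N Z Hl H0. exists (zero_list l).
  assert (nz : forall z lam, In lam l -> (z ^ 2 = RtoC lam)%C -> z <> RtoC 0).
  { intros z lam Hin E ->. apply Z. replace 0 with lam; [exact Hin|]. apply RtoC_inj. rewrite <- E. ring. }
  assert (l0 : forall lam, In lam l -> lam <> 0) by (intros lam Hin ->; contradiction).
  split; [now apply zero_list_nodup|]. split; [|split].
  - intros z. rewrite zero_list_in. split.
    + intros [lam [Hin E]]. pose proof (nz z lam Hin E) as Hz. pose proof (proj1 (Hl lam (l0 lam Hin)) Hin) as [I F0].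
      assert (D : h_dom nu de z) by now left.
      split; [split; [exact D|]|].
      * apply (f_equal Cmod) in E. rewrite Cmod_pow, Cmod_R in E.
        assert (Q : Rabs lam < w ^ 2) by (apply Rabs_def1; lra). rewrite <- E in Q.
        pose proof (Cmod_ge_0 z). nra.
      * rewrite h_tilde_hext by exact D. apply hext_zero_iff; [exact Hz|now exists lam].
    + intros [[D Hzw] E]. rewrite h_tilde_hext in E by exact D.
      destruct (Ceq_dec z (RtoC 0)) as [Ez|Hz].
      * exfalso. subst z. destruct H0 as [H0|H0]; [destruct D as [D|D]; contradiction|].
        unfold hext in E. destruct (Ceq_dec (RtoC 0) (RtoC 0)) as [_|]; [|contradiction]. apply RtoC_inj in E. contradiction.
      * apply hext_zero_iff in E; [|exact Hz]. destruct E as [lam [E1 E2]]. exists lam. split; [|exact E1].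
        assert (lam <> 0). { intros ->. now apply (pow_2_neq_0 z Hz). }
        apply Hl; [assumption|]. split; [|exact E2].
        apply (f_equal Cmod) in E1. rewrite Cmod_pow, Cmod_R in E1.
        assert (Q : Rabs lam < w ^ 2) by (rewrite <- E1; pose proof (Cmod_ge_0 z); nra). apply Rabs_def2 in Q. lra.
  - intros z m Hin. pose proof (zero_list_mult l z m Hin) as ->.
    apply (in_map fst) in Hin. simpl in Hin. apply zero_list_in in Hin. destruct Hin as [lam [Hin E]].
    pose proof (nz z lam Hin E) as Hz. pose proof (proj1 (Hl lam (l0 lam Hin)) Hin) as [I F0].
    split; [lia|]. exists (hext_c gco z). split; [now apply h_tilde_taylor|]. split.
    + intros k Hk. replace k with 0%nat by lia. rewrite (taylor_0 H z (hext_c gco z)) by (apply hext_taylor; [apply exp_bounded_gco|exact Hz]).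
      apply hext_zero_iff; [exact Hz|now exists lam].
    + now apply hext_c1_neq_0 with lam.
  - apply zero_list_sum.
Qed.
End Assembly.

Theorem theorem3p1 (r Ro delta : R) (hr : 0 < r) (hrR : r < Ro) :
  exists K : R, 0 < K /\
    forall nu : R, 0 <= nu ->
    forall s : nat, K * (nu ^ 3 + 1) < INR s ->
      let disk := fun z : C =>
        h_dom nu delta z /\ Cmod z < (INR s + 1 / 2) * PI / (Ro - r) in
      (nu <> Rabs delta ->
         number_of_zeros (h_tilde Ro r nu delta) disk (2 * s + 2)) /\
      (nu = Rabs delta ->
         number_of_zeros (h_tilde Ro r nu delta) disk (2 * s)).
Proof.
  set (L := ln Ro - ln r).
  assert (HL : 0 < L) by (unfold L; pose proof (ln_increasing r Ro hr hrR); lra).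
  set (k0 := Rabs (delta + 1 / 2)). assert (Hk0 : 0 <= k0) by apply Rabs_pos.
  pose proof (Rabs_pos delta) as Hd0.
  (* Since [nu^2 + 1 <= 2 (nu^3 + 1)], the part [4 L + 2 k0] keeps the phase error of [theta_high]
     below 1/2. The summand [Rabs delta] serves the hypothesis of [theta_low], and 1 is slack. The
     factor [Ro - r] put in front of [M] undoes the division in [w]. *)
  set (M := (4 * L + 2 * k0 + Rabs delta + 1) / r).
  assert (HM : 0 < M) by (apply Rdiv_lt_0_compat; lra).
  exists ((Ro - r) * M). split; [apply Rmult_lt_0_compat; lra|].
  intros nu Hnu s Hs disk.
  set (w := (INR s + 1 / 2) * PI / (Ro - r)) in *.
  assert (P3 : 3 < PI) by (pose proof PI2_3_2; lra).
  assert (N3 : 0 <= nu ^ 3) by now apply pow_le.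
  assert (N2 : nu ^ 2 <= nu ^ 3 + 1).
  { destruct (Rle_dec 1 nu); simpl in *; nra. }
  assert (Hw : M * (nu ^ 3 + 1) < w).
  { unfold w. apply Rmult_lt_reg_r with (Ro - r); [lra|].
    replace ((INR s + 1 / 2) * PI / (Ro - r) * (Ro - r)) with ((INR s + 1 / 2) * PI) by (field; lra).
    pose proof (pos_INR s). nra. }
  assert (Hwr : (4 * L + 2 * k0 + Rabs delta + 1) * (nu ^ 3 + 1) < w * r).
  { apply Rmult_lt_compat_r with (r := r) in Hw; [|exact hr].
    replace (M * (nu ^ 3 + 1) * r) with ((4 * L + 2 * k0 + Rabs delta + 1) * (nu ^ 3 + 1)) in Hw by (unfold M; field; lra).
    exact Hw. }
  assert (w0 : 0 < w) by (eapply Rle_lt_trans; [|exact Hw]; apply Rmult_le_pos; lra).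
  destruct (h_real_fsol Ro r nu delta hr hrR Hnu) as [K [HK Hreal]].
  assert (C1 : w * (exp (ln Ro) - exp (ln r)) = (INR s + 1 / 2) * PI) by (rewrite !exp_ln by lra; unfold w; field; lra).
  assert (C2 : (nu ^ 2 + 1) * (ln Ro - ln r) / (w * exp (ln r)) + Rabs (delta + 1 / 2) / (w * exp (ln r)) <= 1 / 2).
  { rewrite exp_ln by lra. fold L k0. assert (P : 0 < w * r) by (apply Rmult_lt_0_compat; lra).
    apply Rmult_le_reg_r with (w * r); [exact P|].
    replace (((nu ^ 2 + 1) * L / (w * r) + k0 / (w * r)) * (w * r)) with ((nu ^ 2 + 1) * L + k0) by (field; lra).
    assert ((nu ^ 2 + 1) * L <= 2 * (nu ^ 3 + 1) * L) by (apply Rmult_le_compat_r; lra).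
    assert (k0 <= k0 * (nu ^ 3 + 1)) by nra. assert (0 <= Rabs delta * (nu ^ 3 + 1)) by (apply Rmult_le_pos; lra). nra. }
  assert (C3 : delta ^ 2 < w ^ 2 * exp (2 * ln r)).
  { replace (2 * ln r) with (ln r + ln r) by ring. rewrite exp_plus, exp_ln by lra.
    replace (w ^ 2 * (r * r)) with ((w * r) ^ 2) by ring. rewrite <- (pow2_abs delta).
    assert (Rabs delta < w * r).
    { eapply Rle_lt_trans; [|exact Hwr]. assert (Rabs delta * 1 <= Rabs delta * (nu ^ 3 + 1)) by (apply Rmult_le_compat_l; lra).
      assert (0 <= (4 * L + 2 * k0 + 1) * (nu ^ 3 + 1)) by (apply Rmult_le_pos; lra). lra. }
    simpl. nra. }
  destruct (real_zeros nu delta (ln r) w (ln Ro) s (ln_increasing r Ro hr hrR) w0 C1 C2 C3) as (l & N & Len & Hl).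
  pose proof (fsol_0 Ro r nu delta hr hrR Hnu) as F0.
  assert (w2 : 0 < w ^ 2) by now apply pow_lt.
  split; intros Hn.
  - replace (2 * s + 2)%nat with (2 * length l)%nat by lia.
    apply (count_zeros Ro r nu delta K hr hrR Hnu HK Hreal w l w0 N).
    + intros Hin. apply Hl in Hin. apply Hn, F0, Hin.
    + intros lam _. apply Hl.
    + now left.
  - assert (Hin : In 0 l) by (apply Hl; split; [lra|now apply F0]).
    (* 0 is one of the [s + 1] eigenvalues, but division by [z^2] cancels it; taken out of the list,
       it leaves [s]. *)
    apply in_split in Hin. destruct Hin as (l1 & l2 & El).
    replace (2 * s)%nat with (2 * length (l1 ++ l2))%nat
      by (rewrite El, length_app in Len; rewrite length_app; simpl in Len; lia).
    apply (count_zeros Ro r nu delta K hr hrR Hnu HK Hreal w (l1 ++ l2) w0).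
    + apply (NoDup_remove_1 l1 l2 0). now rewrite <- El.
    + apply (NoDup_remove_2 l1 l2 0). now rewrite <- El.
    + intros lam Hlam. rewrite <- Hl, El. rewrite !in_app_iff. simpl. split; [tauto|].
      intros [Q|[Q|Q]]; [now left|congruence|now right].
    + right. now apply gco_1_neq_0.
Qed.
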